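(* The assertion ''$Z_Q$ is determined by homology'' is not true for 2-complexes of Euler characteristic $\le 0$. Specifically, let $\mathcal A$ be a Lie family category over $R=\mathbb Z_{(p)}[v]$ satisfying conditions (a)–(d) of the context, with set $S$ of simple objects, so that $Z_Q$ is defined using a Gelfand–Kazhdan category. The 2-complexes $P=\langle x,y\mid xyx^{-1}y^{-1}\rangle$ and $P'=\langle x,y\mid\emptyset\rangle$, where $\emptyset$ denotes one trivial relation (the empty word), satisfy $$Z_Q(P)=|S|\in\mathbb Z/p\mathbb Z,\qquad Z_Q(P')=0,$$ where $|S|$ is the cardinality of $S$ (reduced mod $p$).
   Context: **Ring.** $p$ is a prime; $\mathbb Z_{(p)}$ is the ring of rationals with denominator prime to $p$; $R=\mathbb Z_{(p)}[v]/(1+v+\dots+v^{p-1})$; $\phi_p:R\to\mathbb Z/p\mathbb Z$ is the ring homomorphism which is reduction mod $p$ on $\mathbb Z_{(p)}$ and sends $v\mapsto 1$. **Semisimple tortile category over $R$.** An $R$-linear ribbon (tortile) category $\mathcal A$ with product written by juxtaposition, unit object $\mathbf 1$, associativity $\alpha$, braiding $\gamma_{A,B}:AB\to BA$, duals with coform $\Lambda_A:\mathbf 1\to A^*A$ and form $\lambda_A:AA^*\to\mathbf 1$ ($A^{**}$ identified with $A$), and twist $\theta_A:A\to A$. There is a finite set $S$ of representatives of simple objects, $\mathbf 1\in S$, with $\hom(a,a)=R\,\mathrm{id}_a$ and $\hom(a,b)=0$ for $a\ne b$ in $S$, and for $a,b\in S$ there are morphisms $inj_k(z,ab):z\to ab$,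 $proj_k(ab,z):ab\to z$ ($z\in S$, $1\le k\le \dim\hom(z,ab)$) with $proj_l\circ inj_k=\delta_{kl}\mathrm{id}_z$ and $\sum_{z,k}inj_k\circ proj_k=\mathrm{id}_{ab}$. The rank is $r_A=\lambda_A\Lambda_{A^*}\in\hom(\mathbf 1,\mathbf 1)=R$. For simple $a$, $\theta_a$ is identified with the scalar by which it acts. **Conditions (a)–(d).** (a) $X^2:=\sum_{a\in S}r_a^2$ is not a zero divisor; (b) $C_\pm:=\sum_{a\in S}r_a^2\theta_a^{\pm1}$ are not zero divisors; (c) for each $a\in S$, $a\neq\mathbf 1$, there are labeled tangle diagrams $D,D'$, each containing a closed component labeled $a$, which become equal when this component is deleted, but whose morphisms in $\mathcal A$ differ; (d) for each $a\in S$, $\theta_a=v^{t(a)}\mathrm{id}_a$ for some integer $t(a)$. **Lie family / Gelfand–Kazhdan category.** For a simple Lie algebra $\mathfrak g$ and a prime $p$ greater than its dual Coxeter number, the Lie family category $\mathcal A$ is the subquotient category, constructed by Gelfand–Kazhdan, of representations of Lusztig's quantum enveloping algebra of $\mathfrak g$ specialized at $v$, with coefficients in $\mathbb Z_{(p)}[v]$: simple objects are the Weyl modules with highest weight in the interior of the fundamental $p$-alcove (or a subset closed under product and duals, such as root-lattice weights), and the product is induced by tensor product. It is assumed to satisfy (a)–(d). Its reduction along $\phi_p$ is the Gelfand–Kazhdan category over $\mathbb Z/p\mathbb Z$. **Link evaluation.** Diagrams of framed tangles (blackboard framing) labeled by objects represent morphisms of $\mathcal A$ in the usual (Reshetikhin–Turaev,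 Shum) way; labels extend linearly to $R$-linear combinations of objects. For a framed link $L$, $Z(L)\in\hom(\mathbf 1,\mathbf 1)=R$ is the value of $L$ with every component labeled by $U=\sum_{a\in S}r_a\,a$. **Q-invariant.** A presentation $P=\langle x_1,\dots,x_n\mid R_1,\dots,R_m\rangle$ is regarded as a 2-complex with one 0-cell, 1-cells $x_k$ and 2-cells attached along the words $R_j$. Let $L_P$ be the framed link which is the closure (blackboard framing) of the braid $\psi_1(R_1)\cdots\psi_m(R_m)\in B_{n+m}$, where $y_j$ ($2\le j\le n+m$) is the braid generator interchanging strings $j-1$ and $j$, $r_{j,k}=y_{j+1}\cdots y_k$ for $j<k$, $r_{j,j}=1$, and $\psi_j:F_n\to B_{n+m}$ is the homomorphism $\psi_j(x_k)=r_{j,m+k-1}\,y_{m+k}^2\,r_{j,m+k-1}^{-1}$. Then $X^{-2n}Z(L_P)\in R$ and $Z_Q(P)=\phi_p(X^{-2n}Z(L_P))\in\mathbb Z/p\mathbb Z$; this is invariant under 2-deformations (deformations through 2-complexes).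
   Formalization: The formal theorem assumes |S| > 1 (for S = {1}, e.g. sl_2, p = 3, root-lattice weights, Z_Q(P') = 1, not 0), and states ''not determined by homology'' under |S| ≠ 0 mod p; it covers every semisimple tortile category over R satisfying (a)–(d). *)

(* Defs.v *)
(* MathComp, plus the classical choice function [xget] of MathComp-Analysis. *)
From HB Require Import structures.
From mathcomp Require Import all_boot all_order all_algebra.
From mathcomp Require Import boolp classical_sets.

Set Implicit Arguments.
Unset Strict Implicit.
Unset Printing Implicit Defensive.

Import GRing.Theory Num.Theory.
Local Open Scope ring_scope.

Definition zloc_pred (p : nat) : pred rat := fun x => coprime p `|denq x|%N.

Lemma zloc_predP p (x : rat) :
  reflect (exists d : nat, coprime p d /\ d%:R * x \is a Num.int)
          (zloc_pred p x).
Proof.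
apply: (iffP idP) => [cx|[d [cd /intrP[m dx]]]].
  exists `|denq x|%N; split=> //; apply/intrP; exists (numq x).
  by rewrite numqE mulrC -[in RHS]absz_denq.
apply: coprime_dvdr cd.
have cnd : coprime `|denq x| `|numq x| by rewrite coprime_sym coprime_num_den.
rewrite -(Gauss_dvdl _ cnd).
apply/dvdnP; exists `|m|%N; rewrite -abszM.
have -> : d = `|d%:Z|%N by [].
rewrite -!abszM; congr (`|_|%N).
apply/(@intr_inj rat); rewrite !rmorphM /= numqE -dx.
by rewrite -[d%:~R]/(d%:R : rat) -mulrA.
Qed.

Lemma zloc_subring_closed p : subring_closed (zloc_pred p).
Proof.
split=> [|x y /zloc_predP[d [cd dx]] /zloc_predP[e [ce ey]]|
          x y /zloc_predP[d [cd dx]] /zloc_predP[e [ce ey]]].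
- by apply/zloc_predP; exists 1%N; rewrite coprimen1 mulr1.
- apply/zloc_predP; exists (d * e)%N; split; first by rewrite coprimeMr cd.
  rewrite natrM mulrBr mulrAC -[_ * y]mulrA.
  by rewrite rpredB // rpredM // rpred_nat.
- apply/zloc_predP; exists (d * e)%N; split; first by rewrite coprimeMr cd.
  by rewrite natrM mulrACA rpredM.
Qed.

HB.instance Definition _ p :=
  GRing.isSubringClosed.Build rat (zloc_pred p) (@zloc_subring_closed p).

Record zloc (p : nat) :=
  Zloc { zloc_rat :> rat; zloc_ratP : zloc_rat \in zloc_pred p }.

HB.instance Definition _ p := [isSub for @zloc_rat p].
HB.instance Definition _ p := [Choice of zloc p by <:].
HB.instance Definition _ p := [SubChoice_isSubComNzRing of zloc p by <:].

Definition zred (p : nat) (x : zloc p) : 'F_p :=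
  (numq (val x))%:~R / (denq (val x))%:~R.

Definition cyclo (p : nat) : {poly zloc p} := \sum_(i < p) 'X^i.

Lemma cycloE p : (0 < p)%N -> cyclo p = \poly_(i < p) 1.
Proof. by move=> p0; rewrite poly_def; apply: eq_bigr => i _; rewrite scale1r. Qed.

Lemma size_cyclo p : (0 < p)%N -> size (cyclo p) = p.
Proof. by move=> p0; rewrite cycloE // size_poly_eq ?oner_neq0. Qed.

Lemma mk_monic_cyclo p : (1 < p)%N -> mk_monic (cyclo p) = cyclo p.
Proof.
move=> p1; have p0 : (0 < p)%N by apply: ltnW.
rewrite /mk_monic (size_cyclo p0) p1 monicE lead_coefE (size_cyclo p0).
by rewrite (cycloE p0) coef_poly ltn_predL p0 eqxx.
Qed.

Lemma zredE p (x : zloc p) (d : nat) (m : int) : prime p -> coprime p d ->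
  d%:R * val x = m%:~R -> zred x = m%:~R / d%:R.
Proof.
move=> pp cd dx; have pchp := pchar_Fp pp.
have unitF (k : nat) : coprime p k -> (k%:R : 'F_p) != 0.
  by move=> ck; rewrite -(dvdn_pcharf pchp) -prime_coprime.
have dE : (denq (val x))%:~R = (`|denq (val x)|%N)%:R :> 'F_p.
  by rewrite -[in LHS]absz_denq.
have cx : coprime p `|denq (val x)|%N by case: x {dx dE}.
rewrite /zred dE; apply/eqP; rewrite eqr_div ?unitF //; apply/eqP.
rewrite -dE -[d%:R]/(d%:~R) -!rmorphM /=; congr _%:~R.
apply/(@intr_inj rat); rewrite !rmorphM /= numqE -dx.
by rewrite mulrC mulrA.
Qed.

Lemma zred_rmorphism p : prime p ->
  [/\ zred (1 : zloc p) = 1, {morph @zred p : x y / x + y}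
    & {morph @zred p : x y / x * y}].
Proof.
move=> pp; have pchp := pchar_Fp pp.
have unitF (k : nat) : coprime p k -> (k%:R : 'F_p) != 0.
  by move=> ck; rewrite -(dvdn_pcharf pchp) -prime_coprime.
have zP (x : zloc p) : exists (d : nat) (m : int), coprime p d /\
    d%:R * val x = m%:~R.
  have /zloc_predP[d [cd /intrP[m dx]]] : zloc_pred p (val x) by case: x.
  by exists d, m.
split=> [|x y|x y].
- by rewrite (@zredE _ _ 1 1) ?coprimen1 ?divr1 // mulr1.
- have [d [m [cd dx]]] := zP x; have [e [n [ce ey]]] := zP y.
  rewrite (zredE pp cd dx) (zredE pp ce ey) addf_div ?unitF //.
  rewrite (@zredE _ _ (d * e) (m * e%:Z + n * d%:Z)) ?coprimeMr ?cd //.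
    by rewrite natrM !rmorphD !rmorphM.
  rewrite natrM intrD !intrM -dx -ey !pmulrn.
  rewrite [val (x + y)]/= mulrDr; congr (_ + _); first exact: mulrAC.
  by rewrite -mulrA mulrC.
- have [d [m [cd dx]]] := zP x; have [e [n [ce ey]]] := zP y.
  rewrite (zredE pp cd dx) (zredE pp ce ey) mulf_div.
  rewrite (@zredE _ _ (d * e) (m * n)) ?coprimeMr ?cd //.
    by rewrite natrM rmorphM.
  by rewrite natrM intrM -dx -ey mulrACA.
Qed.

(* [{poly %/ h}] is the quotient by [h] as soon as [h] is monic and not
   constant, which holds for [cyclo p] when [1 < p] (lemma [mk_monic_cyclo]). *)
Definition Rp (p : nat) : comNzRingType := {poly %/ cyclo p}.

Definition vp (p : nat) : Rp p := in_qpoly (cyclo p) 'X.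

(* Reduce the canonical representative at v = 1; see [phi_rmorphism]. *)
Definition phi (p : nat) (x : Rp p) : 'F_p :=
  zred (polyn x).[1].

Lemma vp_expr p : prime p -> vp p ^+ p = 1.
Proof.
move=> pp.
have -> : vp p ^+ p = in_qpoly (cyclo p) ('X^p).
  by rewrite (rmorphXn (in_qpoly (cyclo p) : {rmorphism _ -> Rp p})).
have -> : 'X^p = 1 + ('X - 1) * cyclo p :> {poly zloc p}.
  by rewrite -subrX1 addrC subrK.
suff c0 : in_qpoly (cyclo p) (cyclo p) = 0.
  by rewrite in_qpolyD in_qpolyM c0 mulr0 addr0 in_qpoly1.
have mc := mk_monic_cyclo (prime_gt1 pp); apply: val_inj => /=.
by rewrite mc Pdiv.RingMonic.rmodpp // -mc monic_mk_monic.
Qed.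

Lemma phi_rmorphism p : prime p ->
  [/\ phi (1 : Rp p) = 1, phi (vp p) = 1, {morph @phi p : x y / x + y}
    & {morph @phi p : x y / x * y}].
Proof.
move=> pp; have [r1 rD rM] := zred_rmorphism pp.
have cyc1 : zred (mk_monic (cyclo p)).[1] = 0.
  rewrite mk_monic_cyclo ?prime_gt1 // /cyclo horner_sum.
  have -> : \sum_(i < p) ('X^i).[1 : zloc p] = \sum_(i < p) 1.
    by apply: eq_bigr => i _; rewrite hornerXn expr1n.
  rewrite (zredE (d := 1) (m := p)) ?coprimen1 //; last first.
    by rewrite mul1r sumr_const card_ord rmorph_nat.
  rewrite divr1 -pmulrn; exact: pcharf0 (pchar_Fp pp).
have inP (P : {poly zloc p}) : phi (in_qpoly (cyclo p) P : Rp p) = zred P.[1].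
  have := Pdiv.RingMonic.rdivp_eq (monic_mk_monic (cyclo p)) P.
  move=> PE; rewrite [in RHS]PE hornerD hornerM rD rM cyc1 mulr0 add0r.
  by [].
split=> [||x y|x y].
- by rewrite /phi /= hornerC.
- by rewrite /vp inP hornerX.
- by rewrite /phi /= hornerD.
- have xyE : x * y = in_qpoly (cyclo p) (polyn x * polyn y) by [].
  by rewrite xyE inP hornerM rM.
Qed.

Declare Scope tortile_scope.
Local Open Scope tortile_scope.

Record linear_category (R : comNzRingType) := LinearCategory {
  ob :> Type;
  hom : ob -> ob -> lmodType R;
  idm : forall A, hom A A;
  comp : forall A B C, hom B C -> hom A B -> hom A C;
  comp1m : forall A B (f : hom A B), comp (idm B) f = f;
  compm1 : forall A B (f : hom A B), comp f (idm A) = f;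
  compA : forall A B C D (h : hom C D) (g : hom B C) (f : hom A B),
    comp h (comp g f) = comp (comp h g) f;
  comp_linl : forall A B C (f : hom A B), linear (fun g : hom B C => comp g f);
  comp_linr : forall A B C (g : hom B C), linear (fun f : hom A B => comp g f)
}.

Arguments idm {R l} A.
Arguments hom {R l} A B.
Notation "g ∘ f" := (comp g f) (at level 40, left associativity) : tortile_scope.

Record monoidal_category (R : comNzRingType) := MonoidalCategory {
  mcat :> linear_category R;
  one : mcat;
  tens : mcat -> mcat -> mcat;
  tensm : forall A B A' B' : mcat,
    hom A A' -> hom B B' -> hom (tens A B) (tens A' B');
  tens_id : forall A B, tensm (idm A) (idm B) = idm (tens A B);
  tens_comp : forall (A B C A' B' C' : mcat) (g : hom B C) (f : hom A B)
      (g' : hom B' C') (f' : hom A' B'),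
    tensm (g ∘ f) (g' ∘ f') = tensm g g' ∘ tensm f f';
  tens_linl : forall (A B A' B' : mcat) (g : hom B B'),
    linear (fun f : hom A A' => tensm f g);
  tens_linr : forall (A B A' B' : mcat) (f : hom A A'),
    linear (fun g : hom B B' => tensm f g);
  assoc : forall A B C, hom (tens (tens A B) C) (tens A (tens B C));
  assocV : forall A B C, hom (tens A (tens B C)) (tens (tens A B) C);
  lunit : forall A, hom (tens one A) A;
  lunitV : forall A, hom A (tens one A);
  runit : forall A, hom (tens A one) A;
  runitV : forall A, hom A (tens A one);
  assocK : forall A B C, assocV A B C ∘ assoc A B C = idm _;
  assocVK : forall A B C, assoc A B C ∘ assocV A B C = idm _;
  lunitK : forall A, lunitV A ∘ lunit A = idm _;
  lunitVK : forall A, lunit A ∘ lunitV A = idm _;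
  runitK : forall A, runitV A ∘ runit A = idm _;
  runitVK : forall A, runit A ∘ runitV A = idm _;
  assoc_nat : forall (A B C A' B' C' : mcat)
      (f : hom A A') (g : hom B B') (h : hom C C'),
    assoc A' B' C' ∘ tensm (tensm f g) h = tensm f (tensm g h) ∘ assoc A B C;
  lunit_nat : forall (A B : mcat) (f : hom A B),
    lunit B ∘ tensm (idm one) f = f ∘ lunit A;
  runit_nat : forall (A B : mcat) (f : hom A B),
    runit B ∘ tensm f (idm one) = f ∘ runit A;
  pentagon : forall A B C D,
    assoc A B (tens C D) ∘ assoc (tens A B) C D =
    tensm (idm A) (assoc B C D) ∘ assoc A (tens B C) D
      ∘ tensm (assoc A B C) (idm D);
  triangle : forall A B,
    tensm (idm A) (lunit B) ∘ assoc A one B = tensm (runit A) (idm B)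
}.

Arguments one {R m}.
Notation "A ⊗ B" := (tens A B) (at level 35, right associativity)
  : tortile_scope.
Notation "f ⊠ g" := (tensm f g) (at level 35, right associativity)
  : tortile_scope.

Record tortile_category (R : comNzRingType) := TortileCategory {
  tcat :> monoidal_category R;
  braid : forall A B : tcat, hom (A ⊗ B) (B ⊗ A);
  braidV : forall A B : tcat, hom (B ⊗ A) (A ⊗ B);
  braidK : forall A B, braidV A B ∘ braid A B = idm _;
  braidVK : forall A B, braid A B ∘ braidV A B = idm _;
  braid_nat : forall (A B A' B' : tcat) (f : hom A A') (g : hom B B'),
    braid A' B' ∘ (f ⊠ g) = (g ⊠ f) ∘ braid A B;
  hexagon : forall A B C,
    assoc B C A ∘ braid A (B ⊗ C) ∘ assoc A B C =
    (idm B ⊠ braid A C) ∘ assoc B A C ∘ (braid A B ⊠ idm C);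
  hexagonV : forall A B C,
    assocV C A B ∘ braid (A ⊗ B) C ∘ assocV A B C =
    (braid A C ⊠ idm B) ∘ assocV A C B ∘ (idm A ⊠ braid B C);
  dual : tcat -> tcat;
  coform : forall A, hom one (dual A ⊗ A);
  form : forall A, hom (A ⊗ dual A) one;
  form_coform : forall A,
    lunit A ∘ (form A ⊠ idm A) ∘ assocV A (dual A) A ∘ (idm A ⊠ coform A) =
    runit A;
  coform_form : forall A,
    runit (dual A) ∘ (idm (dual A) ⊠ form A) ∘ assoc (dual A) A (dual A)
      ∘ (coform A ⊠ idm (dual A)) = lunit (dual A);
  twist : forall A : tcat, hom A A;
  twistV : forall A : tcat, hom A A;
  twistK : forall A, twistV A ∘ twist A = idm A;
  twistVK : forall A, twist A ∘ twistV A = idm A;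
  twist_nat : forall (A B : tcat) (f : hom A B), twist B ∘ f = f ∘ twist A;
  twist_tens : forall A B,
    twist (A ⊗ B) = braid B A ∘ braid A B ∘ (twist A ⊠ twist B);
  twist_dual : forall A,
    (twist (dual A) ⊠ idm A) ∘ coform A = (idm (dual A) ⊠ twist A) ∘ coform A
}.

Section Tortile.

Variables (R : comNzRingType) (T : tortile_category R).

(* The form and coform of [dual A], once [dual (dual A)] is identified with [A]
   by the canonical isomorphism of a tortile category, in terms of the twist. *)
Definition coform_dual (A : T) : hom one (A ⊗ dual A) :=
  (twist A ⊠ idm (dual A)) ∘ braid (dual A) A ∘ coform A.

Definition form_dual (A : T) : hom (dual A ⊗ A) one :=
  form A ∘ braid (dual A) A ∘ (idm (dual A) ⊠ twist A).

(* The scalar [c] with [f = c id]; it exists and is unique when [A] is simple. *)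
Definition scalar (A : T) (f : hom A A) : R :=
  xget 0 [set c | f = c *: idm A]%classic.

Definition rank (A : T) : R := scalar (form A ∘ coform_dual A).

End Tortile.

(* Decomposability is required of every object, not only of products of two
   simple objects. *)
Record semisimple (R : comNzRingType) (T : tortile_category R) := Semisimple {
  simple : finType;
  sobj : simple -> T;
  sone : simple;
  sobj_one : sobj sone = one;
  simple_end : forall a (f : hom (sobj a) (sobj a)),
    exists c : R, f = c *: idm (sobj a);
  simple_free : forall a (c : R), c *: idm (sobj a) = 0 -> c = 0;
  simple_schur : forall a b (f : hom (sobj a) (sobj b)), a != b -> f = 0;
  simple_decomp : forall A : T, exists (d : simple -> nat)
      (inj : forall z, 'I_(d z) -> hom (sobj z) A)
      (proj : forall z, 'I_(d z) -> hom A (sobj z)),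
    (forall z k l, proj z l ∘ inj z k = if k == l then idm (sobj z) else 0) /\
    \sum_z \sum_(k < d z) inj z k ∘ proj z k = idm A
}.

Section Diagrams.

Variable L : Type.

(* A strand labelled [A] and oriented along the diagram is [(A, false)], and
   [(A, true)] if it is oriented backwards. *)
Definition word := seq (L * bool).
Definition flip (x : L * bool) : L * bool := (x.1, ~~ x.2).

(* A diagram is a sequence of slices with one crossing, minimum or maximum each;
   [cross true] is the crossing which represents the braiding, whatever the
   orientations, and [cross false] the one which represents its inverse. *)
Inductive step : word -> word -> Type :=
| cross (s : bool) x y w : step (x :: y :: w) (y :: x :: w)
| cup x w : step w (flip x :: x :: w)
| cap x w : step (x :: flip x :: w) w
| skip x w w' : step w w' -> step (x :: w) (x :: w').

Inductive diagram : word -> word -> Type :=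
| dnil w : diagram w w
| dcons w w' w'' : step w w' -> diagram w' w'' -> diagram w w''.

Definition dstep w w' (s : step w w') : diagram w w' := dcons s (dnil w').

Fixpoint dcat w w' w'' (D : diagram w w') : diagram w' w'' -> diagram w w'' :=
  match D in diagram w w' return diagram w' w'' -> diagram w w'' with
  | dnil _ => id
  | dcons _ _ _ s D' => fun E => dcons s (dcat D' E)
  end.

Fixpoint dskip x w w' (D : diagram w w') : diagram (x :: w) (x :: w') :=
  match D in diagram w w' return diagram (x :: w) (x :: w') with
  | dnil w => dnil (x :: w)
  | dcons _ _ _ s D' => dcons (skip x s) (dskip x D')
  end.

(* Which ends of strands are joined inside a slice: [(false, i)] is the i-th end
   on the source side and [(true, i)] the i-th end on the target side. *)
Fixpoint step_links w w' (s : step w w')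
    : seq ((bool * nat) * (bool * nat)) :=
  match s with
  | cross _ _ _ w => [:: ((false, 0), (true, 1)), ((false, 1), (true, 0)) &
                      [seq ((false, k.+2), (true, k.+2)) | k <- iota 0 (size w)]]
  | cup _ w => ((true, 0), (true, 1)) ::
               [seq ((false, k), (true, k.+2)) | k <- iota 0 (size w)]
  | cap _ w => ((false, 0), (false, 1)) ::
               [seq ((false, k.+2), (true, k)) | k <- iota 0 (size w)]
  | skip _ _ _ s => ((false, 0), (true, 0)) ::
      [seq ((e.1.1, e.1.2.+1), (e.2.1, e.2.2.+1)) | e <- step_links s]
  end%N.

(* The vertex [(h, i)] is the i-th strand between the h-th slice and the previous
   one. *)
Fixpoint diagram_links (h : nat) w w' (D : diagram w w')
    : seq ((nat * nat) * (nat * nat)) :=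
  match D with
  | dnil _ => [::]
  | dcons _ _ _ s D' =>
      [seq ((h + nat_of_bool e.1.1, e.1.2), (h + nat_of_bool e.2.1, e.2.2))
      | e <- step_links s]
      ++ diagram_links h.+1 D'
  end%N.

Fixpoint levels w w' (D : diagram w w') : seq word :=
  match D with
  | dnil w => [:: w]
  | dcons w _ _ _ D' => w :: levels D'
  end.

Definition same_component w w' (D : diagram w w') (u v : nat * nat) : Prop :=
  let E := diagram_links 0 D in
  exists q, path [rel a b | ((a, b) \in E) || ((b, a) \in E)] u q
            /\ last u q = v.

End Diagrams.

Arguments dnil {L} w.

Section Deletion.

Variable L : Type.

(* Over the labels [option L], the label [None] marks the strands which are to be
   deleted. *)
Definition mark (w : word L) : word (option L) :=
  [seq (Some x.1, x.2) | x <- w].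

Definition marked w w' (D : diagram (L := option L) w w') (u : nat * nat)
    : bool :=
  if onth (nth [::] (levels D) u.1) u.2 is Some (None, _) then true else false.

(* The marked strands form exactly one component; it is closed, since no strand
   on the boundary is marked. *)
Definition marks_closed_component s t (D : diagram (mark s) (mark t)) : Prop :=
  (exists u, marked D u) /\
  (forall u v, marked D u -> marked D v -> same_component D u v).

Fixpoint erase (w : word (option L)) : word L :=
  match w with
  | [::] => [::]
  | (Some A, b) :: w => (A, b) :: erase w
  | (None, _) :: w => erase w
  end.

Fixpoint erase_step w w' (s : step w w') : diagram (erase w) (erase w') :=
  match s in step w w' return diagram (erase w) (erase w') with
  | cross s (oA, a) (oB, b) w =>
      match oA, oB return diagram (erase ((oA, a) :: (oB, b) :: w))
                                  (erase ((oB, b) :: (oA, a) :: w)) with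
      | Some A, Some B => dstep (cross s (A, a) (B, b) (erase w))
      | Some A, None => dnil ((A, a) :: erase w)
      | None, Some B => dnil ((B, b) :: erase w)
      | None, None => dnil (erase w)
      end
  | cup (oA, a) w =>
      match oA return diagram (erase w)
                              (erase (flip (oA, a) :: (oA, a) :: w)) with
      | Some A => dstep (cup (A, a) (erase w))
      | None => dnil (erase w)
      end
  | cap (oA, a) w =>
      match oA return diagram (erase ((oA, a) :: flip (oA, a) :: w))
                              (erase w) with
      | Some A => dstep (cap (A, a) (erase w))
      | None => dnil (erase w)
      end
  | skip (oA, a) w w' s =>
      match oA return diagram (erase ((oA, a) :: w)) (erase ((oA, a) :: w')) with
      | Some A => dskip (A, a) (erase_step s)
      | None => erase_step s
      end
  end.

Fixpoint erase_diagram w w' (D : diagram w w')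
    : diagram (erase w) (erase w') :=
  match D in diagram w w' return diagram (erase w) (erase w') with
  | dnil w => dnil (erase w)
  | dcons _ _ _ s D' => dcat (erase_step s) (erase_diagram D')
  end.

End Deletion.

Section Evaluation.

Variables (R : comNzRingType) (T : tortile_category R) (L : Type) (lab : L -> T).

Definition strand (x : L * bool) : T := if x.2 then dual (lab x.1) else lab x.1.

(* Words are bracketed to the right: x1 (x2 (... (xn 1))). *)
Definition wob (w : word L) : T := foldr (fun x B => strand x ⊗ B) one w.

Definition crossm (s : bool) (A B : T) : hom (A ⊗ B) (B ⊗ A) :=
  if s then braid A B else braidV B A.

Definition cupm (x : L * bool) : hom one (strand (flip x) ⊗ strand x) :=
  match x with
  | (A, false) => coform (lab A)
  | (A, true) => coform_dual (lab A)
  end.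

Definition capm (x : L * bool) : hom (strand x ⊗ strand (flip x)) one :=
  match x with
  | (A, false) => form (lab A)
  | (A, true) => form_dual (lab A)
  end.

Fixpoint eval_step w w' (s : step w w') : hom (wob w) (wob w') :=
  match s in step w w' return hom (wob w) (wob w') with
  | cross s x y w =>
      assoc (strand y) (strand x) (wob w)
      ∘ (crossm s (strand x) (strand y) ⊠ idm (wob w))
      ∘ assocV (strand x) (strand y) (wob w)
  | cup x w =>
      assoc (strand (flip x)) (strand x) (wob w)
      ∘ (cupm x ⊠ idm (wob w)) ∘ lunitV (wob w)
  | cap x w =>
      lunit (wob w) ∘ (capm x ⊠ idm (wob w))
      ∘ assocV (strand x) (strand (flip x)) (wob w)
  | skip x _ _ s => idm (strand x) ⊠ eval_step s
  end.

Fixpoint eval w w' (D : diagram w w') : hom (wob w) (wob w') :=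
  match D in diagram w w' return hom (wob w) (wob w') with
  | dnil w => idm (wob w)
  | dcons _ _ _ s D' => eval D' ∘ eval_step s
  end.

End Evaluation.

Section Conditions.

Variables (R : comNzRingType) (T : tortile_category R) (S : semisimple T).

Definition srank (a : simple S) : R := rank (sobj a).

Definition X2 : R := \sum_a srank a ^+ 2.
Definition Cplus : R := \sum_a srank a ^+ 2 * scalar (twist (sobj a)).
Definition Cminus : R := \sum_a srank a ^+ 2 * scalar (twistV (sobj a)).

Definition nonzerodivisor (x : R) : Prop := GRing.lreg x.

(* Strands other than those of the distinguished component may be labelled by
   arbitrary objects. *)
Definition detected (a : simple S) : Prop :=
  exists (s t : word T) (D D' : diagram (mark s) (mark t)),
    [/\ marks_closed_component D, marks_closed_component D',
        erase_diagram D = erase_diagram D' &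
        eval (odflt (sobj a)) D <> eval (odflt (sobj a)) D'].

(* For [v = vp p] the integer powers of [v] are its natural powers, by
   [vp_expr]. *)
Definition twists_are_powers (v : R) : Prop :=
  forall a : simple S, exists t : nat, twist (sobj a) = v ^+ t *: idm (sobj a).

Definition conditions_abcd (v : R) : Prop :=
  [/\ nonzerodivisor X2,
      nonzerodivisor Cplus /\ nonzerodivisor Cminus,
      forall a : simple S, a != sone S -> detected a &
      twists_are_powers v].

End Conditions.

(* The letter [(j, b)] is y_j, or its inverse if [b]; y_j interchanges the strings
   j-1 and j, numbered from 1. *)
Definition braid_word := seq (nat * bool).

Definition braid_inv (u : braid_word) : braid_word :=
  rev [seq (g.1, ~~ g.2) | g <- u].

Section BraidDiagrams.

Variable L : Type.

Fixpoint swap_at (k : nat) (l : seq L) : seq L :=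
  match k, l with
  | 0, x :: y :: l' => [:: y, x & l']
  | k'.+1, x :: l' => x :: swap_at k' l'
  | _, _ => l
  end%N.

Lemma swap_atK k : involutive (swap_at k).
Proof. by elim: k => [|k IH] [|x [|y l]] //=; rewrite IH. Qed.

Definition upward (l : seq L) : word L := [seq (x, false) | x <- l].

Fixpoint swap_diagram (s : bool) (k : nat) (l : seq L)
    : diagram (upward l) (upward (swap_at k l)) :=
  match k, l return diagram (upward l) (upward (swap_at k l)) with
  | 0, x :: y :: l' => dstep (cross s (x, false) (y, false) (upward l'))
  | k'.+1, x :: l' => dskip (x, false) (swap_diagram s k' l')
  | k, l => dnil (upward l)
  end%N.

Fixpoint braid_act (u : braid_word) (l : seq L) : seq L :=
  if u is g :: u' then braid_act u' (swap_at g.1.-2 l) else l.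

Fixpoint braid_diagram (u : braid_word) (l : seq L)
    : diagram (upward l) (upward (braid_act u l)) :=
  match u with
  | [::] => dnil (upward l)
  | g :: u' => dcat (swap_diagram (~~ g.2) g.1.-2 l)
                    (braid_diagram u' (swap_at g.1.-2 l))
  end.

Lemma braid_act_cat u1 u2 l :
  braid_act (u1 ++ u2) l = braid_act u2 (braid_act u1 l).
Proof. by elim: u1 l => //= g u1 IH l. Qed.

Lemma braid_act_inv u l : braid_act (braid_inv u) (braid_act u l) = l.
Proof.
elim: u l => //= g u IH l.
by rewrite /braid_inv /= rev_cons -cats1 braid_act_cat IH /= swap_atK.
Qed.

(* The first string is the innermost one in the closure. *)
Fixpoint braid_closure (l : seq L)
    : diagram (upward l) (upward l) -> diagram [::] [::] :=
  match l return diagram (upward l) (upward l) -> diagram [::] [::] with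
  | [::] => id
  | x :: l' => fun D =>
      braid_closure
        (dcat (dstep (cup (x, false) (upward l')))
        (dcat (dskip (x, true) D) (dstep (cap (x, true) (upward l')))))
  end.

End BraidDiagrams.

(* A letter [(k, b)] of a relator is the generator of index [k], numbered from 0,
   or its inverse if [b]. *)
Record presentation := Presentation {
  ngen : nat;
  relators : seq (seq ('I_ngen * bool))
}.

Definition nrel (P : presentation) : nat := size (relators P).

Definition rbraid (j k : nat) : braid_word :=
  [seq (i, false) | i <- iota j.+1 (k - j)].

(* psi_j(x_k), with k numbered from 1. *)
Definition psi_gen (m j k : nat) : braid_word :=
  rbraid j (m + k).-1 ++ [:: (m + k, false); (m + k, false)]%N
  ++ braid_inv (rbraid j (m + k).-1).

Definition psi (m j n : nat) (w : seq ('I_n * bool)) : braid_word :=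
  flatten [seq let u := psi_gen m j x.1.+1 in if x.2 then braid_inv u else u
          | x : 'I_n * bool <- w].

Definition link_braid (P : presentation) : braid_word :=
  flatten [seq psi (nrel P) jr.1 jr.2
          | jr <- zip (iota 1 (nrel P)) (relators P)].

Lemma link_braid_pure P L (l : seq L) : braid_act (link_braid P) l = l.
Proof.
have flatP (I : Type) (F : I -> braid_word) s :
    (forall i l', braid_act (F i) l' = l' :> seq L) ->
    forall l', braid_act (flatten [seq F i | i <- s]) l' = l' :> seq L.
  by move=> FP; elim: s => //= i s IH l'; rewrite braid_act_cat FP IH.
have invP u : (forall l', braid_act u l' = l' :> seq L) ->
    forall l', braid_act (braid_inv u) l' = l' :> seq L.
  by move=> uP l'; rewrite -{1}(uP l') braid_act_inv.
have genP m j k l' : braid_act (psi_gen m j k) l' = l' :> seq L.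
  by rewrite !braid_act_cat /= swap_atK braid_act_inv.
apply: (flatP) => -[j w] /=; apply: (flatP) => -[k [|]] /= l' //.
exact/invP/genP.
Qed.

(* L_P, its components (one per string, the braid being pure) labelled by [l]. *)
Definition link (P : presentation) (L : Type) (l : seq L)
    : diagram (L := L) [::] [::] :=
  braid_closure (eq_rect _ (fun l' => diagram (upward l) (upward l'))
                   (braid_diagram (link_braid P) l) _ (link_braid_pure P l)).

(* Multilinear expansion of the value of L_P with every component labelled by
   U = sum_a r_a a. *)
Definition Zlink (R : comNzRingType) (T : tortile_category R) (S : semisimple T)
    (P : presentation) : R :=
  \sum_(c : (ngen P + nrel P).-tuple (simple S))
    (\prod_(a <- c) srank a)
    * scalar (eval (@sobj _ _ S) (link P c) : hom (l := T) one one).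

(* Z_Q(P) is defined and equal to [z]; the element X^(-2n) Z(L_P) of R, called
   [q] here, is unique when X^2 is not a zero divisor. *)
Definition has_ZQ (p : nat) (T : tortile_category (Rp p)) (S : semisimple T)
    (P : presentation) (z : 'F_p) : Prop :=
  exists2 q : Rp p, X2 S ^+ ngen P * q = Zlink S P & phi q = z.

Definition euler_char (P : presentation) : int := 1 - (ngen P)%:Z + (nrel P)%:Z.

Definition exponent_sum n (w : seq ('I_n * bool)) (k : 'I_n) : int :=
  \sum_(x <- w | x.1 == k) (-1) ^+ x.2.

(* The cellular boundary C_2 -> C_1; the boundary C_1 -> C_0 is zero. *)
Definition boundary2 (P : presentation) : 'M[int]_(nrel P, ngen P) :=
  \matrix_(j, k) exponent_sum (nth [::] (relators P) j) k.

(* Z/B and Z'/B' are isomorphic abelian groups: [f] and [g] induce inverse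
   homomorphisms. *)
Definition subquotient_iso (U V : zmodType) (Z B : U -> Prop) (Z' B' : V -> Prop)
    : Prop :=
  exists (f : U -> V) (g : V -> U),
    [/\ forall x, Z x -> Z' (f x) /\ B (g (f x) - x),
        forall y, Z' y -> Z (g y) /\ B' (f (g y) - y),
        forall x x', Z x -> Z x' -> B' (f (x + x') - (f x + f x')),
        forall x, B x -> B' (f x) &
        forall y, B' y -> B (g y)].

(* H_0 is Z for every presentation complex. *)
Definition same_homology (P P' : presentation) : Prop :=
  subquotient_iso (U := 'rV[int]_(ngen P)) (V := 'rV[int]_(ngen P'))
    (fun=> True) (fun x => exists c, x = c *m boundary2 P)
    (fun=> True) (fun x => exists c, x = c *m boundary2 P') /\
  subquotient_iso (U := 'rV[int]_(nrel P)) (V := 'rV[int]_(nrel P'))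
    (fun c => c *m boundary2 P = 0) (fun c => c = 0)
    (fun c => c *m boundary2 P' = 0) (fun c => c = 0).

Definition ZQ_determined_by_homology (p : nat) (T : tortile_category (Rp p))
    (S : semisimple T) (complexes : presentation -> Prop) : Prop :=
  forall P P' z z', complexes P -> complexes P' -> same_homology P P' ->
    has_ZQ S P z -> has_ZQ S P' z' -> z = z'.

(* < x, y | x y x^-1 y^-1 > and < x, y | 1 > *)
Definition P_commutator : presentation :=
  @Presentation 2 [:: [:: (0, false); (1, false); (0, true); (1, true)]].

Definition P_trivial : presentation := @Presentation 2 [:: [::]].

(* Main.v *)
(* Write K_a for the operator which encircles a simple strand a by a loop labelled
   U.  Decomposing b c into simple objects shows that a strand slides over such a
   loop (handle slide).  Hence K_a = k id, and k annihilates the double braiding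
   of a with any object minus the identity; R being a domain, either K_a = 0 or a
   is transparent.  If a is transparent, the handle slide of the twist gives
   C_+ (theta_a - 1) = 0, so theta_a = 1; then a closed component labelled a can be
   unknotted and unlinked from everything and contributes only the factor r_a,
   which contradicts condition (c).  So K_a = 0 for all a <> 1.

   Consequently two opposite U-loops around a strand cut it.  For the commutator
   relator, L_P is the closure of a commutator of pure braids; cutting one component
   leaves X^2 sum_(b,c) r_c^2 s(b,c) s'(b,c), where r_c s(b,c) is the
   Hopf link and s' its mirror, and cutting once more makes the inner sum X^2 for
   each b: Z(L_P) = X^4 |S|.  The trivial relator gives Z = X^6, and phi(X^2) = 0
   since mod p all twists become 1, so K_a = 0 reduces to r_a phi(X^2) = 0 with
   r_a invertible. *)
From mathcomp Require Import all_boot all_order all_algebra all_field.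
From mathcomp Require Import boolp classical_sets zify ring.
Require Import Defs.

Set Implicit Arguments.
Unset Strict Implicit.
Unset Printing Implicit Defensive.

Import GRing.Theory.
Local Open Scope ring_scope.
Local Open Scope tortile_scope.

Notation "A ◁ f" := (idm A ⊠ f) (at level 35, right associativity) : tortile_scope.

(** A diagram is a sequence of slices and its value their composite, so the unknotting of a
    transparent component has to be carried out inside the category. The marked strands are pulled
    in front of all others. Then an induction on slices shows that at each level they are arcs made
    by cups and permuted afterwards: crossings of a transparent object have no sign, and curls
    disappear because its twist is trivial. The factor $r_a$ appears when a cap joins the two ends
    of one arc, and connectedness of the component makes this happen exactly once.

    Invertibility of the ranks enters twice: the handle slide rests on a resolution of the identity
    with weights $r_b/r_a$, and $\phi_p(r_a)\ne0$ is what yields $\phi_p(X^2)=0$. The latter needs a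
    simple object other than $\mathbf 1$; for $S=\{\mathbf 1\}$ one has $X^2=1$.

    The double braidings of $a,b$ and of $b,c$ have to be exhibited in the commutator link before
    [b] can be cut, since its defining braid word uses instead a strand that travels around the
    other two. *)

Section LinearCategory.
Variables (R : comNzRingType) (T : linear_category R).
Implicit Types A B C D : T.

(** Composites are mostly kept nested to the right. An equation between composites of two adjacent
    factors is used in front of a tail [z], which spares explicit reassociation. *)
Lemma compE A B C D (g : hom B C) (f : hom A B) (h : hom A C) (z : hom D A) :
  g ∘ f = h -> g ∘ (f ∘ z) = h ∘ z.
Proof. by move=> <-; rewrite compA. Qed.

Lemma compEE A B B' C D (g : hom B C) (f : hom A B) (g' : hom B' C) (f' : hom A B')
    (z : hom D A) :
  g ∘ f = g' ∘ f' -> g ∘ (f ∘ z) = g' ∘ (f' ∘ z).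
Proof. by rewrite !compA => ->. Qed.

Lemma compDl A B C (g g' : hom B C) (f : hom A B) :
  (g + g') ∘ f = g ∘ f + g' ∘ f.
Proof. by have := comp_linl f 1 g g'; rewrite !scale1r. Qed.
Lemma compDr A B C (g : hom B C) (f f' : hom A B) :
  g ∘ (f + f') = g ∘ f + g ∘ f'.
Proof. by have := comp_linr g 1 f f'; rewrite !scale1r. Qed.
Lemma comp0l A B C (f : hom A B) : (0 : hom B C) ∘ f = 0.
Proof. by apply: (@addrI _ (0 ∘ f)); rewrite -compDl !addr0. Qed.
Lemma comp0r A B C (g : hom B C) : g ∘ (0 : hom A B) = 0.
Proof. by apply: (@addrI _ (g ∘ 0)); rewrite -compDr !addr0. Qed.
Lemma compZl A B C c (g : hom B C) (f : hom A B) : (c *: g) ∘ f = c *: (g ∘ f).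
Proof. by have := comp_linl f c g 0; rewrite !addr0 comp0l addr0. Qed.
Lemma compZr A B C c (g : hom B C) (f : hom A B) : g ∘ (c *: f) = c *: (g ∘ f).
Proof. by have := comp_linr g c f 0; rewrite !addr0 comp0r addr0. Qed.
Lemma comp_suml (I : Type) r (P : pred I) A B C (F : I -> hom B C) (f : hom A B) :
  (\sum_(i <- r | P i) F i) ∘ f = \sum_(i <- r | P i) F i ∘ f.
Proof. by apply: (big_morph (fun g : hom B C => g ∘ f)) => [g g'|]; rewrite ?compDl ?comp0l. Qed.
Lemma comp_sumr (I : Type) r (P : pred I) A B C (F : I -> hom A B) (g : hom B C) :
  g ∘ (\sum_(i <- r | P i) F i) = \sum_(i <- r | P i) g ∘ F i.
Proof. by apply: (big_morph (fun f : hom A B => g ∘ f)) => [f f'|]; rewrite ?compDr ?comp0r. Qed.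

Lemma comp_injl A B C (f : hom B C) (g : hom C B) (x y : hom A B) :
  g ∘ f = idm _ -> f ∘ x = f ∘ y -> x = y.
Proof. by move=> gf e; rewrite -[x]comp1m -[y]comp1m -gf -!compA e. Qed.
Lemma comp_injr A B C (f : hom A B) (g : hom B A) (x y : hom B C) :
  f ∘ g = idm _ -> x ∘ f = y ∘ f -> x = y.
Proof. by move=> fg e; rewrite -[x]compm1 -[y]compm1 -fg !compA e. Qed.
End LinearCategory.

(** * Calculus with tails *)

Section Monoidal.
Variables (R : comNzRingType) (T : monoidal_category R).
Implicit Types A B C D P Q W : T.

Lemma tensDl A B A' B' (f f' : hom A A') (g : hom B B') :
  (f + f') ⊠ g = f ⊠ g + f' ⊠ g :> hom (A ⊗ B) (A' ⊗ B').
Proof. by have := tens_linl g 1 f f'; rewrite !scale1r. Qed.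
Lemma tensDr A B A' B' (f : hom A A') (g g' : hom B B') :
  f ⊠ (g + g') = f ⊠ g + f ⊠ g' :> hom (A ⊗ B) (A' ⊗ B').
Proof. by have := tens_linr f 1 g g'; rewrite !scale1r. Qed.
Lemma tens0l A B A' B' (g : hom B B') : (0 : hom A A') ⊠ g = 0 :> hom (A ⊗ B) (A' ⊗ B').
Proof. by apply: (@addrI _ (0 ⊠ g)); rewrite -tensDl !addr0. Qed.
Lemma tens0r A B A' B' (f : hom A A') : f ⊠ (0 : hom B B') = 0 :> hom (A ⊗ B) (A' ⊗ B').
Proof. by apply: (@addrI _ (f ⊠ 0)); rewrite -tensDr !addr0. Qed.
Lemma tensZl A B A' B' c (f : hom A A') (g : hom B B') :
  (c *: f) ⊠ g = c *: (f ⊠ g) :> hom (A ⊗ B) (A' ⊗ B').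
Proof. by have := tens_linl g c f 0; rewrite !addr0 tens0l addr0. Qed.
Lemma tensZr A B A' B' c (f : hom A A') (g : hom B B') :
  f ⊠ (c *: g) = c *: (f ⊠ g) :> hom (A ⊗ B) (A' ⊗ B').
Proof. by have := tens_linr f c g 0; rewrite !addr0 tens0r addr0. Qed.
Lemma tens_suml (I : Type) r (P : pred I) A B A' B' (F : I -> hom A A') (g : hom B B') :
  (\sum_(i <- r | P i) F i) ⊠ g = \sum_(i <- r | P i) F i ⊠ g :> hom (A ⊗ B) (A' ⊗ B').
Proof. by apply: (big_morph (fun f : hom A A' => f ⊠ g)) => [f f'|]; rewrite ?tensDl ?tens0l. Qed.
Lemma tens_sumr (I : Type) r (P : pred I) A B A' B' (f : hom A A') (F : I -> hom B B') :
  f ⊠ (\sum_(i <- r | P i) F i) = \sum_(i <- r | P i) f ⊠ F i :> hom (A ⊗ B) (A' ⊗ B').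
Proof. by apply: (big_morph (fun g : hom B B' => f ⊠ g)) => [g g'|]; rewrite ?tensDr ?tens0r. Qed.

Lemma whisker A B C D (g : hom C D) (f : hom B C) : A ◁ (g ∘ f) = (A ◁ g) ∘ (A ◁ f).
Proof. by rewrite -tens_comp comp1m. Qed.
Lemma rwhisker A B C D (g : hom C D) (f : hom B C) :
  (g ∘ f) ⊠ idm A = (g ⊠ idm A) ∘ (f ⊠ idm A).
Proof. by rewrite -tens_comp comp1m. Qed.
Lemma tens_split A B C D (f : hom A B) (g : hom C D) :
  (f ⊠ idm D) ∘ (A ◁ g) = f ⊠ g.
Proof. by rewrite -tens_comp compm1 comp1m. Qed.
Lemma interchange A B C D (f : hom A B) (g : hom C D) :
  (f ⊠ idm D) ∘ (A ◁ g) = (B ◁ g) ∘ (f ⊠ idm C).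
Proof. by rewrite -!tens_comp !compm1 !comp1m. Qed.

Lemma assocV_nat A B C A' B' C' (f : hom A A') (g : hom B B') (h : hom C C') :
  assocV A' B' C' ∘ (f ⊠ (g ⊠ h)) = ((f ⊠ g) ⊠ h) ∘ assocV A B C.
Proof.
apply: (comp_injl (f := assoc A' B' C') (assocK _ _ _)).
rewrite !compA assocVK comp1m assoc_nat -compA assocVK compm1 //.
Qed.

Lemma lunitV_nat A B (f : hom A B) : lunitV B ∘ f = (idm one ⊠ f) ∘ lunitV A.
Proof.
apply: (comp_injl (f := lunit B) (lunitK _)).
by rewrite !compA lunitVK comp1m lunit_nat -compA lunitVK compm1.
Qed.
Lemma one_faithful A B (f g : hom A B) : idm (@one _ T) ⊠ f = idm (@one _ T) ⊠ g -> f = g.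
Proof.
move=> e; apply: (comp_injr (f := lunit A) (lunitVK _)).
by rewrite -!lunit_nat e.
Qed.

(** Kelly's argument: tensoring with the unit on the left is faithful, and after doing so the
    identity follows from the pentagon and the triangle. *)
Lemma lunit_assoc A B : lunit (A ⊗ B) ∘ assoc one A B = lunit A ⊠ idm B.
Proof.
apply: one_faithful.
have K : assoc one (one ⊗ A) B ∘ (assoc one one A ⊠ idm B)
       ∘ ((assocV one one A ⊠ idm B) ∘ assocV one (one ⊗ A) B) = idm _.
  by rewrite -compA (compE (h:=idm _) (g := assoc _ _ _ ⊠ _)) ?comp1m ?assocVK // -rwhisker assocVK tens_id.
apply: (comp_injr K).
rewrite whisker -(compA (one ◁ lunit _)) [X in _ ∘ X = _]compA -pentagon.
rewrite !compA triangle -(tens_id A B) -!assoc_nat.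
by rewrite -[RHS]compA -rwhisker triangle.
Qed.

Lemma lunitV_assoc A B : assoc one A B ∘ (lunitV A ⊠ idm B) = lunitV (A ⊗ B).
Proof.
apply: (comp_injl (f := lunit (A ⊗ B)) (lunitK _)).
by rewrite compA lunit_assoc -rwhisker !lunitVK tens_id.
Qed.

Lemma triangleV A B : assocV A one B ∘ (A ◁ lunitV B) = runitV A ⊠ idm B.
Proof.
apply: (comp_injl (f := assoc A one B) (assocK _ _ _)).
apply: (comp_injl (f := A ◁ lunit B) (g := A ◁ lunitV B)).
    by rewrite -whisker lunitK tens_id.
rewrite (compA (assoc _ _ _)) assocVK comp1m -whisker lunitVK.
by rewrite compA triangle -rwhisker runitVK !tens_id.
Qed.

Lemma triangle' A B : A ◁ lunit B = (runit A ⊠ idm B) ∘ assocV A one B.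
Proof. by rewrite -triangle -compA assocVK compm1. Qed.

Lemma pentagonV A B C D :
  assocV A B (C ⊗ D) ∘ (A ◁ assoc B C D) =
  assoc (A ⊗ B) C D ∘ (assocV A B C ⊠ idm D) ∘ assocV A (B ⊗ C) D.
Proof.
apply: (comp_injl (f := assoc A B (C ⊗ D)) (assocK _ _ _)).
rewrite compA assocVK comp1m !compA pentagon -!compA.
rewrite (compE (h := idm _) (g := assoc _ _ _ ⊠ _)); last by rewrite -rwhisker assocVK tens_id.
by rewrite comp1m assocVK compm1.
Qed.

(* A morphism acts on the head of a right-bracketed word with an arbitrary tail C.
   All calculations are done with tails, so that no associator occurs in them;
   locking keeps simplification from exposing the associators. *)
Section Lift.
Fact lift_key : unit. Proof. exact: tt. Qed.
Definition lift A B A' B' (f : hom (A ⊗ B) (A' ⊗ B')) C :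
    hom (A ⊗ (B ⊗ C)) (A' ⊗ (B' ⊗ C)) :=
  locked_with lift_key (assoc A' B' C ∘ (f ⊠ idm C) ∘ assocV A B C).
Definition lift0 P Q (e : hom one (P ⊗ Q)) C : hom C (P ⊗ (Q ⊗ C)) :=
  locked_with lift_key (assoc P Q C ∘ (e ⊠ idm C) ∘ lunitV C).
Definition lift2 P Q (e : hom (P ⊗ Q) one) C : hom (P ⊗ (Q ⊗ C)) C :=
  locked_with lift_key (lunit C ∘ (e ⊠ idm C) ∘ assocV P Q C).

Lemma liftE A B A' B' (f : hom (A ⊗ B) (A' ⊗ B')) C :
  lift f C = assoc A' B' C ∘ (f ⊠ idm C) ∘ assocV A B C.
Proof. exact: unlock. Qed.
Lemma lift0E P Q (e : hom one (P ⊗ Q)) C :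
  lift0 e C = assoc P Q C ∘ (e ⊠ idm C) ∘ lunitV C.
Proof. exact: unlock. Qed.
Lemma lift2E P Q (e : hom (P ⊗ Q) one) C :
  lift2 e C = lunit C ∘ (e ⊠ idm C) ∘ assocV P Q C.
Proof. exact: unlock. Qed.

Lemma lift_nat A B A' B' (f : hom (A ⊗ B) (A' ⊗ B')) C C' (g : hom C C') :
  lift f C' ∘ (A ◁ (B ◁ g)) = (A' ◁ (B' ◁ g)) ∘ lift f C.
Proof.
rewrite !liftE -!compA assocV_nat tens_id (compE _ (interchange f g)) !compA.
by rewrite -assoc_nat tens_id.
Qed.
Lemma lift0_nat P Q (e : hom one (P ⊗ Q)) C C' (g : hom C C') :
  lift0 e C' ∘ g = (P ◁ (Q ◁ g)) ∘ lift0 e C.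
Proof.
rewrite !lift0E -!compA lunitV_nat (compE _ (interchange e g)) !compA.
by rewrite -assoc_nat tens_id.
Qed.
Lemma lift2_nat P Q (e : hom (P ⊗ Q) one) C C' (g : hom C C') :
  lift2 e C' ∘ (P ◁ (Q ◁ g)) = g ∘ lift2 e C.
Proof.
rewrite !lift2E -!compA assocV_nat tens_id (compE _ (interchange e g)) !compA.
by rewrite -lunit_nat.
Qed.

Lemma lift_comp A B A' B' A'' B'' (g : hom (A' ⊗ B') (A'' ⊗ B'')) (f : hom (A ⊗ B) (A' ⊗ B')) C :
  lift (g ∘ f) C = lift g C ∘ lift f C.
Proof.
by rewrite !liftE rwhisker !compA -(compA _ (assocV _ _ _)) assocK compm1.
Qed.
Lemma lift_lift0 A B A' B' (g : hom (A ⊗ B) (A' ⊗ B')) e C :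
  lift g C ∘ lift0 e C = lift0 (g ∘ e) C.
Proof.
by rewrite !(liftE, lift0E) rwhisker !compA -(compA _ (assocV _ _ _)) assocK compm1.
Qed.
Lemma lift2_lift A B A' B' (g : hom (A ⊗ B) (A' ⊗ B')) e C :
  lift2 e C ∘ lift g C = lift2 (e ∘ g) C.
Proof.
by rewrite !(liftE, lift2E) rwhisker !compA -(compA _ (assocV _ _ _)) assocK compm1.
Qed.
Lemma lift2_lift0 A B (g : hom one (A ⊗ B)) e C :
  lift2 e C ∘ lift0 g C = lunit C ∘ ((e ∘ g) ⊠ idm C) ∘ lunitV C.
Proof.
by rewrite !(lift0E, lift2E) rwhisker !compA -(compA _ (assocV _ _ _)) assocK compm1.
Qed.
Lemma lift_id A B C : lift (idm (A ⊗ B)) C = idm _.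
Proof. by rewrite !liftE tens_id compm1 assocVK. Qed.
Lemma lift_tens A B A' B' (f : hom A A') (g : hom B B') C :
  lift (f ⊠ g) C = f ⊠ (g ⊠ idm C).
Proof. by rewrite !liftE assoc_nat -compA assocVK compm1. Qed.

(** Only the bracketed morphism from [A] to [Q] matters, for any [e] and [e']. For a form and its
    coform it is the zigzag of the duality axioms; for a simple object and another [e] it is a
    scalar. *)
Lemma zigzag A P Q (e' : hom (A ⊗ P) one) (e : hom one (P ⊗ Q)) C :
  lift2 e' (Q ⊗ C) ∘ (A ◁ lift0 e C) =
  (lunit Q ∘ (e' ⊠ idm Q) ∘ assocV A P Q ∘ (A ◁ e) ∘ runitV A) ⊠ idm C.
Proof.
rewrite !(lift0E, lift2E) !whisker !rwhisker !compA -(compA _ (assocV _ _ _)) pentagonV.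
rewrite -!compA -triangleV (compE _ (assocV_nat (idm A) e (idm C))).
rewrite -(lunit_assoc Q C) -!compA; congr (_ ∘ _); rewrite -[idm (Q ⊗ C)]tens_id.
by rewrite (compE _ (esym (assoc_nat e' (idm Q) (idm C)))) -!compA.
Qed.

Lemma zagzig P Q B (e : hom one (P ⊗ Q)) (e' : hom (Q ⊗ B) one) C :
  (P ◁ lift2 e' C) ∘ lift0 e (B ⊗ C) =
  (runit P ∘ (P ◁ e') ∘ assoc P Q B ∘ (e ⊠ idm B) ∘ lunitV B) ⊠ idm C.
Proof.
rewrite !(lift0E, lift2E) !whisker !rwhisker -(lunitV_assoc B C) -[idm (B ⊗ C)]tens_id.
rewrite -!compA (compE _ (esym (assoc_nat e (idm B) (idm C)))) -!compA.
rewrite (compE _ (pentagon P Q B C)) -!compA.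
rewrite (compE (h := idm _) (g := P ◁ assocV Q B C)); last first.
  by rewrite -whisker assocK tens_id.
rewrite comp1m (compE _ (esym (assoc_nat (idm P) e' (idm C)))) -!compA.
by rewrite triangle' -!compA (compE _ (assocK _ _ _)) comp1m.
Qed.
End Lift.
End Monoidal.

(** * Braiding, duality and partial traces, all in front of a tail *)

Section Braided.
Variables (R : comNzRingType) (T : tortile_category R).
Implicit Types (A B C D P Q W : T) (s : bool).

Lemma crossmK s A B : crossm (~~ s) B A ∘ crossm s A B = idm _.
Proof. by case: s; rewrite /= ?braidK ?braidVK. Qed.

Lemma braidV_nat A B A' B' (f : hom A A') (g : hom B B') :
  braidV A' B' ∘ (g ⊠ f) = (f ⊠ g) ∘ braidV A B.
Proof.
apply: (comp_injl (f := braid A' B') (braidK _ _)).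
by rewrite !compA braidVK comp1m braid_nat -compA braidVK compm1.
Qed.

Lemma crossm_nat s A B A' B' (f : hom A A') (g : hom B B') :
  crossm s A' B' ∘ (f ⊠ g) = (g ⊠ f) ∘ crossm s A B.
Proof. by case: s; rewrite /= ?braid_nat ?braidV_nat. Qed.

Lemma hexagonm s A B C :
  assoc B C A ∘ crossm s A (B ⊗ C) ∘ assoc A B C =
  (idm B ⊠ crossm s A C) ∘ assoc B A C ∘ (crossm s A B ⊠ idm C).
Proof.
case: s => /=; first exact: hexagon.
(* Composition with the inverse of the left side; [hexagonV] turns the right side into the identity
   too. *)
apply: (comp_injl (f := assocV A B C ∘ braid (B ⊗ C) A ∘ assocV B C A)
  (g := assoc B C A ∘ braidV (B ⊗ C) A ∘ assoc A B C)).
  rewrite -!compA (compE _ (assocVK _ _ _)) comp1m (compE _ (braidK _ _)) comp1m.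
  exact: assocVK.
rewrite [in RHS]hexagonV -!compA.
rewrite (compE _ (assocK _ _ _)) comp1m (compE _ (braidVK _ _)) comp1m assocK.
rewrite (compE (h := idm _) (g := B ◁ braid _ _)); last by rewrite -whisker braidVK tens_id.
rewrite comp1m (compE _ (assocK _ _ _)) comp1m -rwhisker braidVK tens_id //.
Qed.

Definition X s A B C := lift (crossm s A B) C.

Lemma X_nat s A B C C' (g : hom C C') :
  X s A B C' ∘ (A ◁ (B ◁ g)) = (B ◁ (A ◁ g)) ∘ X s A B C.
Proof. exact: lift_nat. Qed.
Lemma XK s A B C : X (~~ s) B A C ∘ X s A B C = idm _.
Proof. by rewrite /X -lift_comp crossmK lift_id. Qed.
Lemma XnatL s A A' B C (f : hom A A') : 
  X s A' B C ∘ (f ⊠ idm (B ⊗ C)) = (B ◁ (f ⊠ idm C)) ∘ X s A B C.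
Proof. by rewrite -[idm (B ⊗ C)]tens_id -!lift_tens -!lift_comp crossm_nat. Qed.
Lemma XnatR s A B B' C (f : hom B B') : 
  X s A B' C ∘ (A ◁ (f ⊠ idm C)) = (f ⊠ idm (A ⊗ C)) ∘ X s A B C.
Proof. by rewrite -[idm (A ⊗ C)]tens_id -!lift_tens -!lift_comp crossm_nat. Qed.

Lemma X_tens s A B C D :
  assoc B C (A ⊗ D) ∘ X s A (B ⊗ C) D =
  (B ◁ X s A C D) ∘ X s A B (C ⊗ D) ∘ (A ◁ assoc B C D).
Proof.
have H : assoc B C A ∘ crossm s A (B ⊗ C) =
  (B ◁ crossm s A C) ∘ assoc B A C ∘ (crossm s A B ⊠ idm C) ∘ assocV A B C.
  by rewrite -hexagonm -!compA assocVK compm1.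
rewrite /X !liftE -!compA (compE _ (pentagon B C A D)) -!compA.
rewrite (compE _ (esym (rwhisker _ _ _))) H pentagonV !rwhisker !whisker -!compA.
rewrite -[idm (C ⊗ D)]tens_id.
rewrite (compE _ (esym (assoc_nat (crossm s A B) (idm C) (idm D)))) -!compA.
rewrite (compE _ (pentagon B A C D)) -!compA.
rewrite (compE (h := idm _) (g := B ◁ assocV A C D)); last first.
  by rewrite -whisker assocK tens_id.
by rewrite comp1m (compE _ (esym (assoc_nat (idm B) (crossm s A C) (idm D)))) -!compA.
Qed.

(** Crossing $\mathbf 1\mathbf 1$ is crossing $\mathbf 1$ twice, and by naturality it is also
    crossing $\mathbf 1$ once. This makes [Y] idempotent up to unit isomorphisms, and [Y] is
    invertible. *)
Lemma X_one s A D : X s A one D ∘ (A ◁ lunitV D) = lunitV (A ⊗ D).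
Proof.
set Y := _ ∘ _.
have l1 : lunitV (one ⊗ D) ∘ lunitV D = (one ◁ lunitV D) ∘ lunitV D by exact: lunitV_nat.
have YY : (one ◁ Y) ∘ Y = (one ◁ Y) ∘ lunitV (A ⊗ D).
  rewrite -lunitV_nat -(lunitV_assoc one (A ⊗ D)) {2}/Y -!compA.
  rewrite (compE _ (esym (XnatR s A D (lunitV one)))) -!compA -whisker.
  rewrite (compE _ (X_tens s A one one D)) -!compA -whisker.
  rewrite (compE _ (lunitV_assoc one D)) l1 whisker.
  by rewrite (compE _ (X_nat _ _ _ _)) /Y whisker -!compA.
apply: (comp_injl (g := one ◁ ((A ◁ lunit D) ∘ X (~~ s) one A D)) _ YY).
rewrite -whisker /Y -!compA (compE _ (XK _ _ _ _)) comp1m -whisker lunitVK.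
by rewrite !tens_id.
Qed.

Lemma lunit_X s A D : lunit (A ⊗ D) ∘ X s A one D = A ◁ lunit D.
Proof.
apply: (comp_injr (f := A ◁ lunitV D) (g := A ◁ lunit D)).
  by rewrite -whisker lunitK tens_id.
by rewrite -compA X_one lunitVK -whisker lunitVK tens_id.
Qed.

(** The hexagon splits the crossing of [A] with a product, and naturality carries [A] past the box
    [f]. A crossing as [f] gives the third Reidemeister move; cups and caps are treated in the same
    way below. *)
Lemma slide s A B C B' C' (f : hom (B ⊗ C) (B' ⊗ C')) D :
  lift f (A ⊗ D) ∘ ((B ◁ X s A C D) ∘ X s A B (C ⊗ D)) =
  (B' ◁ X s A C' D) ∘ X s A B' (C' ⊗ D) ∘ (A ◁ lift f D).
Proof.
apply: (comp_injr (f := A ◁ assoc B C D) (g := A ◁ assocV B C D)).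
  by rewrite -whisker assocVK tens_id.
rewrite -[LHS]compA -X_tens !liftE -![in LHS]compA.
rewrite (compE _ (assocK _ _ _)) comp1m.
rewrite -XnatR compA X_tens -!compA -!whisker; congr (_ ∘ (_ ∘ (_ ◁ _))).
by rewrite -!compA assocK compm1.
Qed.

Lemma slide0 s A P Q (e : hom one (P ⊗ Q)) D :
  (P ◁ X s A Q D) ∘ (X s A P (Q ⊗ D) ∘ (A ◁ lift0 e D)) = lift0 e (A ⊗ D).
Proof.
rewrite !lift0E !whisker !compA -X_tens -!compA.
by rewrite (compE _ (XnatR s A D e)) -!compA X_one.
Qed.

Lemma slide2 s A P Q (e : hom (P ⊗ Q) one) D :
  lift2 e (A ⊗ D) ∘ ((P ◁ X s A Q D) ∘ X s A P (Q ⊗ D)) = A ◁ lift2 e D.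
Proof.
apply: (comp_injr (f := A ◁ assoc P Q D) (g := A ◁ assocV P Q D)).
  by rewrite -whisker assocVK tens_id.
rewrite -[LHS]compA -X_tens !lift2E -![in LHS]compA.
rewrite (compE _ (assocK _ _ _)) comp1m.
by rewrite -XnatR compA lunit_X -!whisker -compA assocK compm1.
Qed.

Lemma XKw s P A B C : (P ◁ X (~~ s) B A C) ∘ (P ◁ X s A B C) = idm _.
Proof. by rewrite -whisker XK tens_id. Qed.
Lemma XVK s A B C : X s B A C ∘ X (~~ s) A B C = idm _.
Proof. by rewrite -{1}[s]negbK XK. Qed.
Lemma XVKw s P A B C : (P ◁ X s B A C) ∘ (P ◁ X (~~ s) A B C) = idm _.
Proof. by rewrite -whisker XVK tens_id. Qed.

Lemma rslide s A B C A' B' (f : hom (A ⊗ B) (A' ⊗ B')) D :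
  X s A' C (B' ⊗ D) ∘ ((A' ◁ X s B' C D) ∘ lift f (C ⊗ D)) =
  (C ◁ lift f D) ∘ (X s A C (B ⊗ D) ∘ (A ◁ X s B C D)).
Proof.
have := slide (~~ s) C f D.
move=> /(congr1 (fun h => X s A' C (B' ⊗ D) ∘ ((A' ◁ X s B' C D) ∘
  (h ∘ (X s A C (B ⊗ D) ∘ (A ◁ X s B C D)))))).
rewrite -!compA.
rewrite (compE _ (XK _ _ _ _)) comp1m XKw compm1 => ->.
by rewrite (compE _ (XVKw _ _ _ _ _)) comp1m (compE _ (XVK _ _ _ _)) comp1m.
Qed.

Lemma rslide0 s C P Q (e : hom one (P ⊗ Q)) D :
  X s P C (Q ⊗ D) ∘ ((P ◁ X s Q C D) ∘ lift0 e (C ⊗ D)) = C ◁ lift0 e D.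
Proof.
rewrite -(slide0 (~~ s)) (compE _ (XVKw _ _ _ _ _)) comp1m.
by rewrite (compE _ (XVK _ _ _ _)) comp1m.
Qed.

Lemma rslide2 s C P Q (e : hom (P ⊗ Q) one) D :
  (C ◁ lift2 e D) ∘ (X s P C (Q ⊗ D) ∘ (P ◁ X s Q C D)) = lift2 e (C ⊗ D).
Proof.
rewrite -(slide2 (~~ s)) -!compA (compE _ (XK _ _ _ _)) comp1m.
by rewrite XKw compm1.
Qed.

Lemma yang_baxter s s' A B C D :
  X s B C (A ⊗ D) ∘ ((B ◁ X s' A C D) ∘ X s' A B (C ⊗ D)) =
  (C ◁ X s' A B D) ∘ X s' A C (B ⊗ D) ∘ (A ◁ X s B C D).
Proof. exact: slide. Qed.
Definition coev A C : hom C (dual A ⊗ (A ⊗ C)) := lift0 (coform A) C.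
Definition ev A C : hom (A ⊗ (dual A ⊗ C)) C := lift2 (form A) C.
Definition coev' A C : hom C (A ⊗ (dual A ⊗ C)) := lift0 (coform_dual A) C.
Definition ev' A C : hom (dual A ⊗ (A ⊗ C)) C := lift2 (form_dual A) C.

Lemma snake A C : ev A (A ⊗ C) ∘ (A ◁ coev A C) = idm _.
Proof. by rewrite /ev /coev zigzag form_coform runitVK tens_id. Qed.
Lemma snakeV A C : (dual A ◁ ev A C) ∘ coev A (dual A ⊗ C) = idm _.
Proof. by rewrite /ev /coev zagzig coform_form lunitVK tens_id. Qed.

Lemma twist_natw A B (f : hom A B) C :
  (twist B ⊠ idm C) ∘ (f ⊠ idm C) = (f ⊠ idm C) ∘ (twist A ⊠ idm C).
Proof. by rewrite -!rwhisker twist_nat. Qed.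

Lemma lift_inj A B A' B' (f g : hom (A ⊗ B) (A' ⊗ B')) : lift f one = lift g one -> f = g.
Proof.
rewrite !liftE => /(comp_injr (assocK _ _ _)) /(comp_injl (assocK _ _ _)) e.
by apply: (comp_injr (runitVK _)); rewrite -!runit_nat e.
Qed.

Lemma X_one_one s C : X s one one C = idm _.
Proof.
apply: (comp_injr (f := idm one ⊠ lunitV C) (g := idm one ⊠ lunit C)).
  by rewrite -whisker lunitK tens_id.
rewrite X_one comp1m; apply: (comp_injr (lunitK _)).
exact: lunitV_nat.
Qed.

(** The double braiding of the unit with itself is trivial, so [twist_tens] makes the twist of the
    unit idempotent up to the unit isomorphism. *)
Lemma twist_one : twist (@one _ T) = idm _.
Proof.
have dbl1 : braid one one ∘ braid one one = idm (@one _ T ⊗ one).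
  by apply: lift_inj; rewrite lift_comp -![lift _ _]/(X true one one one) !X_one_one comp1m lift_id.
have H : twist one ∘ lunit one = lunit one ∘ (twist (@one _ T) ⊠ twist one).
  by rewrite twist_nat twist_tens dbl1 comp1m.
have {}H : lunit one ∘ (twist (@one _ T) ⊠ idm one) = lunit one.
  apply: (comp_injr (f := idm (@one _ T) ⊠ twist one) (g := idm one ⊠ twistV one)).
    by rewrite -whisker twistVK tens_id.
  by rewrite -compA tens_split -H lunit_nat.
apply: (comp_injr (runitVK _)); rewrite -runit_nat comp1m -[RHS]compm1; congr (_ ∘ _).
by apply: (comp_injl (f := lunit one) (lunitK _)); rewrite H compm1.
Qed.

Lemma twistw A B : (twistV A ⊠ idm B) ∘ (twist A ⊠ idm B) = idm _.
Proof. by rewrite -rwhisker twistK tens_id. Qed.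
Lemma twistVw A B : (twist A ⊠ idm B) ∘ (twistV A ⊠ idm B) = idm _.
Proof. by rewrite -rwhisker twistVK tens_id. Qed.

(** The twist of the product of [dual A] and [A] fixes the coform, by naturality and [twist_one]. By
    [twist_tens] and [twist_dual] it acts as the double braiding followed by $\theta_A^2$ on one
    leg, so the positive and the negative curl define the same coform. *)
Lemma coform_dualE A :
  coform_dual A = (twistV A ⊠ idm (dual A)) ∘ braidV A (dual A) ∘ coform A.
Proof.
have e : braid A (dual A) ∘ braid (dual A) A ∘ (idm (dual A) ⊠ (twist A ∘ twist A)) ∘ coform A
   = coform A.
  rewrite whisker -!compA -(twist_dual A) (compE _ (esym (interchange _ _))) tens_split.
  by rewrite !compA -twist_tens twist_nat twist_one compm1.
rewrite -e -!compA (compE _ (braidK _ _)) comp1m.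
rewrite (compE _ (braid_nat _ _)) -!compA (compE _ (esym (rwhisker _ _ _))).
by rewrite (compA (twistV A)) twistK comp1m /coform_dual compA.
Qed.

Lemma coev'E A C :
  coev' A C = (twistV A ⊠ idm _) ∘ (X false (dual A) A C ∘ coev A C).
Proof.
rewrite /coev' /coev /X coform_dualE -!lift_lift0 lift_comp lift_tens tens_id -compA //.
Qed.
Lemma ev'E A C :
  ev' A C = ev A C ∘ (X true (dual A) A C ∘ (dual A ◁ (twist A ⊠ idm C))).
Proof.
by rewrite /ev' /ev /X /form_dual -!lift2_lift lift_tens -compA.
Qed.

(** With the cap written by a positive curl and the cup by a negative one, the two twists and the
    two crossings cancel, and the first zigzag identity remains. *)
Lemma snake' A C : (A ◁ ev' A C) ∘ coev' A (A ⊗ C) = idm _.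
Proof.
have core : (A ◁ ev A C) ∘ ((A ◁ X true (dual A) A C) ∘
   (X false (dual A) A (A ⊗ C) ∘ coev A (A ⊗ C))) = idm _.
  rewrite {1}/coev -(slide0 false A (coform A)) -/(coev A C) !compA.
  rewrite -(compA (_ ∘ _) (X _ _ _ _) (dual A ◁ _)) -(compA _ (X _ _ _ _ ∘ _)).
  rewrite -(compA (X _ _ _ _)) yang_baxter -!compA (compE _ (XVKw _ _ _ _ _)) comp1m.
  by rewrite (compA (X _ _ _ _)) (compE _ (rslide2 _ _ _ _)) snake.
rewrite coev'E ev'E !whisker -!compA.
rewrite 3!(compEE _ (esym (interchange (twistV A) _))).
rewrite (compEE _ (esym (X_nat _ _ _ _))) -lift0_nat -/(coev A (A ⊗ C)).
rewrite 2!(compA _ _ (twist A ⊠ _)) (compA _ _ (twist A ⊠ _)) core comp1m.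
exact: twistw.
Qed.

Lemma snakeV' A C : ev' A (dual A ⊗ C) ∘ (dual A ◁ coev' A C) = idm _.
Proof.
rewrite coev'E ev'E !whisker -!compA.
rewrite (compE (h := idm _) (g := dual A ◁ (twist A ⊠ _))); last first.
  by rewrite -whisker twistVw tens_id.
rewrite comp1m -(rslide0 false (dual A) (coform A)).
rewrite (compA (dual A ◁ X _ _ _ _)) (compA (_ ∘ _) (dual A ◁ X _ _ _ _)).
rewrite -(compA (dual A ◁ X _ _ _ _)) (compA (dual A ◁ X _ _ _ _)) -yang_baxter -!compA.
rewrite (compE _ (XVK _ _ _ _)) comp1m.
rewrite (compA (A ◁ X _ _ _ _)) (compE _ (slide2 _ _ _ _)).
exact: snakeV.
Qed.

Lemma coev_nat A C C' (g : hom C C') : coev A C' ∘ g = (dual A ◁ (A ◁ g)) ∘ coev A C.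
Proof. exact: lift0_nat. Qed.
Lemma coev'_nat A C C' (g : hom C C') : coev' A C' ∘ g = (A ◁ (dual A ◁ g)) ∘ coev' A C.
Proof. exact: lift0_nat. Qed.
Lemma ev_nat A C C' (g : hom C C') : ev A C' ∘ (A ◁ (dual A ◁ g)) = g ∘ ev A C.
Proof. exact: lift2_nat. Qed.
Lemma ev'_nat A C C' (g : hom C C') : ev' A C' ∘ (dual A ◁ (A ◁ g)) = g ∘ ev' A C.
Proof. exact: lift2_nat. Qed.

Lemma bend A C C' (h : hom (A ⊗ C) C') : ev A C' ∘ (A ◁ ((dual A ◁ h) ∘ coev A C)) = h.
Proof. by rewrite whisker (compE _ (ev_nat _ _)) -compA snake compm1. Qed.
Lemma bendV A C C' (h : hom C (dual A ⊗ C')) : (dual A ◁ (ev A C' ∘ (A ◁ h))) ∘ coev A C = h.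
Proof. by rewrite whisker -compA -coev_nat compA snakeV comp1m. Qed.
Lemma bendV' A C C' (h : hom (dual A ⊗ C) C') :
  ev' A C' ∘ (dual A ◁ ((A ◁ h) ∘ coev' A C)) = h.
Proof. by rewrite whisker (compE _ (ev'_nat _ _)) -compA snakeV' compm1. Qed.
Lemma form_dual_coform A : form_dual A ∘ coform A = form A ∘ coform_dual A.
Proof.
rewrite /form_dual /coform_dual -!compA.
by rewrite (compE _ (braid_nat _ _)) -compA.
Qed.

Section PartialTrace.
Variable A : T.

(** The loop runs to the left of the remaining strands. This is one step of [braid_closure], whose
    first string is the innermost. *)
Definition ptr C D (f : hom (A ⊗ C) (A ⊗ D)) : hom C D :=
  ev' A D ∘ ((dual A ◁ f) ∘ coev A C).

Lemma ptr_natl C D D' (g : hom D D') (f : hom (A ⊗ C) (A ⊗ D)) :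
  ptr ((A ◁ g) ∘ f) = g ∘ ptr f.
Proof. by rewrite /ptr whisker -!compA (compE _ (lift2_nat _ _)) -compA. Qed.
Lemma ptr_natr C C' D (g : hom C' C) (f : hom (A ⊗ C) (A ⊗ D)) :
  ptr (f ∘ (A ◁ g)) = ptr f ∘ g.
Proof. by rewrite /ptr whisker -!compA -lift0_nat. Qed.
Lemma ptrD C D (f g : hom (A ⊗ C) (A ⊗ D)) : ptr (f + g) = ptr f + ptr g.
Proof. by rewrite /ptr tensDr compDl compDr. Qed.
Lemma ptr0 C D : ptr (0 : hom (A ⊗ C) (A ⊗ D)) = 0.
Proof. by rewrite /ptr tens0r comp0l comp0r. Qed.
Lemma ptrZ C D c (f : hom (A ⊗ C) (A ⊗ D)) : ptr (c *: f) = c *: ptr f.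
Proof. by rewrite /ptr tensZr compZl compZr. Qed.
Lemma ptr_sum (I : Type) r (P : pred I) C D (F : I -> hom (A ⊗ C) (A ⊗ D)) :
  ptr (\sum_(i <- r | P i) F i) = \sum_(i <- r | P i) ptr (F i).
Proof. by apply: (big_morph (@ptr C D)) => [f g|]; rewrite ?ptrD ?ptr0. Qed.

Lemma ptr_X s B C D (f : hom (A ⊗ C) (A ⊗ D)) :
  ptr (X s B A D ∘ ((B ◁ f) ∘ X (~~ s) A B C)) = B ◁ ptr f.
Proof.
rewrite /ptr !whisker /coev -(slide0 s B (coform A)) -!compA.
rewrite (compE _ (XKw _ _ _ _ _)) comp1m.
rewrite (compEE _ (esym (X_nat s B (dual A) f))).
rewrite (compA (dual A ◁ X _ _ _ _)) /ev'.
by rewrite (compE _ (slide2 s B (form_dual A) D)).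
Qed.
End PartialTrace.

Definition dbl s A B C : hom (A ⊗ (B ⊗ C)) (A ⊗ (B ⊗ C)) :=
  locked_with lift_key (X s B A C ∘ X s A B C).
Lemma dbl_def s A B C : dbl s A B C = X s B A C ∘ X s A B C.
Proof. exact: unlock. Qed.
End Braided.

(** * Handle slides *)

Section SplitMerge.
Variables (R : comNzRingType) (T : monoidal_category R).
Implicit Types A B C D P Q W : T.

Fact split_key : unit. Proof. exact: tt. Qed.
Definition spl A P Q (f : hom A (P ⊗ Q)) C : hom (A ⊗ C) (P ⊗ (Q ⊗ C)) :=
  locked_with split_key (assoc P Q C ∘ (f ⊠ idm C)).
Definition mrg A P Q (f : hom (P ⊗ Q) A) C : hom (P ⊗ (Q ⊗ C)) (A ⊗ C) :=
  locked_with split_key ((f ⊠ idm C) ∘ assocV P Q C).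
Lemma splE A P Q (f : hom A (P ⊗ Q)) C : spl f C = assoc P Q C ∘ (f ⊠ idm C).
Proof. exact: unlock. Qed.
Lemma mrgE A P Q (f : hom (P ⊗ Q) A) C : mrg f C = (f ⊠ idm C) ∘ assocV P Q C.
Proof. exact: unlock. Qed.

Lemma spl_nat A P Q (f : hom A (P ⊗ Q)) C C' (g : hom C C') :
  spl f C' ∘ (A ◁ g) = (P ◁ (Q ◁ g)) ∘ spl f C.
Proof.
rewrite !splE -!compA interchange !compA -tens_id -assoc_nat //.
Qed.
Lemma mrg_nat A P Q (f : hom (P ⊗ Q) A) C C' (g : hom C C') :
  mrg f C' ∘ (P ◁ (Q ◁ g)) = (A ◁ g) ∘ mrg f C.
Proof.
by rewrite !mrgE -!compA assocV_nat tens_id !compA interchange.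
Qed.
Lemma mrg_spl A P Q B (g : hom (P ⊗ Q) B) (f : hom A (P ⊗ Q)) C :
  mrg g C ∘ spl f C = (g ∘ f) ⊠ idm C.
Proof. by rewrite splE mrgE -!compA (compE _ (assocK _ _ _)) comp1m -rwhisker. Qed.
Lemma spl_mrg A P Q P' Q' (g : hom A (P ⊗ Q)) (f : hom (P' ⊗ Q') A) C :
  spl g C ∘ mrg f C = lift (g ∘ f) C.
Proof. by rewrite splE mrgE liftE rwhisker -!compA. Qed.
Lemma lift0_lift2 P Q P' Q' (g : hom one (P ⊗ Q)) (f : hom (P' ⊗ Q') one) C :
  lift0 g C ∘ lift2 f C = lift (g ∘ f) C.
Proof.
by rewrite lift0E lift2E liftE rwhisker -!compA (compE _ (lunitK _)) comp1m.
Qed.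
(** Bending one leg of a trivalent vertex by a cup or a cap gives a trivalent vertex again,
    independent of the tail. Through [mate1] to [mate4] rotated vertices are computed by their
    action on tails only. *)
Lemma mate1 P A B Z (e : hom (P ⊗ B) one) (f : hom A (B ⊗ Z)) C :
  lift2 e (Z ⊗ C) ∘ (P ◁ spl f C) =
  mrg (lunit Z ∘ (e ⊠ idm Z) ∘ assocV P B Z ∘ (P ◁ f)) C.
Proof.
rewrite lift2E splE mrgE !whisker !rwhisker -!compA.
rewrite (compE _ (pentagonV _ _ _ _)) -!compA -[idm (Z ⊗ C)]tens_id.
rewrite (compEE _ (esym (assoc_nat e (idm Z) (idm C)))).
rewrite (compE _ (lunit_assoc _ _)).
by rewrite (assocV_nat (idm P) f (idm C)).
Qed.

Lemma mate2 P A B Z (e : hom one (P ⊗ B)) (g : hom (B ⊗ Z) A) C :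
  (P ◁ mrg g C) ∘ lift0 e (Z ⊗ C) =
  spl ((P ◁ g) ∘ assoc P B Z ∘ (e ⊠ idm Z) ∘ lunitV Z) C.
Proof.
rewrite lift0E splE mrgE !whisker !rwhisker -!compA -(lunitV_assoc Z C) -[idm (Z ⊗ C)]tens_id.
rewrite (compEE _ (esym (assoc_nat e (idm Z) (idm C)))).
rewrite (compE _ (pentagon _ _ _ _)) -!compA.
rewrite (compE (h := idm _) (g := P ◁ assocV _ _ _)); last first.
  by rewrite -whisker assocK tens_id.
by rewrite comp1m (compEE _ (esym (assoc_nat (idm P) g (idm C)))).
Qed.

Lemma mate3 P A Q Z (f : hom (P ⊗ A) Z) (e : hom one (A ⊗ Q)) D :
  mrg f (Q ⊗ D) ∘ (P ◁ lift0 e D) =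
  spl ((f ⊠ idm Q) ∘ assocV P A Q ∘ (P ◁ e) ∘ runitV P) D.
Proof.
rewrite lift0E splE mrgE !whisker !rwhisker -!compA -triangleV.
rewrite (compE _ (pentagonV _ _ _ _)) -!compA -[idm (Q ⊗ D)]tens_id.
rewrite (compEE _ (esym (assoc_nat f (idm Q) (idm D)))).
by rewrite (compEE _ (assocV_nat (idm P) e (idm D))).
Qed.

Lemma mate4 P A Q Z (g : hom Z (P ⊗ A)) (e : hom (A ⊗ Q) one) D :
  (P ◁ lift2 e D) ∘ spl g (Q ⊗ D) =
  mrg (runit P ∘ (P ◁ e) ∘ assoc P A Q ∘ (g ⊠ idm Q)) D.
Proof.
apply: (comp_injr (assocVK _ _ _)).
rewrite lift2E splE mrgE !whisker !rwhisker -!compA assocK compm1.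
rewrite -[idm (Q ⊗ D)]tens_id -(assoc_nat g (idm Q) (idm D)).
rewrite (compE _ (pentagon _ _ _ _)) -!compA.
rewrite (compE (h := idm _) (g := P ◁ assocV _ _ _)); last first.
  by rewrite -whisker assocK tens_id.
rewrite comp1m (compEE _ (esym (assoc_nat (idm P) e (idm D)))).
by rewrite (compE _ (triangle _ _)).
Qed.

Lemma tail_inj A B (f g : hom A B) : f ⊠ idm one = g ⊠ idm one -> f = g.
Proof. by move=> e; apply: (comp_injr (runitVK _)); rewrite -!runit_nat e. Qed.

Lemma spl_inj A P Q (f g : hom A (P ⊗ Q)) : spl f one = spl g one -> f = g.
Proof. by rewrite !splE => /(comp_injl (assocK _ _ _)) /tail_inj. Qed.
End SplitMerge.

(** * Simple objects, their ranks, and rotation of trivalent vertices *)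

Section Simple.
Variables (R : comNzRingType) (T : tortile_category R).
Implicit Types A B C D P Q W : T.

Definition simple_ob A : Prop :=
  (forall f : hom A A, exists c : R, f = c *: idm A) /\
  (forall c : R, c *: idm A = 0 -> c = 0).

Lemma scalar_eq A (f : hom A A) c : simple_ob A -> f = c *: idm A -> scalar f = c.
Proof.
move=> [_ inj] fc; rewrite /scalar; case: xgetP => [x _ /= e|]; last by move/(_ c) => [].
by apply/eqP; rewrite -subr_eq0; apply/eqP/inj; rewrite scalerBl -e -fc subrr.
Qed.
Lemma scalarE A (f : hom A A) : simple_ob A -> f = scalar f *: idm A.
Proof. by move=> sA; have [c fc] := sA.1 f; rewrite (scalar_eq sA fc). Qed.

Section Rotation.
Variables B Z A : T.

(** Rotations of the vertices through which [B] and [Z] merge into [A]. They exchange the roles of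
    the loops labelled [A] and [B] while [Z] passes from one to the other. *)
Definition rotF (F : hom A (B ⊗ Z)) : hom (dual B) (Z ⊗ dual A) :=
  ((lunit Z ∘ (form_dual B ⊠ idm Z) ∘ assocV (dual B) B Z ∘ (dual B ◁ F)) ⊠ idm (dual A))
  ∘ assocV (dual B) A (dual A) ∘ (dual B ◁ coform_dual A) ∘ runitV (dual B).
Definition rotG (G : hom (B ⊗ Z) A) : hom (Z ⊗ dual A) (dual B) :=
  runit (dual B) ∘ (dual B ◁ form A) ∘ assoc (dual B) A (dual A)
  ∘ (((dual B ◁ G) ∘ assoc (dual B) B Z ∘ (coform B ⊠ idm Z) ∘ lunitV Z) ⊠ idm (dual A)).

Lemma spl_rotF F D : spl (rotF F) D =
  ev' B (Z ⊗ (dual A ⊗ D)) ∘ ((dual B ◁ spl F (dual A ⊗ D)) ∘ (dual B ◁ coev' A D)).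
Proof. by rewrite -mate3 -mate1 -compA. Qed.
Lemma mrg_rotG G D : mrg (rotG G) D =
  (dual B ◁ ev A D) ∘ ((dual B ◁ mrg G (dual A ⊗ D)) ∘ coev B (Z ⊗ (dual A ⊗ D))).
Proof. by rewrite -mate4 -mate2. Qed.

Lemma rotFD F F' : rotF (F + F') = rotF F + rotF F'.
Proof. by rewrite /rotF tensDr compDr tensDl !compDl. Qed.
Lemma rotF0 : rotF 0 = 0.
Proof. by rewrite /rotF tens0r comp0r tens0l !comp0l. Qed.
Lemma rotFZ c F : rotF (c *: F) = c *: rotF F.
Proof. by rewrite /rotF tensZr compZr tensZl !compZl. Qed.
Lemma rotF_sum (I : Type) r (P : pred I) (F : I -> hom A (B ⊗ Z)) :
  rotF (\sum_(i <- r | P i) F i) = \sum_(i <- r | P i) rotF (F i).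
Proof. by apply: (big_morph rotF) => [f g|]; rewrite ?rotFD ?rotF0. Qed.

Lemma rotF_surj (p : hom (dual B) (Z ⊗ dual A)) : exists F, rotF F = p.
Proof.
pose F : hom A (B ⊗ Z) :=
  (B ◁ (runit Z ∘ (Z ◁ form_dual A) ∘ assoc Z (dual A) A ∘ (p ⊠ idm A)))
  ∘ assoc B (dual B) A ∘ (coform_dual B ⊠ idm A) ∘ lunitV A.
have FE C : spl F C = (B ◁ ((Z ◁ ev' A C) ∘ spl p (A ⊗ C))) ∘ coev' B (A ⊗ C).
  by rewrite /ev' mate4 /coev' mate2.
exists F; apply: spl_inj; set D := one; rewrite spl_rotF FE -whisker -!compA coev'_nat.
rewrite (compE _ (esym (whisker _ _ _))) bendV' -compA spl_nat compA -whisker snakeV'.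
by rewrite tens_id comp1m.
Qed.
End Rotation.

Section Semisimple.
Variable S : semisimple T.

Lemma sobj_simple (a : simple S) : simple_ob (sobj a).
Proof. by split; [exact: simple_end | exact: simple_free]. Qed.
Lemma one_simple : simple_ob (@one _ T).
Proof. by rewrite -(sobj_one S); exact: sobj_simple. Qed.

Lemma rankE A : form A ∘ coform_dual A = rank A *: idm one.
Proof. exact: scalarE one_simple. Qed.

Lemma loop A C : ev' A C ∘ coev A C = rank A *: idm C.
Proof.
rewrite /ev' /coev lift2_lift0 form_dual_coform rankE tensZl tens_id compZr compZl.
by rewrite compm1 lunitVK.
Qed.
Lemma loop' A C : ev A C ∘ coev' A C = rank A *: idm C.
Proof.
rewrite /ev /coev' lift2_lift0 rankE tensZl tens_id compZr compZl.
by rewrite compm1 lunitVK.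
Qed.
Lemma ptr_id A C : ptr (idm (A ⊗ C)) = rank A *: idm C.
Proof. by rewrite /ptr tens_id comp1m loop. Qed.

Section Decomposition.
Variable A : T.
Let d1 := cid (simple_decomp S A).
Let d2 := cid (projT2 d1).
Let d3 := cid (projT2 d2).
Definition dim : simple S -> nat := projT1 d1.
Definition inj : forall z, 'I_(dim z) -> hom (sobj z) A := projT1 d2.
Definition proj : forall z, 'I_(dim z) -> hom A (sobj z) := projT1 d3.
Lemma proj_inj z k l : proj l ∘ inj k = if k == l then idm (sobj z) else 0.
Proof. exact: (projT2 d3).1. Qed.
Lemma sum_inj_proj : \sum_z \sum_(k < dim z) inj k ∘ proj k = idm A.
Proof. exact: (projT2 d3).2. Qed.
End Decomposition.

Lemma factor_simple a A (f : hom (sobj a) A) :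
  f = \sum_(i < dim A a) scalar (proj i ∘ f) *: inj i.
Proof.
rewrite -[LHS]comp1m -sum_inj_proj comp_suml (bigD1 a) //= comp_suml.
rewrite [X in _ + X]big1 ?addr0.
  by apply: eq_bigr => i _; rewrite -compA {1}(scalarE (_ ∘ f) (sobj_simple a)) compZr compm1.
move=> b ba; rewrite comp_suml big1 // => i _.
by rewrite -compA (simple_schur (proj i ∘ f)) ?comp0r // eq_sym.
Qed.

Lemma lift0_inj P Q (f g : hom one (P ⊗ Q)) : lift0 f one = lift0 g one -> f = g.
Proof.
rewrite !lift0E -!compA => /(comp_injl (assocK _ _ _)) /(comp_injr (lunitK _)).
exact: tail_inj.
Qed.
Lemma lift2_inj P Q (f g : hom (P ⊗ Q) one) : lift2 f one = lift2 g one -> f = g.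
Proof.
rewrite !lift2E => /(comp_injr (assocK _ _ _)) /(comp_injl (lunitK _)).
exact: tail_inj.
Qed.
Lemma lift0Z P Q c (f : hom one (P ⊗ Q)) C : lift0 (c *: f) C = c *: lift0 f C.
Proof. by rewrite !lift0E tensZl compZr compZl. Qed.
Lemma lift2Z P Q c (f : hom (P ⊗ Q) one) C : lift2 (c *: f) C = c *: lift2 f C.
Proof. by rewrite !lift2E tensZl compZr compZl. Qed.

(** Bending one strand identifies this hom space with the endomorphisms of [B], which are
    scalars. *)
Lemma coform_span B (sB : simple_ob B) (g : hom one (dual B ⊗ B)) :
  exists u, g = u *: coform B.
Proof.
have [u ue] := sB.1 (lunit B ∘ (form B ⊠ idm _) ∘ assocV _ _ _ ∘ (B ◁ g) ∘ runitV _).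
exists u; apply: lift0_inj; set C := one; rewrite lift0Z.
have := zigzag (form B) g C; rewrite ue tensZl tens_id => e.
by rewrite -[LHS](bendV (A := B)) e tensZr tens_id compZl comp1m.
Qed.
Lemma form_span B (sB : simple_ob B) (h : hom (dual B ⊗ B) one) :
  exists u, h = u *: form_dual B.
Proof.
have [u ue] := sB.1 (runit B ∘ (B ◁ h) ∘ assoc _ _ _ ∘ (coform_dual B ⊠ idm _) ∘ lunitV _).
exists u; apply: lift2_inj; set C := one; rewrite lift2Z.
have := zagzig (coform_dual B) h C; rewrite ue tensZl tens_id => e.
by rewrite -[LHS](bendV' (A := B)) e tensZr tens_id compZr compm1.
Qed.
Lemma coform_free B (sB : simple_ob B) c : c *: coform B = 0 -> c = 0.
Proof.
move=> e; apply: sB.2; apply: tail_inj; set C := one.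
rewrite tensZl tens_id -(snake B C) -compZr -tensZr /coev -lift0Z e.
by rewrite lift0E tens0l comp0r comp0l tens0r comp0r tens0l.
Qed.

Definition unit_part A : hom A A := \sum_(k < dim A (sone S)) inj k ∘ proj k.

Lemma one_schur b (f : hom one (sobj b)) : b != sone S -> f = 0.
Proof. by move: f; rewrite -(sobj_one S) eq_sym => f /simple_schur. Qed.

Lemma unit_part_one A (g : hom one A) : unit_part A ∘ g = g.
Proof.
rewrite -[RHS]comp1m -sum_inj_proj (bigD1 (sone S)) //= -/(unit_part A).
rewrite compDl -[LHS]addr0; congr (_ + _).
rewrite comp_suml big1 // => b b1; rewrite comp_suml big1 // => i _; rewrite -compA.
by rewrite (one_schur (proj i ∘ g)) ?comp0r.
Qed.

(** The object [sobj (sone S)] is replaced by [one] along an equality of objects while the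
    injections and projections are still generic, so that no cast remains. *)
Lemma unit_part_factor A : exists n (i : 'I_n -> hom one A) (p : 'I_n -> hom A one),
  unit_part A = \sum_k i k ∘ p k.
Proof.
exists (dim A (sone S)); rewrite /unit_part.
move: (@inj A (sone S)) (@proj A (sone S)); rewrite (sobj_one S) => i p.
by exists i, p.
Qed.

(** Every map between the unit and the product of [dual B] and [B] is a multiple of the coform or of
    the form, so the projection onto the unit part is [t] times their composite. It fixes the
    coform, whence [t] is inverse to the rank. *)
Lemma unit_part_dual B (sB : simple_ob B) : exists2 t, t * rank B = 1 &
  unit_part (dual B ⊗ B) = t *: (coform B ∘ form_dual B).
Proof.
have [n [i [p e]]] := unit_part_factor (dual B ⊗ B).
have [t te] : exists t, unit_part (dual B ⊗ B) = t *: (coform B ∘ form_dual B).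
  have /choice[u ue] : forall k, exists u, i k = u *: coform B.
    by move=> k; exact: coform_span.
  have /choice[w we] : forall k, exists w, p k = w *: form_dual B.
    by move=> k; exact: form_span.
  exists (\sum_k u k * w k); rewrite e scaler_suml; apply: eq_bigr => k _.
  by rewrite ue we compZl compZr scalerA.
exists t => //; apply/eqP; rewrite -subr_eq0; apply/eqP/(coform_free sB).
rewrite scalerBl scale1r -{2}(unit_part_one (coform B)) te compZl -compA.
by rewrite form_dual_coform rankE compZr compm1 scalerA subrr.
Qed.

Lemma srank_unit (a : simple S) : exists t, t * srank a = 1 :> R.
Proof. by have [t t1 _] := unit_part_dual (sobj_simple a); exists t. Qed.
Definition irank (a : simple S) : R := xget 0 [set t | t * srank a = 1]%classic.
Lemma irankK (a : simple S) : irank a * srank a = 1.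
Proof.
rewrite /irank; case: xgetP => [x _ -> //|].
by have [t te] := srank_unit a => /(_ t).
Qed.

(** Schur's lemma is stated for representatives only, and the dual of one is merely isomorphic to
    another. Transposition carries Schur's lemma over to duals. *)
Lemma dual_mate B B' (m : hom (dual B') (dual B)) : exists φ : hom B B',
  forall D, m ⊠ idm D =
    (dual B ◁ ev B' D) ∘ ((dual B ◁ (φ ⊠ idm _)) ∘ coev B (dual B' ⊗ D)).
Proof.
exists (lunit B' ∘ (form B ⊠ idm B') ∘ assocV B (dual B) B'
  ∘ (B ◁ ((m ⊠ idm B') ∘ coform B')) ∘ runitV B) => D.
rewrite -zigzag -lift_lift0 lift_tens -/(coev _ _) -/(ev _ _).
rewrite compA -whisker (compE _ (esym (ev_nat B (ev B' D)))) -compA -!whisker.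
rewrite tens_id (compEE _ (esym (interchange m _))) snakeV compm1.
exact/esym/bendV.
Qed.

(** Both sides evaluate the same theta-shaped graph, closed along [B] or along [A]. *)
Lemma rot_pairing B Z A (F : hom A (B ⊗ Z)) (G : hom (B ⊗ Z) A) C :
  ev B C ∘ ((B ◁ ((rotG G ∘ rotF F) ⊠ idm C)) ∘ coev' B C) =
  ev A C ∘ (((G ∘ F) ⊠ idm (dual A ⊗ C)) ∘ coev' A C).
Proof.
rewrite -mrg_spl spl_rotF mrg_rotG !whisker -!compA.
rewrite -coev'_nat (compEE _ (esym (coev'_nat _ _))) (compE _ (snake' _ _)) comp1m.
rewrite (compEE _ (ev_nat _ _)) (compEE _ (ev_nat _ _)) (compE _ (snake _ _)) comp1m.
by rewrite -mrg_spl -!compA.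
Qed.

Implicit Types a b w : simple S.

Lemma rot_schur_neq b (b' : simple S) Z A (F : hom A (sobj b' ⊗ Z)) (G : hom (sobj b ⊗ Z) A) :
  b != b' -> rotG G ∘ rotF F = 0.
Proof.
move=> bb'; have [φ e] := dual_mate (rotG G ∘ rotF F).
apply: tail_inj; rewrite e (simple_schur φ bb') tens0l tens0r comp0l comp0r.
by rewrite tens0l.
Qed.

(** The composite is a scalar by transposition; [rot_pairing] determines it by comparing traces,
    which is where the ratio of ranks comes from. *)
Lemma rot_schur_eq b Z a (F : hom (sobj a) (sobj b ⊗ Z)) (G : hom (sobj b ⊗ Z) (sobj a)) g :
  G ∘ F = g *: idm _ ->
  rotG G ∘ rotF F = (g * srank a * irank b) *: idm _.
Proof.
move=> gE; have [φ e] := dual_mate (rotG G ∘ rotF F).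
have [x xE] := simple_end φ.
have {}e : rotG G ∘ rotF F = x *: idm _.
  apply: tail_inj; rewrite e xE !(tensZl, tensZr) !tens_id compZl comp1m compZr.
  by rewrite snakeV.
rewrite e; congr (_ *: _).
have := rot_pairing F G one; rewrite e gE !tensZl tensZr !tens_id !compZl !comp1m !compZr.
rewrite !loop' !scalerA => /eqP; rewrite -subr_eq0 -scalerBl => /eqP /one_simple.2 /eqP.
rewrite subr_eq0 /srank => /eqP <-; rewrite -mulrA [rank _ * _]mulrC irankK mulr1 //.
Qed.

(** This is the decomposition of [dual A], transposed. *)
Lemma id_factor_dual A : exists (n : simple S -> nat)
    (p : forall w, 'I_(n w) -> hom (dual (sobj w)) A)
    (q : forall w, 'I_(n w) -> hom A (dual (sobj w))),
  \sum_w \sum_(k < n w) p w k ∘ q w k = idm A.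
Proof.
pose q w k : hom A (dual (sobj w)) := runit (dual (sobj w)) ∘
  (dual (sobj w) ◁ (form_dual A ∘ (@inj (dual A) w k ⊠ idm A))) ∘ assoc _ _ _
  ∘ (coform (sobj w) ⊠ idm A) ∘ lunitV A.
pose p w k : hom (dual (sobj w)) A := runit A ∘
  (A ◁ (form (sobj w) ∘ (@proj (dual A) w k ⊠ idm _))) ∘ assoc _ _ _
  ∘ (coform_dual A ⊠ idm _) ∘ lunitV _.
exists (dim (dual A)), p, q; apply: tail_inj; rewrite tens_id.
rewrite tens_suml; under eq_bigr => w _ do rewrite tens_suml.
transitivity (\sum_w \sum_(k < dim (dual A) w)
  (A ◁ (ev' A one ∘ ((@inj (dual A) w k ∘ proj k) ⊠ idm _))) ∘ coev' A (A ⊗ one)).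
  apply: eq_bigr => w _; apply: eq_bigr => k _; rewrite rwhisker.
  rewrite -!zagzig -(lift2_lift (inj k ⊠ idm A)) -(lift2_lift (proj k ⊠ idm _)).
  rewrite -/(coev' _ _) -/(coev _ _) -/(ev _ _) -/(ev' _ _) !lift_tens !tens_id.
  rewrite -!compA coev'_nat compA -!whisker -!compA; congr ((_ ◁ _) ∘ _).
  by rewrite interchange compA bend -compA -rwhisker.
under eq_bigr => w _ do rewrite -comp_suml -tens_sumr -comp_sumr -tens_suml.
rewrite -comp_suml -tens_sumr -comp_sumr -tens_suml sum_inj_proj tens_id compm1.
exact: snake'.
Qed.

Hypothesis domR : forall x y : R, x * y = 0 -> x = 0 \/ y = 0.

(** Between simple objects morphisms are scalars or zero, so decomposing source and target reduces
    the claim to matrix entries in a domain. *)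
Lemma torsion_free A B (f : hom A B) c : c *: f = 0 -> c = 0 \/ f = 0.
Proof.
move=> cf; have [-> |c0] := pselect (c = 0); first by left.
right; rewrite -[f]comp1m -[f]compm1 -[idm A]sum_inj_proj -[idm B]sum_inj_proj.
rewrite comp_suml big1 // => b _; rewrite comp_suml big1 // => j _.
rewrite !comp_sumr big1 // => a _; rewrite !comp_sumr big1 // => i _.
have : proj j ∘ (f ∘ inj i) = 0.
  have [ab|ab] := eqVneq a b; last exact: simple_schur.
  subst b; have [x e] := simple_end (proj j ∘ (f ∘ inj i)).
  rewrite e; have /simple_free/domR : (c * x) *: idm (sobj a) = 0.
    by rewrite -scalerA -e -compZr -compZl cf comp0l comp0r.
  by case=> // ->; rewrite scale0r.
by move=> e; rewrite -!compA (compA f) (compA (proj j)) e comp0l comp0r.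
Qed.
End Semisimple.
End Simple.

(** * The resolution of the identity behind the handle slide *)

Section HandleSlide.
Variables (R : comNzRingType) (T : tortile_category R) (S : semisimple T).
Implicit Types (A B C P Q W Y Z : T) (a b w : simple S) (s : bool).

Lemma lift_sum (I : Type) r (Q : pred I) A B A' B' (F : I -> hom (A ⊗ B) (A' ⊗ B')) C :
  lift (\sum_(i <- r | Q i) F i) C = \sum_(i <- r | Q i) lift (F i) C.
Proof. by rewrite liftE tens_suml comp_sumr comp_suml; apply: eq_bigr => i _; rewrite liftE. Qed.
Lemma liftZ A B A' B' c (f : hom (A ⊗ B) (A' ⊗ B')) C : lift (c *: f) C = c *: lift f C.
Proof. by rewrite !liftE tensZl compZr compZl. Qed.

(** The sum fixes every [rotF F], the rotated bases being dual to each other up to ratios of ranks.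
    By [rotF_surj] these are all morphisms from duals of simple objects, and the identity factors
    through such morphisms. *)
Lemma rot_resolution a Z :
  \sum_(b : simple S) \sum_(i < dim (S:=S) (sobj b ⊗ Z) a)
     (srank b * irank a) *: (rotF (inj i) ∘ rotG (proj i)) = idm (Z ⊗ dual (sobj a)).
Proof.
set e := \sum_(b : simple S) _.
have eF w (F : hom (sobj a) (sobj w ⊗ Z)) : e ∘ rotF F = rotF F.
  rewrite (factor_simple F) rotF_sum comp_sumr; apply: eq_bigr => j _.
  rewrite rotFZ compZr; congr (_ *: _); rewrite /e comp_suml (bigD1 w) //=.
  rewrite [X in _ + X]big1 ?addr0 => [|b bw]; last first.
    rewrite comp_suml big1 // => i _.
    by rewrite compZl -compA (rot_schur_neq _ _ bw) comp0r scaler0.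
  rewrite comp_suml (bigD1 j) //= big1 ?addr0 => [|i ij].
    rewrite compZl -compA (rot_schur_eq (g := 1)) ?compZr ?compm1 ?scalerA.
      by rewrite mul1r -mulrA (mulrA (irank a)) irankK mul1r mulrC irankK scale1r.
    by rewrite proj_inj eqxx scale1r.
  rewrite compZl -compA (rot_schur_eq (g := 0)) ?mul0r ?scale0r ?comp0r ?scaler0 //.
  by rewrite proj_inj eq_sym (negPf ij).
have [n [p [q pq]]] := id_factor_dual S (Z ⊗ dual (sobj a)).
rewrite -[LHS]compm1 -pq comp_sumr; apply: eq_bigr => w _.
rewrite comp_sumr; apply: eq_bigr => k _.
by have [F <-] := rotF_surj (p w k); rewrite compA eF.
Qed.

(* The strand Z slides over a U-labelled loop decorated by N: the b-labelled loop
   together with Z is resolved into simple c, and the basis of hom(c, b Z) is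
   rotated into a basis of morphisms from the dual of b to Z tensor the dual of c. *)
Lemma handle_slide Y (N : forall W, hom (W ⊗ Y) (W ⊗ Y)) Z :
  (forall W W' (f : hom W W'), N W' ∘ (f ⊠ idm Y) = (f ⊠ idm Y) ∘ N W) ->
  \sum_(b : simple S) srank b *: ptr (assoc (sobj b) Z Y ∘ N (sobj b ⊗ Z) ∘ assocV (sobj b) Z Y) =
  Z ◁ (\sum_(a : simple S) srank a *: ptr (N (sobj a))).
Proof.
move=> Nnat.
transitivity (\sum_(b : simple S) \sum_(a : simple S) \sum_(i < dim (S:=S) (sobj b ⊗ Z) a)
   srank b *: ptr (spl (inj i) Y ∘ (N (sobj a) ∘ mrg (proj i) Y))).
  apply: eq_bigr => b _; rewrite -[N _]compm1 -tens_id -[idm (_ ⊗ Z)](sum_inj_proj S).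
  rewrite !(tens_suml, comp_suml, comp_sumr) ptr_sum scaler_sumr; apply: eq_bigr => a _.
  rewrite !(tens_suml, comp_suml, comp_sumr) ptr_sum scaler_sumr; apply: eq_bigr => i _.
  by rewrite rwhisker splE mrgE -!compA (compEE _ (Nnat _ _ (inj i))).
rewrite exchange_big tens_sumr; apply: eq_bigr => a _ /=.
have a1 : srank a * irank a = 1 by rewrite mulrC irankK.
(* The resolution is inserted between [N] and the cap closing the [a]-loop; its weight $r_b/r_a$
   turns $r_a$ into $r_b$. *)
rewrite tensZr /ptr !whisker -[(Z ◁ (dual _ ◁ N _)) ∘ _]comp1m.
rewrite -(lift_id _ _ (sobj a ⊗ Y)) -rot_resolution lift_sum.
rewrite comp_suml comp_sumr scaler_sumr; apply: eq_bigr => b _.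
rewrite lift_sum comp_suml comp_sumr scaler_sumr; apply: eq_bigr => i _.
rewrite liftZ compZl compZr scalerA mulrCA a1 mulr1; congr (_ *: _).
rewrite -spl_mrg -!compA (compEE _ (mrg_nat _ _)).
have e1 : mrg (rotG (proj i)) (sobj a ⊗ Y) ∘ (Z ◁ coev (sobj a) Y) =
    (dual (sobj b) ◁ mrg (proj i) Y) ∘ coev (sobj b) (Z ⊗ Y).
  rewrite mrg_rotG -!compA coev_nat; do 2![rewrite compA -whisker]; rewrite -compA mrg_nat.
  by rewrite (compE _ (snake _ _)) comp1m.
have e2 : (Z ◁ ev' (sobj a) Y) ∘ spl (rotF (inj i)) (sobj a ⊗ Y) =
    ev' (sobj b) (Z ⊗ Y) ∘ (dual (sobj b) ◁ spl (inj i) Y).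
  rewrite spl_rotF (compEE _ (esym (ev'_nat _ _))) -!whisker.
  by rewrite (compE _ (esym (spl_nat _ _))) -compA snake' compm1.
by rewrite e1 (compE _ e2) !whisker -!compA.
Qed.
End HandleSlide.

(** * Encircling by U *)

Section DoubleBraiding.
Variables (R : comNzRingType) (T : tortile_category R).
Implicit Types (A B C D P Q W Y Z : T) (s : bool).

Lemma dblK s A B C : dbl (~~ s) A B C ∘ dbl s A B C = idm _.
Proof. by rewrite !dbl_def -compA (compE _ (XK _ _ _ _)) comp1m XK. Qed.

Lemma dblC s A B C : dbl s A B C = idm _ -> dbl (~~ s) A B C = idm _.
Proof. by move=> e; have := dblK s A B C; rewrite e compm1. Qed.

Lemma X_tensV s P Q A D :
  (A ◁ assoc P Q D) ∘ X s (P ⊗ Q) A D =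
  X s P A (Q ⊗ D) ∘ ((P ◁ X s Q A D) ∘ assoc P Q (A ⊗ D)).
Proof.
apply: (comp_injr (f := X (~~ s) A (P ⊗ Q) D) (g := X s (P ⊗ Q) A D) (XK _ _ _ _)).
rewrite -!compA X_tens XVK compm1.
by rewrite -!compA (compE _ (XVKw _ _ _ _ _)) comp1m (compE _ (XVK _ _ _ _)) comp1m.
Qed.

Lemma assocKw A P Q C : (A ◁ assocV P Q C) ∘ (A ◁ assoc P Q C) = idm _.
Proof. by rewrite -whisker assocK tens_id. Qed.
Lemma assocVKw A P Q C : (A ◁ assoc P Q C) ∘ (A ◁ assocV P Q C) = idm _.
Proof. by rewrite -whisker assocVK tens_id. Qed.

Lemma dbl_tens s P Q A C :
  assoc P Q (A ⊗ C) ∘ dbl s (P ⊗ Q) A C ∘ assocV P Q (A ⊗ C) =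
  (P ◁ X s A Q C) ∘ (dbl s P A (Q ⊗ C) ∘ (P ◁ X s Q A C)).
Proof.
rewrite !dbl_def -!compA (compE _ (X_tens _ _ _ _ _)) -!compA (compE _ (X_tensV _ _ _ _ _)).
by rewrite -!compA assocVK compm1.
Qed.

Lemma dbl_tensr s A P Q C :
  (A ◁ assoc P Q C) ∘ dbl s A (P ⊗ Q) C ∘ (A ◁ assocV P Q C) =
  X s P A (Q ⊗ C) ∘ ((P ◁ dbl s A Q C) ∘ X s A P (Q ⊗ C)).
Proof.
rewrite !dbl_def -!compA (compE _ (X_tensV _ _ _ _ _)) -!compA (compE _ (X_tens _ _ _ _ _)).
by rewrite -!compA assocVKw compm1 whisker -!compA.
Qed.

Lemma dbl_natl s A A' B C (f : hom A A') :
  dbl s A' B C ∘ (f ⊠ idm _) = (f ⊠ idm _) ∘ dbl s A B C.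
Proof. by rewrite !dbl_def -compA XnatL !compA XnatR. Qed.
Lemma dbl_natr s A B B' C (f : hom B B') :
  dbl s A B' C ∘ (A ◁ (f ⊠ idm _)) = (A ◁ (f ⊠ idm _)) ∘ dbl s A B C.
Proof. by rewrite !dbl_def -compA XnatR !compA XnatL. Qed.
Lemma dbl_one s A C : dbl s A one C = idm _.
Proof.
apply: (comp_injr (f := A ◁ lunitV C) (g := A ◁ lunit C)).
  by rewrite -whisker lunitK tens_id.
rewrite comp1m !dbl_def -compA X_one -(negbK s); apply: (comp_injl (XK (~~ s) _ _ _)).
by rewrite (compE _ (XVK _ _ _ _)) comp1m X_one.
Qed.

Definition dblm s A B : hom (A ⊗ B) (A ⊗ B) := crossm s B A ∘ crossm s A B.
Lemma dblE s A B C : dbl s A B C = lift (dblm s A B) C.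
Proof. by rewrite dbl_def lift_comp. Qed.

(** The loop does not meet the tail, so one endomorphism serves for all tails. This makes the
    scalars of [K_simple] and [sloopE] independent of [C]. *)
Lemma ptr_tail A P Q (f : hom (A ⊗ P) (A ⊗ Q)) : exists φ : hom P Q,
  forall C, ptr (lift f C) = φ ⊠ idm C.
Proof.
exists (lunit Q ∘ (form_dual A ⊠ idm Q) ∘ assocV _ _ _ ∘ (dual A ◁ f) ∘
  ((dual A ◁ idm (A ⊗ P)) ∘ assoc _ _ _ ∘ (coform A ⊠ idm P) ∘ lunitV P)) => C.
rewrite /ptr -{1}[f]compm1 -spl_mrg whisker /ev' /coev -!compA mate2.
by rewrite compA mate1 mrg_spl -!compA.
Qed.

(* The strand is encircled on the right instead of on the left. *)
Lemma right_loop t A B C :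
  (A ◁ ev B C) ∘ (dbl t A B (dual B ⊗ C) ∘ (A ◁ coev' B C)) = ptr (dbl t B A C).
Proof.
have evE : ev B C = ev' B C ∘ ((dual B ◁ (twistV B ⊠ idm C)) ∘ X false B (dual B) C).
  rewrite ev'E -!compA (compE (h := idm _) (g := dual B ◁ _)).
    by rewrite comp1m XVK compm1.
  by rewrite -whisker twistVw tens_id.
have coev'E : coev' B C = (twist B ⊠ idm _) ∘ (X true (dual B) B C ∘ coev B C).
  by rewrite /coev' /coev /X /coform_dual -!lift_lift0 lift_comp lift_tens tens_id -compA.
have XtwistE : (A ◁ X false B (dual B) C) ∘ (A ◁ (twist B ⊠ idm (dual B ⊗ C)))
  = (A ◁ (dual B ◁ (twist B ⊠ idm C))) ∘ (A ◁ X false B (dual B) C).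
  by rewrite -whisker XnatL whisker.
have twistVE : (A ◁ (dual B ◁ (twistV B ⊠ idm C))) ∘ (A ◁ (dual B ◁ (twist B ⊠ idm C))) = idm _.
  by rewrite -!whisker twistw !tens_id.
have slideE : dbl t A B (dual B ⊗ C) ∘ (A ◁ X true (dual B) B C) =
  (A ◁ X true (dual B) B C) ∘ (X true (dual B) A (B ⊗ C) ∘ ((dual B ◁ dbl t A B C)
    ∘ X false A (dual B) (B ⊗ C))).
  have := slide true (dual B) (dblm t A B) C; rewrite -!dblE.
  move=> /(congr1 (fun h => h ∘ X false A (dual B) (B ⊗ C))).
  by rewrite -!compA (XVK true) compm1 => ->.
have coevX : X false A (dual B) (B ⊗ C) ∘ (A ◁ coev B C) =
    (dual B ◁ X true B A C) ∘ coev B (A ⊗ C).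
  by rewrite /coev -(slide0 false A (coform B)) (compE _ (XKw false _ _ _ _)) comp1m.
have evX : (A ◁ ev' B C) ∘ X true (dual B) A (B ⊗ C) =
    ev' B (A ⊗ C) ∘ (dual B ◁ X false A B C).
  by rewrite /ev' -(slide2 false A (form_dual B)) -!compA (XK true) compm1.
rewrite evE coev'E !whisker -!compA (compEE _ (dbl_natr _ _ _ _)) (compEE _ XtwistE).
rewrite (compE _ twistVE) comp1m (compE _ slideE) -!compA coevX.
rewrite (compE _ (XKw true _ _ _ _)) comp1m (compE _ evX) -!compA /ptr.
have <- : X false A B C ∘ (dbl t A B C ∘ X true B A C) = dbl t B A C.
  rewrite !dbl_def; case: t {slideE}; rewrite -!compA.
    by rewrite (compE _ (XK true _ _ _)) comp1m.
  by rewrite (XVK false) compm1.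
by rewrite !whisker -!compA.
Qed.

Definition transparent A := forall s B C, dbl s A B C = idm _.
Lemma transparentP A s : (forall B C, dbl s B A C = idm _) -> transparent A.
Proof.
have H t : (forall B C, dbl t B A C = idm (B ⊗ (A ⊗ C))) -> forall B C, dbl t A B C = idm _.
  move=> h B C; apply: (comp_injr (f := X t B A C) (XVK t A B C)).
  by rewrite comp1m !dbl_def -compA; have := h B C; rewrite !dbl_def => ->; rewrite compm1.
move=> h t; have [->|->] : t = s \/ t = ~~ s by case: (t) (s) => -[]; auto.
  exact: H.
by apply: H => B C; apply: dblC.
Qed.
Lemma transparent_X A s B C : transparent A -> X s B A C = X (~~ s) B A C.
Proof.
move=> tA; apply: (comp_injr (f := X s A B C) (XVK s B A C)).
by rewrite XK -dbl_def; apply: tA.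
Qed.
Lemma transparent_Xl A s B C : transparent A -> X s A B C = X (~~ s) A B C.
Proof.
move=> tA; apply: (comp_injl (f := X s B A C) (XK s B A C)).
by rewrite XVK -dbl_def; apply: tA.
Qed.
Lemma transparentr A s B C : transparent A -> dbl s B A C = idm _.
Proof. by move=> tA; rewrite !dbl_def (transparent_X s B C tA) XVK. Qed.
End DoubleBraiding.

Section Encircling.
Variables (R : comNzRingType) (T : tortile_category R) (S : semisimple T).
Implicit Types (A B C P Q W Y Z : T) (a b w : simple S) (s : bool).

(* A loop labelled by U around the strand W. *)
Definition K s W C : hom (W ⊗ C) (W ⊗ C) :=
  \sum_(b : simple S) srank b *: ptr (dbl s (sobj b) W C).

Lemma K_natl s W W' C (f : hom W W') : K s W' C ∘ (f ⊠ idm C) = (f ⊠ idm C) ∘ K s W C.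
Proof.
rewrite /K comp_suml comp_sumr; apply: eq_bigr => b _.
by rewrite compZl compZr -ptr_natl -ptr_natr dbl_natr.
Qed.

Lemma K_simple s a : exists k, forall C, K s (sobj a) C = k *: idm _.
Proof.
have /choice[φ φE] : forall b : simple S, exists φ, forall C,
    ptr (dbl s (sobj b) (sobj a) C) = φ ⊠ idm C.
  by move=> b; have [φ e] := ptr_tail (dblm s (sobj b) (sobj a)); exists φ => C; rewrite dblE e.
have [k kE] := simple_end (\sum_b srank b *: φ b).
exists k => C; rewrite /K -(tens_id _ C) -tensZl -kE tens_suml; apply: eq_bigr => b _.
by rewrite φE tensZl.
Qed.

Lemma K_one s C : K s one C = X2 S *: idm _.
Proof.
rewrite /K /X2 scaler_suml; apply: eq_bigr => b _.
by rewrite dbl_one (ptr_id S) scalerA.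
Qed.

Lemma K_sone s C : K s (sobj (sone S)) C = X2 S *: idm _.
Proof. by rewrite (sobj_one S) K_one. Qed.

(** The handle slide for loops that link [y]: a strand [Z] passing around [y] can be taken off by
    sliding it over the loop. *)
Lemma K_slide s y Z C :
  X s y Z C ∘ (K s y (Z ⊗ C) ∘ X s Z y C) = Z ◁ K s y C.
Proof.
have := @handle_slide R T S (y ⊗ C) (fun W => dbl s W y C) Z (fun W W' f => dbl_natl s y C f).
rewrite -/(K s y C) => <-; rewrite /K comp_suml comp_sumr; apply: eq_bigr => b _.
by rewrite compZl compZr dbl_tens -ptr_natr -ptr_natl.
Qed.

Hypothesis domR : forall x y : R, x * y = 0 -> x = 0 \/ y = 0.

Lemma K_dichotomy s a : (forall C, K s (sobj a) C = 0) \/ transparent (sobj a).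
Proof.
have [k kE] := K_simple s a.
have [k0|k0] := pselect (k = 0); first by left=> C; rewrite kE k0 scale0r.
right; apply: (transparentP (s := s)) => Z C.
have := K_slide s (sobj a) Z C; rewrite !kE tensZr tens_id compZl comp1m compZr.
move=> /eqP; rewrite -subr_eq0 -scalerBr => /eqP /(torsion_free S domR) [] // /eqP.
by rewrite subr_eq0 dbl_def => /eqP.
Qed.

Lemma transparent_twist (y : simple S) : transparent (sobj y) -> nonzerodivisor (Cplus S) ->
  twist (sobj y) = idm (sobj y).
Proof.
move=> ty regC; have [t tE] := simple_end (twist (sobj y)).
(* The loop over which the strand slides carries a full twist; its value is $C_+$. *)
have := @handle_slide R T S one (fun W => twist W ⊠ idm one) (sobj y)
  (fun W W' f => twist_natw f one).
have -> : \sum_(b : simple S) srank b *: ptr (twist (sobj b) ⊠ idm one) = Cplus S *: idm one.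
  rewrite /Cplus scaler_suml; apply: eq_bigr => b _.
  rewrite {1}(scalarE (twist (sobj b)) (sobj_simple b)) tensZl tens_id ptrZ (ptr_id S).
  by rewrite !scalerA mulrAC -expr2.
move=> H; have {}H : Cplus S *: (twist (sobj y) ⊠ idm one) = Cplus S *: idm (sobj y ⊗ one).
  rewrite -[in RHS](tens_id (sobj y)) -[in RHS]tensZr -H /Cplus scaler_suml.
  apply: eq_bigr => b _.
  rewrite -liftE twist_tens lift_comp -[lift (_ ∘ _) _](dblE true).
  have -> : dbl true (sobj b) (sobj y) one = idm _ by exact: transparentr.
  rewrite comp1m lift_tens {2}(scalarE (twist (sobj b)) (sobj_simple b)) tensZl ptrZ.
  by rewrite -[X in ptr X]compm1 ptr_natl (ptr_id S) compZr compm1 !scalerA expr2 -!mulrA [_ * rank _]mulrC.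
move: H; rewrite tE tensZl tens_id scalerA => /eqP.
rewrite -subr_eq0 -scalerBl => /eqP H.
have : (Cplus S * t - Cplus S) *: idm (sobj y) = 0.
  by apply: tail_inj; rewrite tensZl tens_id H tens0l.
move=> /simple_free/eqP; rewrite subr_eq0 -[X in _ == X]mulr1 => /eqP /regC ->.
by rewrite scale1r.
Qed.

Section Killing.
Variable s : bool.
Hypothesis kill : forall a C, a != sone S -> K s (sobj a) C = 0.

(** By naturality the loop acts on each simple summand separately, and only summands isomorphic to
    the unit survive. *)
Lemma K_unit W C : K s W C = X2 S *: (unit_part S W ⊠ idm C).
Proof.
rewrite -[LHS]compm1 -tens_id -(sum_inj_proj S W) tens_suml comp_sumr.
rewrite (bigD1 (sone S)) //= [X in _ + X]big1 ?addr0 => [|b b1]; last first.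
  rewrite tens_suml comp_sumr big1 // => i _.
  by rewrite rwhisker compA K_natl kill // comp0r comp0l.
rewrite /unit_part !tens_suml comp_sumr scaler_sumr; apply: eq_bigr => i _.
by rewrite rwhisker compA K_natl K_sone compZr compm1 compZl.
Qed.

Lemma irank_eq b t : t * rank (sobj b) = 1 -> t = irank b.
Proof. by move=> e; rewrite -[t]mulr1 -(irankK b) mulrCA e mulr1. Qed.

Lemma K_dual b C : lift (unit_part S (dual (sobj b) ⊗ sobj b)) C =
  irank b *: (coev (sobj b) C ∘ ev' (sobj b) C).
Proof.
have [t /irank_eq -> ->] := unit_part_dual S (sobj_simple b).
by rewrite liftZ -lift0_lift2.
Qed.

(* Two opposite encirclings by U cut the strand. *)
Lemma cut b C C' (M : hom (sobj b ⊗ C) (sobj b ⊗ C')) :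
  \sum_(a : simple S) srank a *: ptr (dbl s (sobj a) (sobj b) C' ∘
     ((sobj a ◁ M) ∘ dbl (~~ s) (sobj a) (sobj b) C)) =
  (X2 S * irank b) *: (sobj b ◁ ptr M).
Proof.
set B := sobj b.
(* With the strand [b] bent back, the two opposite encirclings become one loop around [dual B] and
   [B] together. [K_unit] and [K_dual] replace that loop by a cap followed by a cup. *)
suff H : (dual B ◁ (\sum_(a : simple S) srank a *: ptr (dbl s (sobj a) B C' ∘
     ((sobj a ◁ M) ∘ dbl (~~ s) (sobj a) B C)))) ∘ coev B C = 
   (X2 S * irank b) *: (coev B C' ∘ ptr M).
  rewrite -[LHS]bend H tensZr compZr; congr (_ *: _).
  by rewrite whisker (compE _ (snake _ _)) comp1m.
transitivity (lift (X2 S *: unit_part S (dual B ⊗ B)) C' ∘ ((dual B ◁ M) ∘ coev B C)); last first.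
  by rewrite liftZ K_dual scalerA compZl -compA.
rewrite liftZ liftE -compZl -compZr -K_unit /K.
rewrite comp_sumr !comp_suml tens_sumr comp_suml; apply: eq_bigr => a _.
rewrite compZr !compZl tensZr compZl; congr (_ *: _).
have coevX t : X t (sobj a) (dual B) (B ⊗ C) ∘ (sobj a ◁ coev B C) =
    (dual B ◁ X (~~ t) B (sobj a) C) ∘ coev B (sobj a ⊗ C).
  by rewrite /coev -(slide0 t (sobj a) (coform B)) (compE _ (XKw _ _ _ _ _)) comp1m.
rewrite -(ptr_X s) -ptr_natr -!ptr_natl -!ptr_natr -[in RHS]compA; congr ptr.
rewrite -![in LHS]compA coevX [RHS]compA dbl_tensr.
rewrite (whisker (sobj a)) -!compA (compEE _ (X_nat s (sobj a) (dual B) M)) coevX negbK !dbl_def.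
by rewrite !whisker -!compA (compE _ (XKw _ _ _ _ _)) comp1m.
Qed.

(** The factor by which a [b]-loop acts on an [a]-strand: an entry of the S-matrix divided by
    $r_a$. *)
Definition sloop t b a : R := scalar (runit _ ∘ ptr (dbl t (sobj b) (sobj a) one) ∘ runitV _).
Lemma sloopE t b a C : ptr (dbl t (sobj b) (sobj a) C) = sloop t b a *: idm _.
Proof.
have [φ φE] := ptr_tail (dblm t (sobj b) (sobj a)).
have [x xE] := simple_end φ.
rewrite dblE φE xE tensZl tens_id; congr (_ *: _).
apply/esym/(scalar_eq (sobj_simple a)).
by rewrite dblE φE xE tensZl tens_id compZr compm1 compZl runitVK.
Qed.

Lemma sloop_sum b : \sum_(a : simple S) srank a ^+ 2 * (sloop s b a * sloop (~~ s) b a) = X2 S.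
Proof.
(* Taking a cap followed by a cup for [M] makes its partial trace the identity, while the cut strand
   closes up into two separate loops around [a]. *)
set B := sobj b; pose M := coev' B one ∘ ev B one.
have := cut M; move=> /(congr1 (fun h => ev B one ∘ (h ∘ coev' B one))).
have -> : ptr M = idm _.
  by rewrite /ptr /M whisker -!compA snakeV compm1 snakeV'.
rewrite tens_id compZl comp1m compZr (loop' S) -/(srank b) scalerA -mulrA irankK mulr1 => H.
have [_ inj1] := one_simple S; apply/eqP; rewrite -subr_eq0; apply/eqP/inj1.
rewrite scalerBl -H comp_suml comp_sumr scaler_suml; apply/eqP; rewrite subr_eq0; apply/eqP.
apply: eq_bigr => a _; rewrite compZl compZr -ptr_natr -ptr_natl /M whisker -!compA.
rewrite right_loop (compA (dbl s _ _ _)) (compE _ (right_loop s _ _ _)).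
rewrite !sloopE compZl compZr compm1 !ptrZ (ptr_id S) !scalerA.
by rewrite -/(srank a) expr2 -!mulrA; congr (_ * _ *: _); rewrite mulrC -mulrA.
Qed.
End Killing.

Lemma commutator_sum :
  (forall a C, a != sone S -> K false (sobj a) C = 0) ->
  \sum_(c : simple S) \sum_(b : simple S) \sum_(a : simple S) (srank a * srank b * srank c) *:
   ptr (ptr (ptr ((sobj a ◁ dbl true (sobj b) (sobj c) one) ∘ (dbl false (sobj a) (sobj b) (sobj c ⊗ one) ∘
     ((sobj a ◁ dbl false (sobj b) (sobj c) one) ∘ dbl true (sobj a) (sobj b) (sobj c ⊗ one))))))
  = (X2 S ^+ 2 * #|simple S|%:R) *: idm one.
Proof.
move=> kill; transitivity (\sum_(c : simple S) \sum_(b : simple S)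
  (X2 S * (srank c ^+ 2 * (sloop false b c * sloop true b c))) *: idm (@one _ T)).
  apply: eq_bigr => c _; apply: eq_bigr => b _.
  (* The sum over [a] has the form required by [cut], with [M] the inverse double braiding of [b]
     and [c]. *)
  transitivity ((srank b * srank c) *: ptr (ptr (dbl true (sobj b) (sobj c) one ∘
    (\sum_(a : simple S) srank a *: ptr (dbl false (sobj a) (sobj b) (sobj c ⊗ one) ∘
     ((sobj a ◁ dbl false (sobj b) (sobj c) one) ∘ dbl true (sobj a) (sobj b) (sobj c ⊗ one))))))).
    rewrite comp_sumr !ptr_sum scaler_sumr; apply: eq_bigr => a _.
    by rewrite compZr !ptrZ scalerA -ptr_natl -mulrA [srank a * _]mulrC.
  rewrite (cut kill) sloopE compZr tensZr tens_id compZr compm1 !ptrZ sloopE !ptrZ (ptr_id S).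
  rewrite !scalerA; congr (_ *: _); rewrite expr2.
  rewrite -/(srank c) -[RHS]mul1r -(irankK b); ring.
rewrite exchange_big /=; under eq_bigr => b _.
  by rewrite -scaler_suml -mulr_sumr (sloop_sum kill b) over.
by rewrite sumr_const cardT -cardE -scaler_nat scalerA mulrC -expr2.
Qed.
End Encircling.

(** * The two links *)

Section Eval.
Variables (R : comNzRingType) (T : tortile_category R) (L : Type) (lab : L -> T).

Lemma eval_dcat w w' w'' (D : diagram w w') (E : diagram w' w'') :
  eval lab (dcat D E) = eval lab E ∘ eval lab D.
Proof. by elim: D E => [u|u u' u'' st D IH] E /=; rewrite ?compm1 // IH compA. Qed.
Lemma eval_dstep w w' (st : step w w') : eval lab (dstep st) = eval_step lab st.
Proof. exact: comp1m. Qed.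
Lemma eval_dskip x w w' (D : diagram w w') :
  eval lab (dskip x D) = strand lab x ◁ eval lab D.
Proof. by elim: D => [u|u u' u'' st D IH] /=; rewrite ?tens_id // IH whisker. Qed.
Lemma eval_cup x w : eval_step lab (cup x w) = lift0 (cupm lab x) (wob lab w).
Proof. by rewrite lift0E. Qed.
Lemma eval_cap x w : eval_step lab (cap x w) = lift2 (capm lab x) (wob lab w).
Proof. by rewrite lift2E. Qed.

Lemma eval_around x l (D : diagram (upward (x :: l)) (upward (x :: l))) :
  eval lab (dcat (dstep (cup (x, false) (upward l)))
    (dcat (dskip (x, true) D) (dstep (cap (x, true) (upward l))))) =
  ptr (eval lab D : hom (lab x ⊗ wob lab (upward l)) (lab x ⊗ wob lab (upward l))).
Proof. by rewrite !eval_dcat !eval_dstep eval_dskip eval_cup eval_cap -compA. Qed.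

Lemma eval_closure3 a b c (D : diagram (upward [:: a; b; c]) (upward [:: a; b; c])) :
  eval lab (braid_closure D) =
  ptr (A := lab c) (ptr (A := lab b) (ptr (A := lab a) (eval lab D))).
Proof.
transitivity (ptr (A := lab c) (ptr (A := lab b) (eval lab
  (dcat (dstep (cup (a, false) (upward [:: b; c]))) (dcat (dskip (a, true) D)
     (dstep (cap (a, true) (upward [:: b; c])))))))); last by rewrite eval_around.
rewrite -(eval_around (x := b) (l := [:: c])) -(eval_around (x := c) (l := [::])) //.
Qed.
End Eval.

(** * The braid of the commutator as a commutator of double braidings *)

Section BraidIdentity.
Variables (R : comNzRingType) (T : tortile_category R).
Implicit Types A B C D : T.

(** The double braiding of [A] with [B] and [C] taken together, freed of associators. *)
Definition dbl2 t A B C D : hom (A ⊗ (B ⊗ (C ⊗ D))) (A ⊗ (B ⊗ (C ⊗ D))) :=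
  X t B A (C ⊗ D) ∘ ((B ◁ dbl t A C D) ∘ X t A B (C ⊗ D)).

Lemma dbl2_nat t A B C B' C' D (f : hom (B ⊗ C) (B' ⊗ C')) :
  (A ◁ lift f D) ∘ dbl2 t A B C D = dbl2 t A B' C' D ∘ (A ◁ lift f D).
Proof.
rewrite /dbl2 -!dbl_tensr liftE !whisker -!compA (compE _ (assocKw _ _ _ _)) comp1m.
rewrite (compE _ (assocKw _ _ _ _)) comp1m.
by rewrite (compEE _ (esym (dbl_natr _ _ _ _))).
Qed.

Lemma slide_dbl s t A B C D :
  dbl t A C (B ⊗ D) ∘ ((A ◁ X s B C D) ∘ X s B A (C ⊗ D)) =
  (A ◁ X s B C D) ∘ (X s B A (C ⊗ D) ∘ (B ◁ dbl t A C D)).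
Proof. by rewrite !dblE slide -compA. Qed.

Lemma dbl2E t A B C D : dbl2 t A B C D =
  (A ◁ X (~~ t) C B D) ∘ (dbl t A C (B ⊗ D) ∘ ((A ◁ X t B C D) ∘ dbl t A B (C ⊗ D))).
Proof.
rewrite [dbl t A B _]dbl_def (compA (A ◁ X t B C D)) (compE _ (slide_dbl _ _ _ _ _ _)).
by rewrite -!compA (compE _ (XKw _ _ _ _ _)) comp1m.
Qed.

(** On the left stands the braid of the relator, its first letter rightmost: $x$ becomes $y_2^2$ and
    $y$ becomes $y_2y_3^2y_2^{-1}$. On the right [A] circles only [B], and [B] circles only [C], the
    form in which the strand [b] can be cut. *)
Lemma braid_commutator A B C D :
  X false B A (C ⊗ D) ∘ ((B ◁ X false C A D) ∘ ((B ◁ X false A C D) ∘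
  (X true A B (C ⊗ D) ∘ (X false B A (C ⊗ D) ∘ (X false A B (C ⊗ D) ∘ (X false B A (C ⊗ D) ∘
  ((B ◁ X true C A D) ∘ ((B ◁ X true A C D) ∘
  (X true A B (C ⊗ D) ∘ (X true B A (C ⊗ D) ∘ X true A B (C ⊗ D))))))))))) =
  (A ◁ dbl true B C D) ∘ (dbl false A B (C ⊗ D) ∘
   ((A ◁ dbl false B C D) ∘ dbl true A B (C ⊗ D))).
Proof.
(* [A] reaches [C] by crossing [B]; equivalently [B] and [C] cross first. *)
have G t : X false B A (C ⊗ D) ∘ ((B ◁ dbl t A C D) ∘ X true A B (C ⊗ D)) =
   (A ◁ X true C B D) ∘ (dbl t A C (B ⊗ D) ∘ (A ◁ X false B C D)).
  apply: (comp_injr (f := X false B A (C ⊗ D)) (XK true _ _ _)).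
  rewrite -!compA (XVK true) compm1 slide_dbl.
  by rewrite (compE _ (XKw false _ _ _ _)) comp1m.
(* [A] circling [B] and [C] together commutes with the crossing of [B] and [C]; [dbl2E] expands both
   sides. *)
have H : dbl false A C (B ⊗ D) ∘ ((A ◁ X false B C D) ∘ dbl false A B (C ⊗ D)) =
   (A ◁ X true B C D) ∘ (dbl false A B (C ⊗ D) ∘ ((A ◁ X false C B D) ∘
     (dbl false A C (B ⊗ D) ∘ (A ◁ X false B C D)))).
  have := dbl2_nat false A D (crossm false B C); rewrite !dbl2E -/(X _ _ _ _).
  by rewrite -!compA (compE _ (XKw true _ _ _ _)) comp1m.
transitivity ((X false B A (C ⊗ D) ∘ ((B ◁ dbl false A C D) ∘ X true A B (C ⊗ D))) ∘
  (dbl false A B (C ⊗ D) ∘ ((X false B A (C ⊗ D) ∘ ((B ◁ dbl true A C D) ∘ X true A B (C ⊗ D)))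
   ∘ dbl true A B (C ⊗ D)))).
  by rewrite !dbl_def !whisker -!compA !(compE _ (XVK true B A _)) !comp1m.
rewrite !G -!compA (compA (A ◁ X false B C D) (dbl _ _ _ _)) (compE _ H) -!compA.
rewrite (compE _ (XKw true _ _ _ _)) comp1m (compE _ (dblK true _ _ _)) comp1m.
by rewrite !(dbl_def _ B C) !whisker -!compA.
Qed.
End BraidIdentity.

Section CommutatorLink.
Variables (R : comNzRingType) (T : tortile_category R) (S : semisimple T).

(** [link] transports along an opaque proof of purity. For a concrete relator the equality holds by
    computation, so irrelevance allows [erefl] instead and the transport reduces. *)
Lemma link_pureK P (l : seq (simple S)) (e : braid_act (link_braid P) l = l) :
  link_braid_pure P l = e.
Proof. exact: eq_irrelevance. Qed.

Lemma eval_trivial_link (a b c : simple S) :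
  eval (@sobj _ _ S) (link P_trivial [:: a; b; c]) =
  (srank a * srank b * srank c) *: idm (@one _ T).
Proof.
rewrite /link (@link_pureK P_trivial [:: a; b; c] erefl) [eq_rect _ _ _ _ _]/= eval_closure3.
rewrite /= (ptr_id S) ptrZ (ptr_id S) !ptrZ (ptr_id S) !scalerA //.
Qed.

Lemma eval_commutator_link (a b c : simple S) :
  eval (@sobj _ _ S) (link P_commutator [:: a; b; c]) =
   ptr (ptr (ptr ((sobj a ◁ dbl true (sobj b) (sobj c) one) ∘ (dbl false (sobj a) (sobj b) (sobj c ⊗ one) ∘
     ((sobj a ◁ dbl false (sobj b) (sobj c) one) ∘ dbl true (sobj a) (sobj b) (sobj c ⊗ one)))))).
Proof.
rewrite /link (@link_pureK P_commutator [:: a; b; c] erefl) [eq_rect _ _ _ _ _]/= eval_closure3.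
congr (ptr (ptr (ptr _))).
rewrite [eval _ _]/=.
rewrite !comp1m ?compm1.
rewrite -!liftE -!compA -(braid_commutator (sobj a) (sobj b) (sobj c) one).
by [].
Qed.
End CommutatorLink.

(** * Reduction modulo p *)

Section Domain.
Variables (p : nat) (p_prime : prime p).

(** Evaluation at a primitive $p$-th root of unity is multiplicative on $R$ since the root kills
    [cyclo p]. It is injective because canonical representatives have degree below $p-1$, the degree
    of the cyclotomic minimal polynomial. *)
Lemma mulRp_eq0 (x y : Rp p) : x * y = 0 -> x = 0 \/ y = 0.
Proof.
have p_gt1 := prime_gt1 p_prime; have p_gt0 := prime_gt0 p_prime.
have [z zp] := C_prim_root_exists p_gt0.
have z1 : z != 1 by rewrite -[z]expr1 -(prim_order_dvd zp) gtnNdvd.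
pose f : {rmorphism zloc p -> algC} := (ratr : rat -> algC) \o (val : zloc p -> rat).
pose e (q : {poly zloc p}) := (map_poly f q).[z].
have eM q r : e (q * r) = e q * e r by rewrite /e rmorphM hornerM.
have e_cyclo : e (mk_monic (cyclo p)) = 0.
  rewrite mk_monic_cyclo // /e /cyclo rmorph_sum horner_sum.
  rewrite (eq_bigr (fun i : 'I_p => z ^+ i)) => [|i _]; last first.
    by transitivity ((map_poly f 'X^i).[z]); rewrite // map_polyXn hornerXn.
  apply: (mulfI (x := z - 1)); first by rewrite subr_eq0.
  by rewrite -subrX1 (prim_expr_order zp) subrr mulr0.
have e0 (q : Rp p) : e (polyn q) = 0 -> q = 0.
  move=> eq0; pose g : {rmorphism zloc p -> rat} := (val : zloc p -> rat).
  have gsz (r : {poly zloc p}) : size (map_poly g r) = size r.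
    by apply: size_map_inj_poly; [exact: val_inj | exact: rmorph0].
  apply: val_inj; apply/eqP; rewrite -size_poly_eq0 -gsz size_poly_eq0.
  have [r [rE rmon] /(_ (map_poly g (polyn q)))] := minCpolyP z.
  rewrite /root -map_poly_comp -[X in X == 0]/(e (polyn q)) eq0 eqxx => /esym rq.
  have szr : size r = p.
    rewrite -(size_map_poly (ratr : {rmorphism rat -> algC})) -rE (minCpoly_cyclotomic zp).
    by rewrite size_cyclotomic totient_prime // prednK.
  apply: contraT => /dvdp_leq/(_ rq); rewrite szr gsz leqNgt.
  have szq : (size (polyn q) <= p.-1)%N.
    have := size_npoly q; move: (size (polyn q)) => n.
    by rewrite mk_monic_cyclo // size_cyclo.
  by rewrite (leq_ltn_trans szq) // prednK.
move=> xy0.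
have /(congr1 (@polyn _ _)) : x * y = in_qpoly (cyclo p) (polyn x * polyn y) by [].
rewrite xy0 /= => r0.
have := Pdiv.RingMonic.rdivp_eq (monic_mk_monic (cyclo p)) (polyn x * polyn y).
rewrite -r0 addr0 => /(congr1 e); rewrite !eM e_cyclo mulr0 => /eqP.
by rewrite mulf_eq0 => /orP[] /eqP /e0; auto.
Qed.

Lemma phi_sum (I : Type) (r : seq I) (P : pred I) (F : I -> Rp p) :
  phi (\sum_(i <- r | P i) F i) = \sum_(i <- r | P i) phi (F i).
Proof.
have [_ _ phiD _] := phi_rmorphism p_prime.
apply: (big_morph (@phi p) phiD); apply: (@addrI _ (phi (0 : Rp p))).
by rewrite -phiD !addr0.
Qed.

Lemma phi_vp n : phi (vp p ^+ n) = 1.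
Proof.
have [phi1 phiv _ phiM] := phi_rmorphism p_prime.
by elim: n => [|n IH]; rewrite ?expr0 // exprS phiM phiv IH mulr1.
Qed.

Lemma phi_nat n : phi (n%:R : Rp p) = n%:R.
Proof.
have [phi1 _ phiD _] := phi_rmorphism p_prime.
elim: n => [|n IH]; last by rewrite -natr1 phiD IH phi1 natr1.
by apply: (@addrI _ (phi (0 : Rp p))); rewrite -phiD !addr0.
Qed.
End Domain.

Section ReductionModP.
Variables (p : nat) (p_prime : prime p) (T : tortile_category (Rp p)) (S : semisimple T).
Hypothesis twist_pow : twists_are_powers S (vp p).

(* At v = 1 every twist becomes trivial, hence so does the S-matrix. *)
Lemma phi_loop (b y : simple S) : exists x : Rp p,
  ptr (ptr (dbl true (sobj b) (sobj y) one)) = x *: idm one /\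
  phi x = phi (srank b) * phi (srank y).
Proof.
have [phi1 phiv phiD phiM] := phi_rmorphism p_prime.
have /choice[t tE] := twist_pow.
(* Since $v^p=1$, the exponent $t(p-1)$ inverts $v^t$ without negative powers. *)
have tVE a : twistV (sobj a) = vp p ^+ (t a * p.-1) *: idm _.
  have vK : vp p ^+ (t a * p.-1) * vp p ^+ t a = 1.
    by rewrite -exprD -mulnSr prednK ?prime_gt0 // mulnC exprM vp_expr // expr1n.
  by rewrite -(twistK (sobj a)) tE compZr compm1 scalerA vK scale1r.
set B := sobj b; set Y := sobj y.
have trE (f : hom (B ⊗ Y) (B ⊗ Y)) : exists x, ptr (ptr (lift f one)) = x *: idm (@one _ T).
  exact: (one_simple S).1.
(* [τ z] is the trace of the projection of $BY$ onto its [z]-part, on which the double braiding acts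
   by $\theta_z\theta_b^{-1}\theta_y^{-1}$, a power of $v$. *)
have /choice[τ τE] : forall z : simple S, exists x : Rp p,
    ptr (ptr (lift (\sum_(i < dim (B ⊗ Y) z) inj i ∘ proj i) one)) = x *: idm (@one _ T).
  by move=> z; exact: trE.
have sumτ : \sum_z τ z = srank b * srank y.
  apply/eqP; rewrite -subr_eq0; apply/eqP/(one_simple S).2.
  rewrite scalerBl scaler_suml; under eq_bigr do rewrite -τE.
  rewrite -!ptr_sum -lift_sum sum_inj_proj lift_id (ptr_id S) ptrZ (ptr_id S) scalerA.
  exact: subrr.
exists (\sum_z (vp p ^+ (t z + (t b * p.-1 + t y * p.-1)) * τ z)); split; last first.
  rewrite phi_sum // -phiM -sumτ phi_sum //; apply: eq_bigr => z _.
  by rewrite phiM phi_vp // mul1r.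
rewrite scaler_suml dblE.
have -> : dblm true B Y = (vp p ^+ (t b * p.-1 + t y * p.-1)) *: twist (B ⊗ Y).
  rewrite twist_tens; transitivity (dblm true B Y ∘ ((twist B ⊠ twist Y) ∘ (twistV B ⊠ twistV Y))).
    by rewrite -tens_comp !twistVK tens_id compm1.
  by rewrite !tVE tensZl tensZr tens_id !compZr compm1 scalerA -exprD.
rewrite -[twist _]compm1 -(sum_inj_proj S (B ⊗ Y)) comp_sumr scaler_sumr.
rewrite lift_sum !ptr_sum; apply: eq_bigr => z _.
have -> : twist (B ⊗ Y) ∘ (\sum_(i < dim (B ⊗ Y) z) inj i ∘ proj i) =
    vp p ^+ t z *: \sum_(i < dim (B ⊗ Y) z) inj i ∘ proj i.
  rewrite comp_sumr scaler_sumr; apply: eq_bigr => i _.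
  by rewrite compA twist_nat tE compZr compm1 compZl.
by rewrite !scalerA -exprD addnC liftZ !ptrZ τE scalerA.
Qed.

Lemma phi_X2 (y : simple S) : K S true (sobj y) one = 0 -> phi (X2 S) = 0.
Proof.
have [phi1 phiv phiD phiM] := phi_rmorphism p_prime => K0.
have phi0 : phi (0 : Rp p) = 0 by apply: (@addrI _ (phi (0 : Rp p))); rewrite -phiD !addr0.
have /choice[x xE] : forall b : simple S, exists x, 
    ptr (ptr (dbl true (sobj b) (sobj y) one)) = x *: idm one /\
    phi x = phi (srank b) * phi (srank y) by move=> b; exact: phi_loop.
have : \sum_b srank b * x b = 0.
  apply: (one_simple S).2; rewrite scaler_suml.
  under eq_bigr do rewrite -scalerA -(proj1 (xE _)) -ptrZ.
  by rewrite -ptr_sum -/(K S true (sobj y) one) K0 ptr0.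
move=> /(congr1 (@phi p)); rewrite phi_sum // phi0.
under eq_bigr do rewrite phiM (proj2 (xE _)) mulrA -expr2.
rewrite -mulr_suml => /eqP; rewrite mulf_eq0 => /orP[/eqP <-|/eqP y0].
  by rewrite phi_sum //; apply: eq_bigr => b _; rewrite !expr2 phiM.
by have := phi1; rewrite -(irankK y) phiM y0 mulr0 => /esym/eqP; rewrite oner_eq0.
Qed.
End ReductionModP.

(** * Expansion of the two link invariants over labels *)

Section LinkSums.
Variables (R : comNzRingType) (T : tortile_category R) (S : semisimple T).

Lemma sum_tuple_cons (I : finType) n (F : n.+1.-tuple I -> R) :
  \sum_t F t = \sum_i \sum_(t : n.-tuple I) F [tuple of i :: t].
Proof.
rewrite pair_big /=.
rewrite (reindex (fun it : I * n.-tuple I => [tuple of it.1 :: it.2])) //=.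
exists (fun t => (thead t, [tuple of behead t])) => [[i t] _|t _] /=.
  by congr (_, _); apply: val_inj.
by rewrite -tuple_eta.
Qed.

Lemma Zlink3 P (Pn : (ngen P + nrel P = 3)%N) : Zlink S P =
  \sum_(a : simple S) \sum_(b : simple S) \sum_(c : simple S)
    srank a * srank b * srank c * scalar (eval (@sobj _ _ S) (link P [:: a; b; c]) : hom (l := T) one one).
Proof.
rewrite /Zlink; pose G l := scalar (eval (@sobj _ _ S) (link P l) : hom (l:=T) one one).
transitivity (\sum_(c : 3.-tuple (simple S)) (\prod_(a <- c) srank a) * G c).
  by move: (Pn); move: (ngen P + nrel P)%N => n ->.
rewrite !sum_tuple_cons; apply: eq_bigr => a _.
rewrite !sum_tuple_cons; apply: eq_bigr => b _.
rewrite !sum_tuple_cons; apply: eq_bigr => c _.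
rewrite (big_pred1 [tuple]) => [|t]; last by apply/esym/eqP; apply: tuple0.
by rewrite /= !big_cons big_nil mulr1 !mulrA.
Qed.

Lemma Zlink_trivial : Zlink S P_trivial = X2 S ^+ 3.
Proof.
rewrite Zlink3 // exprS expr2 /X2 mulr_suml; apply: eq_bigr => a _.
rewrite mulr_suml mulr_sumr; apply: eq_bigr => b _.
rewrite !mulr_sumr; apply: eq_bigr => c _.
rewrite (scalar_eq (one_simple S) (eval_trivial_link a b c)); ring.
Qed.

Lemma Zlink_commutator (domR : forall x y : R, x * y = 0 -> x = 0 \/ y = 0) :
  (forall (a : simple S) C, a != sone S -> K S false (sobj a) C = 0) ->
  Zlink S P_commutator = X2 S ^+ 2 * #|simple S|%:R.
Proof.
move=> kill; apply/eqP; rewrite -subr_eq0; apply/eqP/(one_simple S).2.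
rewrite scalerBl -(commutator_sum kill) Zlink3 //.
set H := fun a b c : simple S => scalar (eval (@sobj _ _ S) (link P_commutator [:: a; b; c])).
have HE a b c : H a b c *: idm one = _ := etrans (esym (scalarE _ (one_simple S)))
  (eval_commutator_link a b c).
rewrite -[X in X *: _ - _]/(\sum_a \sum_b \sum_c srank a * srank b * srank c * H a b c).
(* The values of the link are made abstract, so that rewriting under the sums does not compute
   them. *)
move: H HE => H HE; rewrite scaler_suml; apply/eqP; rewrite subr_eq0; apply/eqP.
under eq_bigr do rewrite scaler_suml.
rewrite exchange_big /=; under eq_bigr do under eq_bigr do rewrite scaler_suml.
under eq_bigr do rewrite exchange_big.
rewrite exchange_big /=; apply: eq_bigr => c _; apply: eq_bigr => b _; apply: eq_bigr => a _.
by rewrite -(scalerA _ (H a b c)); congr (_ *: _); apply: HE.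
Qed.
End LinkSums.

(** * Transparent components *)

Section Transparent.
Variables (R : comNzRingType) (T : tortile_category R) (A : T).
Hypothesis tA : transparent A.

(** A crossing with [dual A] is a crossing with [A] bent by [coev] and [ev], so it has no sign
    either. *)
Lemma transparent_dual : transparent (dual A).
Proof.
suff H s Z C : X s Z (dual A) C = X (~~ s) Z (dual A) C.
  by move=> s Z C; rewrite dbl_def (H s Z C) XK.
have {}H t D : X t Z (dual A) (A ⊗ D) ∘ (Z ◁ coev A D) =
    (dual A ◁ X true A Z D) ∘ coev A (Z ⊗ D).
  have -> : X true A Z D = X (~~ t) A Z D by case: t; rewrite // (transparent_Xl true).
  by rewrite /coev -(slide0 t Z (coform A)) (compE _ (XKw _ _ _ _ _)) comp1m.
have E t : X t Z (dual A) C = (dual A ◁ (Z ◁ ev A C)) ∘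
    ((dual A ◁ X true A Z _) ∘ coev A (Z ⊗ (dual A ⊗ C))).
  rewrite -(H t) compA -X_nat -compA -whisker snakeV tens_id compm1 //.
by rewrite !E.
Qed.

Definition mob (o : bool) : T := if o then dual A else A.

Lemma mob_transparent o : transparent (mob o).
Proof. by case: o; [exact: transparent_dual | exact: tA]. Qed.

Hypothesis twistA : twist A = idm A.

Definition mcup o C : hom C (mob (~~ o) ⊗ (mob o ⊗ C)) :=
  if o return hom C (mob (~~ o) ⊗ (mob o ⊗ C)) then coev' A C else coev A C.
Definition mcap o C : hom (mob o ⊗ (mob (~~ o) ⊗ C)) C :=
  if o return hom (mob o ⊗ (mob (~~ o) ⊗ C)) C then ev' A C else ev A C.
Definition mX o B C := X true (mob o) B C.

Lemma mcup_nat o C C' (g : hom C C') : mcup o C' ∘ g = (_ ◁ (_ ◁ g)) ∘ mcup o C.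
Proof. by case: o; [exact: coev'_nat | exact: coev_nat]. Qed.
Lemma mcap_nat o C C' (g : hom C C') : mcap o C' ∘ (_ ◁ (_ ◁ g)) = g ∘ mcap o C.
Proof. by case: o; [exact: ev'_nat | exact: ev_nat]. Qed.

Lemma mXK o B C : X true B (mob o) C ∘ mX o B C = idm _.
Proof. by have := mob_transparent o true B C; rewrite dbl_def. Qed.
Lemma coev'_sym C : coev' A C = X true (dual A) A C ∘ coev A C.
Proof.
by rewrite /coev' /coev /coform_dual twistA tens_id comp1m /X lift_lift0.
Qed.
Lemma ev'_sym C : ev' A C = ev A C ∘ X true (dual A) A C.
Proof.
by rewrite /ev' /ev /form_dual twistA tens_id compm1 /X lift2_lift.
Qed.

Lemma XK_A s Z C : X s Z A C ∘ X s A Z C = idm _.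
Proof. by rewrite -dbl_def tA. Qed.
Lemma XVK_A s Z C : X s A Z C ∘ X s Z A C = idm _.
Proof. by rewrite -dbl_def (transparentr s _ _ tA). Qed.
Lemma X_coev' C : X true A (dual A) C ∘ coev' A C = coev A C.
Proof. by rewrite coev'_sym compA -dbl_def (transparentr true _ _ tA) comp1m. Qed.
Lemma ev'_X C : ev' A C ∘ X true A (dual A) C = ev A C.
Proof. by rewrite ev'_sym -compA XK_A compm1. Qed.
Lemma ev_coev' C : ev A C ∘ coev' A C = ev' A C ∘ coev A C.
Proof. by rewrite ev'_sym coev'_sym compA. Qed.

Lemma mcup_slide o B C : X true (mob (~~ o)) B (mob o ⊗ C) ∘ ((mob (~~ o) ◁ X true (mob o) B C) ∘
   mcup o (B ⊗ C)) = B ◁ mcup o C.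
Proof. by case: o; [exact: (rslide0 true B (coform_dual A)) | exact: (rslide0 true B (coform A))]. Qed.
Lemma mcap_slide o B C : mcap o (B ⊗ C) ∘ ((mob o ◁ X true B (mob (~~ o)) C) ∘
   X true B (mob o) (mob (~~ o) ⊗ C)) = B ◁ mcap o C.
Proof. by case: o; [exact: (slide2 true B (form_dual A)) | exact: (slide2 true B (form A))]. Qed.

Fixpoint M (u : seq bool) (C : T) : T := if u is o :: u' then mob o ⊗ M u' C else C.

Section States.
Variables B C : T.

(** The target word is packed with the morphism. Operations are then total functions indexed by
    positions, equal to the identity where they do not apply, and can be compared without casts. *)
Definition arrow u := {u' : seq bool & hom (M u C) (M u' C)}.
Definition Arrow u u' (f : hom (M u C) (M u' C)) : arrow u := existT _ u' f.
Definition aop := forall u, arrow u.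
Definition skipA o u (x : arrow u) : arrow (o :: u) :=
  @Arrow (o :: u) (o :: projT1 x) (mob o ◁ projT2 x).
Arguments skipA o {u} x.
Definition aid : aop := fun u => Arrow (idm (M u C)).
Definition aseq (b a : aop) : aop := fun u => Arrow (projT2 (b (projT1 (a u))) ∘ projT2 (a u)).
Definition askip (a : aop) : aop := fun u => if u is o :: u' then skipA o (a u') else aid [::].

Lemma aseq_skip b a o u : aseq (askip b) (askip a) (o :: u) = skipA o (aseq b a u).
Proof. by rewrite /aseq /skipA /= -whisker. Qed.

Definition asw0 : aop := fun u => match u return arrow u with
  | x :: y :: u' => @Arrow (x :: y :: u') (y :: x :: u') (X true (mob x) (mob y) (M u' C))
  | u => aid u end.
Definition acu0 o : aop := fun u => @Arrow u (~~ o :: o :: u) (mcup o (M u C)).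
Definition aca0 : aop := fun u => match u return arrow u with
  | true :: false :: u' => @Arrow (true :: false :: u') u' (ev' A (M u' C))
  | false :: true :: u' => @Arrow (false :: true :: u') u' (ev A (M u' C))
  | u => aid u end.
Definition asw k := iter k askip asw0.
Definition acu k o := iter k askip (acu0 o).
Definition aca k := iter k askip aca0.

Definition state := {u : seq bool & hom B (M u C)}.
Definition State u (f : hom B (M u C)) : state := existT _ u f.
Definition ap (a : aop) (s : state) : state :=
  State (projT2 (a (projT1 s)) ∘ projT2 s).
Definition scale (r : R) (s : state) : state := State (r *: projT2 s).

Lemma ap_aseq b a s : ap b (ap a s) = ap (aseq b a) s.
Proof. by rewrite /ap /aseq /= compA. Qed.
Lemma ap_eq (a b : aop) s : a (projT1 s) = b (projT1 s) -> ap a s = ap b s.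
Proof. by rewrite /ap => ->. Qed.
Lemma ap_id s : ap aid s = s.
Proof. by case: s => u f; rewrite /ap /= comp1m. Qed.

Lemma asw_invol k u : aseq (asw k) (asw k) u = aid u.
Proof.
elim: k u => [|k IH] [|x u].
- by rewrite /aseq /= comp1m.
- case: u => [|y u]; rewrite /aseq /= ?comp1m //; congr (existT _ _ _).
  by have := mXK x (mob y) (M u C); rewrite /mX.
- by rewrite /aseq /= comp1m.
by have := IH u => /(congr1 (skipA x)); rewrite -aseq_skip => ->; rewrite /skipA /= tens_id.
Qed.

Lemma asw_far j k u : aseq (asw j) (asw (j.+2 + k)) u = aseq (asw (j.+2 + k)) (asw j) u.
Proof.
elim: j u => [|j IH] [|x u].
- by [].
- case: u => [|y u]; rewrite /aseq /asw /=.
    by rewrite !compm1 comp1m.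
  by rewrite X_nat.
- by [].
by have := IH u => /(congr1 (skipA x)); rewrite -!aseq_skip.
Qed.

(** The bound matters: on two strands [asw 1] is the identity and for [j = 0] the relation would say
    that [asw 0] is trivial. *)
Lemma asw_yb j u : (j.+2 < size u)%N ->
  aseq (asw j) (aseq (asw j.+1) (asw j)) u = aseq (asw j.+1) (aseq (asw j) (asw j.+1)) u.
Proof.
elim: j u => [|j IH] [|x u] //; last first.
  move=> /IH /(congr1 (skipA x)); rewrite -!aseq_skip /aseq /=.
  by rewrite !whisker.
case: u => [|y [|z u]] // _; rewrite /aseq /asw /=; congr (existT _ _ _).
by rewrite yang_baxter -!compA.
Qed.

Lemma acu_sw o k u : aseq (acu0 o) (asw k) u = aseq (asw k.+2) (acu0 o) u.
Proof. by rewrite /aseq /acu0 /asw /= mcup_nat. Qed.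

Lemma acu_slide o x u : aseq (asw 0) (aseq (asw 1) (acu0 o)) (x :: u) = acu 1 o (x :: u).
Proof. by rewrite /aseq /acu /asw /acu0 /= mcup_slide. Qed.

Lemma acu_acu o o' u :
  aseq (asw 1) (aseq (asw 2) (aseq (asw 0) (aseq (asw 1) (aseq (acu0 o) (acu0 o'))))) u =
  aseq (acu0 o') (acu0 o) u.
Proof.
rewrite /aseq /acu /asw /acu0 /=; congr (existT _ _ _).
rewrite (compA (mob (~~ o) ◁ _)) (compE _ (mcup_slide o _ _)).
by rewrite !compA -!whisker -compA mcup_slide -mcup_nat.
Qed.

Definition cappable u := if u is x :: y :: _ then y == ~~ x else false.

Lemma cappableP u : cappable u -> exists o v, u = o :: ~~ o :: v.
Proof. by case: u => [|x [|y v]] //= /eqP ->; exists x, v. Qed.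

Lemma aca0E o u : aca0 (o :: ~~ o :: u) = @Arrow (o :: ~~ o :: u) u (mcap o (M u C)).
Proof. by case: o. Qed.

Lemma aca_sw k u : cappable u -> aseq aca0 (asw k.+2) u = aseq (asw k) aca0 u.
Proof.
move=> /cappableP[o [v ->]]; rewrite /aseq aca0E /=.
by case: o; rewrite /= ?ev'_nat ?ev_nat.
Qed.

Lemma aca_slide x u : cappable u ->
  askip aca0 (x :: u) = aseq aca0 (aseq (asw 1) (asw 0)) (x :: u).
Proof.
move=> /cappableP[o [v ->]]; rewrite /askip aca0E /aseq /asw /=.
have := mcap_slide o (mob x) (M v C).
by case: o => /= ->.
Qed.

Lemma asw_acu o u : aseq asw0 (acu0 o) u = acu0 (~~ o) u.
Proof. by case: o; rewrite /aseq /acu0 /= ?X_coev' -?coev'_sym. Qed.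

(** After a crossing of their inner feet, a cap on two neighbouring arcs straightens them into
    one. *)
Lemma asnake o u :
  aseq aca0 (aseq (asw 1) (aseq (acu0 o) (acu0 (~~ o)))) u = acu0 (~~ o) u.
Proof.
case: o; rewrite /aseq /acu0 /asw /=; congr (existT _ _ _).
  have e : (A ◁ X true (dual A) (dual A) (A ⊗ M u C)) ∘ coev' A (dual A ⊗ (A ⊗ M u C)) =
     X true (dual A) A _ ∘ (dual A ◁ coev' A (A ⊗ M u C)).
    rewrite -(mcup_slide true (dual A)) [RHS]compA [X in _ = X ∘ _](_ : _ = idm _) ?comp1m //.
    exact: XK_A.
  by rewrite (compE _ e) -compA (compE _ (esym (ev'_sym _))) (compE _ (snakeV' _ _)) comp1m.
have e : (dual A ◁ X true A A (dual A ⊗ M u C)) ∘ coev A (A ⊗ (dual A ⊗ M u C)) =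
   X true A (dual A) _ ∘ (A ◁ coev A (dual A ⊗ M u C)).
  rewrite -(mcup_slide false A) [RHS]compA [X in _ = X ∘ _](_ : _ = idm _) ?comp1m //.
  exact: XVK_A.
by rewrite (compE _ e) -compA (compE _ (ev'_X _)) (compE _ (snake _ _)) comp1m.
Qed.

Variable r : R.
Hypothesis loopA : forall C, ev' A C ∘ coev A C = r *: idm C.

Lemma aca_acu o u : aseq aca0 (acu0 o) u = Arrow (r *: idm (M u C)).
Proof. by case: o; rewrite /aseq /acu0 /= ?ev_coev' loopA. Qed.

End States.
End Transparent.

(** * Lists of labels, on which operations act as on strands *)

Section Labels.
Local Open Scope nat_scope.
Variable I : eqType.
Implicit Type l : seq I.

Definition lskip (f : seq I -> seq I) l := if l is x :: l' then x :: f l' else [::].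
Definition lsw0 l := if l is x :: y :: l' then y :: x :: l' else l.
Definition lsw k := iter k lskip lsw0.
Definition lrem k := iter k lskip (fun l => if l is _ :: _ :: l' then l' else l).
Definition lcu k i := iter k lskip (fun l => i :: i :: l).

Lemma lsw_invol k l : lsw k (lsw k l) = l.
Proof. by elim: k l => [|k IH] [|x l] //=; [case: l | rewrite IH]. Qed.
Lemma lsw_far j k l : lsw j (lsw (j.+2 + k) l) = lsw (j.+2 + k) (lsw j l).
Proof.
elim: j l => [|j IH] [|x l] //; first by case: l.
by have := IH l => /(congr1 (cons x)).
Qed.
Lemma lsw_yb j l : j.+2 < size l -> lsw j (lsw j.+1 (lsw j l)) = lsw j.+1 (lsw j (lsw j.+1 l)).
Proof.
elim: j l => [|j IH] [|x l] //; first by case: l => [|y [|z l]].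
by move=> /IH /(congr1 (cons x)).
Qed.
Lemma perm_lsw k l : perm_eq (lsw k l) l.
Proof.
elim: k l => [|k IH] [|x l] //=; last by rewrite perm_cons.
by case: l => [|y l] //=; rewrite (perm_catCA [:: y] [:: x] l).
Qed.
Lemma size_lsw k l : size (lsw k l) = size l.
Proof. exact/perm_size/perm_lsw. Qed.
Lemma mem_lsw k l : lsw k l =i l.
Proof. exact/perm_mem/perm_lsw. Qed.
Lemma lsw_out k l : size l <= k.+1 -> lsw k l = l.
Proof.
elim: k l => [|k IH] [|x l] //=; first by case: l.
by rewrite ltnS => /IH ->.
Qed.

Lemma nth_lsw_lt (x0 : I) k l m : m < k -> nth x0 (lsw k l) m = nth x0 l m.
Proof. by elim: k l m => [|k IH] [|x l] [|m] //=; exact: IH. Qed.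
Lemma nth_lsw_gt (x0 : I) k l m : k.+1 < m -> nth x0 (lsw k l) m = nth x0 l m.
Proof. by elim: k l m => [|k IH] [|x l] [|m] //=; [case: l; case: m => [|[]] | exact: IH]. Qed.
Lemma nth_lsw (x0 : I) k l : k.+1 < size l -> nth x0 (lsw k l) k = nth x0 l k.+1.
Proof. by elim: k l => [|k IH] [|x l] //; [case: l | exact: IH]. Qed.
Lemma lrem_slide k l : k.+2 < size l -> lrem k (lsw k.+1 (lsw k l)) = lrem k.+1 l.
Proof.
elim: k l => [|k IH] [|x l] //; first by case: l => [|y [|z l]].
by move=> /IH /(congr1 (cons x)).
Qed.
Lemma lcu_slide k i l : k < size l -> lsw k (lsw k.+1 (lcu k i l)) = lcu k.+1 i l.
Proof.
elim: k l => [|k IH] [|x l] //.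
by move=> /IH /(congr1 (cons x)).
Qed.
Lemma map_lsw k (f : I -> I) l : map f (lsw k l) = lsw k (map f l).
Proof. by elim: k l => [|k IH] [|x l] //=; [case: l | rewrite IH]. Qed.

Definition rename (i j : I) := fun x => if x == j then i else x.
Lemma rename_id i j l : j \notin l -> map (rename i j) l = l.
Proof.
move=> jl; rewrite -[RHS]map_id; apply/eq_in_map => x xl.
by rewrite /rename; case: eqP => // e; rewrite -e xl in jl.
Qed.
End Labels.

(** * Normal form of the arcs formed by transparent strands *)

Section Good.
Variables (R : comNzRingType) (T : tortile_category R) (A : T).
Hypothesis tA : transparent A.
Hypothesis twistA : twist A = idm A.
Variable r : R.
Hypothesis loopA : forall C, ev' A C ∘ coev A C = r *: idm C.
Variables B C : T.
Local Notation state := (state A B C).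
Local Notation asw := (asw A C).
Local Notation acu0 := (@acu0 R T A C).
Local Notation aca0 := (@aca0 R T A C).
Local Notation aca := (@aca R T A C).
Local Open Scope nat_scope.

Implicit Types (s : state) (S : seq nat * state).
Variable s0 : state.
Hypothesis s00 : projT1 s0 = [::].

Definition psw k S := (lsw k S.1, ap (asw k) S.2).
Definition pcu i o S := (i :: i :: S.1, ap (acu0 o) S.2).
Definition wf S := size S.1 = size (projT1 S.2).

Lemma asw_lsw k (u : seq bool) : projT1 (asw k u) = lsw k u.
Proof. by elim: k u => [|k IH] [|x u] //=; [case: u | rewrite IH]. Qed.
Lemma asw_out k (u : seq bool) : size u <= k.+1 -> asw k u = aid A C u.
Proof.
elim: k u => [|k IH] [|x u] //=; first by case: u.
by rewrite ltnS => /IH; rewrite /asw /= => ->; rewrite /skipA /= tens_id.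
Qed.

Lemma psw_invol k S : psw k (psw k S) = S.
Proof. by case: S => l s; rewrite /psw /= lsw_invol ap_aseq (ap_eq (asw_invol tA _ _ _)) ap_id. Qed.
Lemma psw_far j k S : psw j (psw (j.+2 + k) S) = psw (j.+2 + k) (psw j S).
Proof. by case: S => l s; rewrite /psw /= lsw_far !ap_aseq (ap_eq (asw_far _ _ _ _ _)). Qed.
Lemma psw_yb j S : wf S -> j.+2 < size S.1 ->
  psw j (psw j.+1 (psw j S)) = psw j.+1 (psw j (psw j.+1 S)).
Proof.
case: S => l s; rewrite /wf /psw /= => ws jl; rewrite lsw_yb //.
have ju : j.+2 < size (projT1 s) by rewrite -ws.
by have := ap_eq (asw_yb A C ju); rewrite -!ap_aseq => ->.
Qed.
Lemma psw_out k S : wf S -> size S.1 <= k.+1 -> psw k S = S.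
Proof.
case: S => l s; rewrite /wf /psw /= => ws lk; rewrite lsw_out //.
by rewrite (ap_eq (b := @aid R T A C)) ?ap_id // asw_out // -ws.
Qed.
Lemma pcu_psw i o k S : pcu i o (psw k S) = psw k.+2 (pcu i o S).
Proof. by case: S => l s; rewrite /psw /pcu /= !ap_aseq (ap_eq (acu_sw _ _ _ _ _)). Qed.
Lemma pcu_pcu i o i' o' S :
  psw 1 (psw 2 (psw 0 (psw 1 (pcu i o (pcu i' o' S))))) = pcu i' o' (pcu i o S).
Proof.
case: S => l s; rewrite /psw /pcu /=.
by have := ap_eq (acu_acu A C o o' (projT1 s)); rewrite -!ap_aseq => ->.
Qed.
Lemma psw_pcu i o S : psw 0 (pcu i o S) = pcu i (~~ o) S.
Proof. by case: S => l s; rewrite /psw /pcu /= !ap_aseq (ap_eq (asw_acu tA twistA _ _ _)). Qed.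

Lemma wf_psw k S : wf S -> wf (psw k S).
Proof. by rewrite /wf /= asw_lsw !size_lsw. Qed.
Lemma wf_pcu i o S : wf S -> wf (pcu i o S).
Proof. by rewrite /wf /= => ->. Qed.

(* Marked strands carry the same label when they are joined below the current
   level; a good state consists of pairs of marked strands, each created by a cup
   in front of everything and then permuted, with no knotting left to record. *)
Inductive good : seq nat * state -> Prop :=
| good_nil : good ([::], s0)
| good_cu i o S : good S -> i \notin S.1 -> good (pcu i o S)
| good_sw k S : good S -> good (psw k S).

Lemma good_wf S : good S -> wf S.
Proof.
elim=> [|i o {}S _ wS _|k {}S _ wS]; first by rewrite /wf s00.
- exact: wf_pcu.
- exact: wf_psw.
Qed.

Lemma good_base S : good S -> S.1 = [::] -> S.2 = s0.
Proof.
elim=> [//|i o {}S _ _ _ //|k {}S gS IH] /= l0.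
have S0 : S.1 = [::] by apply/nilP; rewrite /nilp -(size_lsw k) l0.
have := psw_out (k := k) (good_wf gS); rewrite S0 /= => /(_ isT) /(congr1 snd) /= ->.
exact: IH.
Qed.

(** The strand in place [j] travels to place [j + p] by adjacent swaps. *)
Fixpoint mv j p S := if p is p'.+1 then mv j.+1 p' (psw j S) else S.

Lemma mv_far j d p S : psw j (mv (j.+2 + d) p S) = mv (j.+2 + d) p (psw j S).
Proof. by elim: p d S => [//|p IH] d S /=; rewrite -psw_far -addnS IH. Qed.

Lemma mv_pcu i o j p S : pcu i o (mv j p S) = mv j.+2 p (pcu i o S).
Proof. by elim: p j S => [//|p IH] j S /=; rewrite IH pcu_psw. Qed.

Lemma wf_mv j p S : wf S -> wf (mv j p S).
Proof. by elim: p j S => [//|p IH] j S /= wS; apply/IH/wf_psw. Qed.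
Lemma perm_mv j p S : perm_eq (mv j p S).1 S.1.
Proof. by elim: p j S => [//|p IH] j S /=; exact: (perm_trans (IH j.+1 (psw j S)) (perm_lsw j S.1)). Qed.
(** The moves are coset representatives of the permutations that fix place [j]. A further swap
    either changes the representative or emerges before the move as a swap beyond [j]. *)
Lemma psw_mv k j p n : j <= k -> k.+1 < n -> j + p < n ->
  exists2 p', j + p' < n &
    (exists2 k', j < k' & forall S, wf S -> size S.1 = n -> psw k (mv j p S) = mv j p' (psw k' S))
    \/ (forall S, wf S -> size S.1 = n -> psw k (mv j p S) = mv j p' S).
Proof.
elim: p j => [|p IH] j jk kn jpn.
  have [ejk|njk] := eqVneq j k.
    by exists 1; [lia | right=> S _ _; rewrite -ejk].
  by exists 0; [lia | left; exists k; first by lia].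
have [ejk|njk] := eqVneq j k.
  case: p jpn {IH} => [|p] jpn.
    by exists 0; [lia | right=> S _ _; rewrite -ejk /= psw_invol].
  exists p.+2; first by lia.
  (* The braid relation carries the swap through the move, shifted by one place. *)
  left; exists j.+1 => // S wS nS; rewrite -ejk /= -[j.+2]addn0 mv_far addn0.
  by rewrite psw_yb // nS; lia.
have [p' p'n [[k' jk' H]|H]] := IH j.+1 ltac:(lia) kn ltac:(lia).
  exists p'.+1; first by lia.
  left; exists k'; first by lia.
  move=> S wS nS /=; rewrite H ?size_lsw //; last exact: wf_psw.
  have -> : k' = j.+2 + (k' - j.+2) by lia.
  by rewrite /= (psw_far j).
exists p'.+1; first by lia.
by right=> S wS nS /=; rewrite H ?size_lsw //; exact: wf_psw.
Qed.

(* Any pair can be assumed to have been created last. *)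
Lemma good_pull S i : good S -> i \in S.1 -> exists p q o t,
  [/\ good t, i \notin t.1, p < size S.1, q.+1 < size S.1 &
      S = mv 0 p (mv 1 q (pcu i o t))].
Proof.
elim=> [//|j o {}S gS IH jS|k {}S gS IH].
  rewrite !inE orbA orbb; have [->|ij] := eqVneq i j.
    by move=> _; exists 0, 0, o, S.
  move=> /IH[p [q [o' [t [gt it pS qS e]]]]].
  have jt : j \notin t.1.
    apply: contra jS => jt; rewrite e (perm_mem (perm_mv _ _ _)) (perm_mem (perm_mv _ _ _)).
    by rewrite !inE jt !orbT.
  (* Both feet of the older arc also have to pass the two feet of the new one. *)
  exists p.+2, q.+2, o', (pcu j o t); split.
  - exact: good_cu.
  - by rewrite !inE (negPf ij) (negPf it).
  - by rewrite /= !ltnS.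
  - by rewrite /= !ltnS.
  by rewrite {1}e !mv_pcu /= (mv_far 0 1) (mv_far 1 0) (psw_far 0 0) pcu_pcu.
rewrite mem_lsw => /IH[p [q [o [t [gt it pS qS e]]]]].
have wS := good_wf gS.
have [kS|kS] := leqP (size S.1) k.+1.
  by exists p, q, o, t; split; rewrite ?size_lsw // psw_out.
have wt := good_wf gt.
have nS : size (mv 1 q (pcu i o t)).1 = size S.1.
  by rewrite e (perm_size (perm_mv 0 p _)).
have nt : size (pcu i o t).1 = size S.1 by rewrite -nS (perm_size (perm_mv 1 q _)).
have [p' p'n [[k' k'0 H]|H]] := @psw_mv k 0 p (size S.1) isT kS pS; last first.
  exists p', q, o, t; rewrite size_lsw; split => //.
  by rewrite {1}e H //; apply/wf_mv/wf_pcu.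
have [kS'|kS'] := leqP (size S.1) k'.+1.
  exists p', q, o, t; rewrite size_lsw; split => //.
  rewrite {1}e H ?psw_out ?nS //; first exact/wf_mv/wf_pcu.
  exact/wf_mv/wf_pcu.
have [q' q'n [[k'' k''0 H']|H']] := @psw_mv k' 1 q (size S.1) k'0 kS' qS.
  exists p', q', o, (psw k''.-2 t); rewrite size_lsw; split => //.
  - exact: good_sw.
  - by rewrite mem_lsw.
  rewrite {1}e H // ?H' //; [|exact: wf_pcu|exact/wf_mv/wf_pcu].
  have -> : k'' = k''.-2.+2 by lia.
  by rewrite pcu_psw.
exists p', q', o, t; rewrite size_lsw; split => //.
by rewrite {1}e H // ?H' //; [exact: wf_pcu|exact/wf_mv/wf_pcu].
Qed.

Lemma good_count S i : good S -> i \in S.1 -> count_mem i S.1 = 2.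
Proof.
move=> gS /(good_pull gS)[p [q [o [t [gt it _ _ ->]]]]].
rewrite (permP (perm_mv _ _ _)) (permP (perm_mv _ _ _)) /= eqxx.
by rewrite (count_memPn it).
Qed.

Lemma nth_mv j p S m : m < j -> nth 0 (mv j p S).1 m = nth 0 S.1 m.
Proof.
elim: p j S => [//|p IH] j S mj /=.
by rewrite IH ?nth_lsw_lt //; apply: ltnW.
Qed.

(** With the arc [i] created last, its feet can end in the first two places only by staying there or
    by crossing each other. In the latter case the curl is absorbed, the twist being trivial. *)
Lemma good_cup_inv S i l : good S -> S.1 = i :: i :: l ->
  exists o t, [/\ good t, i \notin t.1, t.1 = l & S = pcu i o t].
Proof.
move=> gS Sl; have iS : i \in S.1 by rewrite Sl inE eqxx.
have [p [q [o [t [gt it pS qS e]]]]] := good_pull gS iS.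
have H q' : S = mv 0 q' (pcu i o t) -> q' < size S.1 -> q' < 2.
  case: q' => [//|[//|q']] e' q'S.
  move: e'; rewrite /= => /(congr1 (fun S => nth 0 S.1 1)).
  rewrite nth_mv // Sl /=; case tt: t.1 it => [|x l'].
    by move: q'S; rewrite e (perm_size (perm_mv _ _ _)) (perm_size (perm_mv _ _ _)) /= tt.
  by rewrite inE negb_or => /andP[/eqP].
case: q => [|q] in e qS *.
  have := H _ e pS; case: p e {pS} => [|[|//]] /= e _.
    exists o, t; split=> //; by move: Sl; rewrite e => -[].
  rewrite psw_pcu in e; exists (~~ o), t; split=> //; by move: Sl; rewrite e => -[].
case tt: t.1 it => [|x l'].
  by move: qS; rewrite e (perm_size (perm_mv _ _ _)) (perm_size (perm_mv _ _ _)) /= tt.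
rewrite inE negb_or => /andP[/eqP ix _]; case: ix; case: p e {pS H} => [|p] e.
  have := congr1 (fun S => nth 0 S.1 1) e; rewrite /= nth_mv // Sl /= tt //.
have := congr1 (fun S => nth 0 S.1 0) e; rewrite /= nth_mv // Sl /= => ->.
set X := mv 2 _ _; have : nth 0 X.1 1 = x by rewrite /X nth_mv //= tt.
have : 1 < size X.1 by rewrite (perm_size (perm_mv _ _ _)) /= tt.
by case: X.1 => [|? []].
Qed.

Lemma good_cap_eq S i l : good S -> S.1 = i :: i :: l ->
  exists t, [/\ good t, t.1 = l, i \notin t.1 & ap aca0 S.2 = scale r t.2].
Proof.
move=> gS /(good_cup_inv gS)[o [t [gt it tl ->]]]; exists t; split=> //=.
by rewrite ap_aseq /ap (aca_acu twistA C loopA) /scale /= compZl comp1m.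
Qed.

(** For a property unaffected by swaps from place [d] on, the strand labelled [i] may be assumed to
    stand in place [d]. *)
Lemma good_bring d m S (Q : seq nat * state -> Prop) i :
  (forall k S, d <= k -> good S -> Q (psw k S) -> Q S) ->
  good S -> d + m < size S.1 -> nth 0 S.1 (d + m) = i ->
  (forall S', good S' -> perm_eq S'.1 S.1 -> (forall p, p < d -> nth 0 S'.1 p = nth 0 S.1 p) ->
    nth 0 S'.1 d = i -> Q S') -> Q S.
Proof.
move=> HQ; elim: m S => [|m IH] S gS dmS Si Q0.
  by apply: Q0 => //; rewrite -[d]addn0.
apply: (HQ (d + m) S _ gS); first exact: leq_addr.
have dS : d + m < size (psw (d + m) S).1 by rewrite /= size_lsw (ltn_trans _ dmS) // addnS.
apply: (IH _ (good_sw (d + m) gS) dS).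
- by rewrite /= nth_lsw -addnS.
move=> S' gS' pS' S'd S'i; apply: Q0 => //; first exact: perm_trans pS' (perm_lsw _ _).
by move=> p pd; rewrite S'd //= nth_lsw_lt //; lia.
Qed.

(* The other ends of i and j are brought to the third and fourth place, where the
   cap straightens the two arcs into one by a snake identity. *)
Lemma good_cap_neq S i j l : good S -> S.1 = i :: j :: l -> i != j ->
  cappable (projT1 S.2) -> good (map (rename i j) l, ap aca0 S.2).
Proof.
move=> gS Sl ij cS.
pose Q S := forall l, S.1 = i :: j :: l -> cappable (projT1 S.2) -> good (map (rename i j) l, ap aca0 S.2).
suff : Q S by apply.
(* A swap beyond the first two strands can be postponed until after the cap, where its index drops
   by two. *)
have HQ k S' : 1 < k -> good S' -> Q (psw k S') -> Q S'.
  case: k => [//|[//|k]] _ gS' QS l' S'l cS'.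
  have := QS (lsw k l'); rewrite /= S'l /= => /(_ erefl).
  have -> : cappable (projT1 (asw k.+2 (projT1 S'.2))) by case: (S') cS' => ? [[|? [|? ?]] ?].
  move=> /(_ isT) /(good_sw k).
  rewrite ap_aseq (ap_eq (aca_sw A C k cS')) -ap_aseq map_lsw.
  by rewrite -[(lsw k _, _)]/(psw k (_, _)) psw_invol.
have iS : i \in S.1 by rewrite Sl inE eqxx.
have jS : j \in S.1 by rewrite Sl !inE eqxx orbT.
have il : i \in l.
  rewrite -has_pred1 has_count; have := good_count gS iS.
  by rewrite Sl /= eqxx eq_sym (negPf ij) /= => H; lia.
apply: (good_bring (d := 2) (m := index i l) (i := i)) => //.
- by rewrite Sl /= !ltnS index_mem.
- by rewrite Sl /= nth_index.
move=> S' gS' pS' S'd S'i.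
have [l' S'l] : exists l', S'.1 = i :: j :: i :: l'.
  have := S'd 0 isT; have := S'd 1 isT; rewrite Sl /=.
  have : size S'.1 = size S.1 := perm_size pS'.
  rewrite Sl; case: (S'.1) S'i => [|a [|b [|c l']]] //=; first by case: (l) il.
  by move=> -> _ -> ->; exists l'.
have {}jS : j \in S'.1 by rewrite (perm_mem pS').
have jl : j \in l'.
  rewrite -has_pred1 has_count; have := good_count gS' jS.
  by rewrite S'l /= eqxx !(negPf ij) /= => H; lia.
have HQ3 k S'' : 2 < k -> good S'' -> Q (psw k S'') -> Q S'' by move/ltnW; exact: HQ.
apply: (good_bring (d := 3) (m := index j l') (i := j)) => //.
- by rewrite S'l /= !ltnS index_mem.
- by rewrite S'l /= nth_index.
move=> U gU pU Ud Uj l'' Ul cU.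
have [l3 e3] : exists l3, l'' = i :: j :: l3.
  have := Ud 2 isT; have := perm_size pU; rewrite S'l Ul /=.
  move: Uj; rewrite Ul; case: l'' {Ul} => [|a [|b l3]] //=.
    by move=> _ []; case: (l') jl.
  by move=> -> _ ->; exists l3.
rewrite {}e3 in Ul *.
have [o1 [t [gt it tl e1]]] := good_cup_inv (good_sw 1 gU) (l := j :: j :: l3) (i := i)
  ltac:(by rewrite /= Ul).
have [o2 [t2 [gt2 jt2 t2l e2]]] := good_cup_inv gt tl.
have eU : U = psw 1 (pcu i o1 (pcu j o2 t2)) by rewrite -e2 -e1 psw_invol.
(* The cap requires opposite orientations, which is the case covered by [asnake]. *)
have o21 : o2 = ~~ o1 by move: cU; rewrite eU /= => /eqP /(congr1 negb); rewrite !negbK.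
have -> : ap aca0 U.2 = ap (acu0 (~~ o1)) t2.2.
  rewrite eU o21 /=; have := ap_eq (asnake tA twistA C o1 (projT1 t2.2)).
  by rewrite -!ap_aseq.
have -> : map (rename i j) [:: i, j & l3] = i :: i :: t2.1.
  by rewrite /= /rename (negPf ij) eqxx -/(rename i j) -t2l rename_id.
by apply: good_cu => //; move: it; rewrite e2 /= !inE !negb_or => /and3P[].
Qed.

Definition capat k (u : seq bool) := (k.+1 < size u) && (nth false u k.+1 == ~~ nth false u k).

Lemma aca_slides k (u : seq bool) : capat k.+1 u ->
  aca k.+1 u = aseq (aca k) (aseq (asw k.+1) (asw k)) u.
Proof.
elim: k u => [|k IH] [|x u] // ku; first last.
  by have := IH u ku => /(congr1 (@skipA _ _ A C x _)); rewrite /aseq /skipA /= !whisker.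
by apply: (aca_slide A C x); case: u ku => [|? []] // *; rewrite /capat /= in ku *; case/andP: ku.
Qed.

Lemma acu_slides k o (u : seq bool) : k < size u ->
  acu A C k.+1 o u = aseq (asw k) (aseq (asw k.+1) (acu A C k o)) u.
Proof.
elim: k u => [|k IH] [|x u] // ku; first exact/esym/acu_slide.
by have := IH u ku => /(congr1 (@skipA _ _ A C x _)); rewrite /aseq /skipA /= !whisker.
Qed.

Lemma good_cup k i o S : good S -> i \notin S.1 -> k <= size S.1 ->
  good (lcu k i S.1, ap (acu A C k o) S.2).
Proof.
move=> gS iS; elim: k => [|k IH] kS; first exact: good_cu.
have ku : k < size (projT1 S.2) by rewrite -(good_wf gS).
rewrite -(lcu_slide i kS) (ap_eq (acu_slides o ku)) -!ap_aseq.
exact: (good_sw k (good_sw k.+1 (IH (ltnW kS)))).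
Qed.

(** A cap in place [k + 1] becomes one in place [k] when the preceding strand is pulled across it;
    this is the induction step for caps in any position. *)
Lemma psw2_capat k S : good S -> capat k.+1 (projT1 S.2) ->
  [/\ capat k (projT1 (psw k.+1 (psw k S)).2),
      nth 0 (psw k.+1 (psw k S)).1 k = nth 0 S.1 k.+1,
      nth 0 (psw k.+1 (psw k S)).1 k.+1 = nth 0 S.1 k.+2 &
      ap (aca k.+1) S.2 = ap (aca k) (psw k.+1 (psw k S)).2].
Proof.
move=> gS cS; have /andP[kS /eqP cS'] := cS.
have kS1 : k.+2 < size S.1 by rewrite (good_wf gS).
split; last by rewrite (ap_eq (aca_slides cS)) -!ap_aseq.
- rewrite /capat [projT1 _](_ : _ = lsw k.+1 (lsw k (projT1 S.2))) ?size_lsw; last first.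
    by rewrite -!asw_lsw.
  rewrite (ltnW kS) nth_lsw ?size_lsw //.
  by rewrite nth_lsw_gt // nth_lsw_lt // nth_lsw ?cS' ?eqxx // ltnW.
- by rewrite -[(psw _ (psw k S)).1]/(lsw k.+1 (lsw k S.1)) nth_lsw_lt // nth_lsw // ltnW.
by rewrite -[(psw _ (psw k S)).1]/(lsw k.+1 (lsw k S.1)) nth_lsw ?size_lsw // nth_lsw_gt.
Qed.

Lemma good_cap_neq_at k S (i := nth 0 S.1 k) (j := nth 0 S.1 k.+1) :
  good S -> capat k (projT1 S.2) -> i != j ->
  good (lrem k (map (rename i j) S.1), ap (aca k) S.2).
Proof.
elim: k S @i @j => [|k IH] S i j gS cS ij.
  have := cS; rewrite /capat -(good_wf gS); case Sl: S.1 => [|i' [|j' l]] //= _.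
  move: ij; rewrite /i /j Sl /= => ij; apply: good_cap_neq gS Sl ij _.
  by move: cS; rewrite /capat; case: (projT1 S.2) => [|? [|? ?]].
have [cS' ei ej ->] := psw2_capat gS cS.
have := IH _ (good_sw k.+1 (good_sw k gS)) cS'; rewrite ei ej => /(_ ij).
rewrite -[(psw _ (psw k S)).1]/(lsw k.+1 (lsw k S.1)) !map_lsw lrem_slide // size_map (good_wf gS).
by case/andP: cS.
Qed.

Lemma good_cap_eq_at k S (i := nth 0 S.1 k) :
  good S -> capat k (projT1 S.2) -> i = nth 0 S.1 k.+1 ->
  exists t, [/\ good t, t.1 = lrem k S.1, i \notin t.1 & ap (aca k) S.2 = scale r t.2].
Proof.
elim: k S @i => [|k IH] S i gS cS ij.
  have := cS; rewrite /capat -(good_wf gS); case Sl: S.1 => [|i' [|j' l]] //= _.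
  by move: ij; rewrite /i Sl /= => ij; apply: good_cap_eq; rewrite // Sl ij.
have [cS' ei ej ->] := psw2_capat gS cS.
have := IH _ (good_sw k.+1 (good_sw k gS)) cS'; rewrite ei ej => /(_ ij).
by rewrite -[(psw _ (psw k S)).1]/(lsw k.+1 (lsw k S.1)) lrem_slide // (good_wf gS); case/andP: cS.
Qed.
End Good.

(** * Separating the marked strands from the others *)

Section Separation.
Variables (R : comNzRingType) (T : tortile_category R) (A : T).
Hypothesis tA : transparent A.
Local Notation mob := (mob A).
Local Notation M := (M A).
Local Notation lab := (odflt A).

Fixpoint marks (w : word (option T)) : seq bool :=
  match w with
  | [::] => [::]
  | (Some _, _) :: w => marks w
  | (None, o) :: w => o :: marks w
  end.

(** What a slice does to the marked strands alone: crossings with unmarked strands are dropped, and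
    the signs of the remaining ones forgotten. *)
Fixpoint macts w w' (s : step w w') C : hom (M (marks w) C) (M (marks w') C) :=
  match s in step w w' return hom (M (marks w) C) (M (marks w') C) with
  | cross _ (oA, a) (oB, b) w =>
      match oA, oB return hom (M (marks ((oA, a) :: (oB, b) :: w)) C)
                              (M (marks ((oB, b) :: (oA, a) :: w)) C) with
      | None, None => X true (mob a) (mob b) (M (marks w) C)
      | _, _ => idm _
      end
  | cup (oA, a) w =>
      match oA return hom (M (marks w) C) (M (marks (flip (oA, a) :: (oA, a) :: w)) C) with
      | Some _ => idm _
      | None => mcup A a (M (marks w) C)
      end
  | cap (oA, a) w =>
      match oA return hom (M (marks ((oA, a) :: flip (oA, a) :: w)) C) (M (marks w) C) with
      | Some _ => idm _
      | None => mcap A a (M (marks w) C)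
      end
  | skip (oA, a) w w' s =>
      match oA return hom (M (marks ((oA, a) :: w)) C) (M (marks ((oA, a) :: w')) C) with
      | Some _ => macts s C
      | None => mob a ◁ macts s C
      end
  end.

Fixpoint mactD w w' (D : diagram w w') C : hom (M (marks w) C) (M (marks w') C) :=
  match D in diagram w w' return hom (M (marks w) C) (M (marks w') C) with
  | dnil _ => idm _
  | dcons _ _ _ s D' => mactD D' C ∘ macts s C
  end.

Fixpoint Mmap u C C' (g : hom C C') : hom (M u C) (M u C') :=
  if u is o :: u' return hom (M u C) (M u C') then mob o ◁ Mmap u' g else g.

(* The strand P passes through the marked strands. *)
Fixpoint thr P u C : hom (P ⊗ M u C) (M u (P ⊗ C)) :=
  if u is o :: u' return hom (P ⊗ M u C) (M u (P ⊗ C))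
  then (mob o ◁ thr P u' C) ∘ X true P (mob o) (M u' C) else idm _.

Local Notation ewob w := (wob (fun B : T => B) (erase w)).
Local Notation str := (strand lab).

(* Pulls all marked strands in front of the unmarked ones; this commutes with
   diagrams because the marked strands are transparent. *)
Fixpoint sep w : hom (wob lab w) (M (marks w) (ewob w)) :=
  match w return hom (wob lab w) (M (marks w) (ewob w)) with
  | [::] => idm _
  | (Some B, b) :: w =>
      thr (str (Some B, b)) (marks w) (ewob w) ∘ (str (Some B, b) ◁ sep w)
  | (None, o) :: w => mob o ◁ sep w
  end.

Lemma Mmap_comp u C C' C'' (g : hom C' C'') (f : hom C C') :
  Mmap u (g ∘ f) = Mmap u g ∘ Mmap u f.
Proof. by elim: u => //= o u ->; rewrite whisker. Qed.
Lemma Mmap_id u C : Mmap u (idm C) = idm _.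
Proof. by elim: u => //= o u ->; rewrite tens_id. Qed.

Lemma thr_nat P u C C' (g : hom C C') :
  thr P u C' ∘ (P ◁ Mmap u g) = Mmap u (P ◁ g) ∘ thr P u C.
Proof.
elim: u => [|o u IH] /=; first by rewrite comp1m compm1.
by rewrite -compA X_nat !compA -!whisker IH.
Qed.

Lemma macts_nat w w' (s : step w w') C C' (g : hom C C') :
  macts s C' ∘ Mmap (marks w) g = Mmap (marks w') g ∘ macts s C.
Proof.
elim: s => [s [oA a] [oB b] v|[oA a] v|[oA a] v|[oA a] v v' s IH] /=.
- by case: oA oB => [A'|] [B'|] /=; rewrite ?comp1m ?compm1 ?X_nat.
- by case: oA => [A'|] /=; rewrite ?comp1m ?compm1 ?mcup_nat.
- by case: oA => [A'|] /=; rewrite ?comp1m ?compm1 ?mcap_nat.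
by case: oA => [A'|] //=; rewrite -!whisker IH.
Qed.

Lemma mcup_slidel P o C :
  (mob (~~ o) ◁ X true P (mob o) C) ∘ (X true P (mob (~~ o)) _ ∘ (P ◁ mcup A o C)) =
  mcup A o (P ⊗ C).
Proof. by case: o; [exact: (slide0 true P (coform_dual A)) | exact: (slide0 true P (coform A))]. Qed.

Lemma thr_macts P w w' (s : step w w') C :
  thr P (marks w') C ∘ (P ◁ macts s C) = macts s (P ⊗ C) ∘ thr P (marks w) C.
Proof.
elim: s => [s [oA a] [oB b] v|[oA a] v|[oA a] v|[oA a] v v' s IH] /=.
- case: oA oB => [A'|] [B'|] /=; rewrite ?tens_id ?comp1m ?compm1 //.
  rewrite !whisker -!compA; set Y := thr P (marks v) C.
  rewrite (compA (mob b ◁ X _ _ _ _)) -yang_baxter.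
  by rewrite (compE _ (esym (X_nat _ _ _ _))) -!compA.
- case: oA => [A'|] /=; rewrite ?tens_id ?comp1m ?compm1 // !whisker -!compA.
  by rewrite mcup_nat mcup_slidel.
- case: oA => [A'|] /=; rewrite ?tens_id ?comp1m ?compm1 // !whisker -!compA.
  rewrite -(mcap_slide A a P (M (marks v) C)).
  by rewrite (compEE _ (esym (mcap_nat _ _ _))).
case: oA => [A'|] //=.
by rewrite -!compA X_nat !compA -!whisker IH.
Qed.

Lemma thr_lift P Q P' Q' (f : hom (P ⊗ Q) (P' ⊗ Q')) u C :
  thr P' u (Q' ⊗ C) ∘ ((P' ◁ thr Q' u C) ∘ lift f (M u C)) =
  Mmap u (lift f C) ∘ (thr P u (Q ⊗ C) ∘ (P ◁ thr Q u C)).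
Proof.
elim: u => [|o u IH] /=; first by rewrite !tens_id !comp1m !compm1.
rewrite !whisker -!compA (compEE _ (X_nat _ _ _ _)) rslide.
by rewrite (compEE _ (X_nat _ _ _ _)) !compA -!whisker -!compA IH !compA.
Qed.

Lemma thr_lift0 P Q (e : hom one (P ⊗ Q)) u C :
  thr P u (Q ⊗ C) ∘ ((P ◁ thr Q u C) ∘ lift0 e (M u C)) = Mmap u (lift0 e C).
Proof.
elim: u => [|o u IH] /=; first by rewrite !tens_id !comp1m.
rewrite !whisker -!compA (compEE _ (X_nat _ _ _ _)) rslide0.
by rewrite -!whisker IH.
Qed.

Lemma thr_lift2 P Q (e : hom (P ⊗ Q) one) u C :
  Mmap u (lift2 e C) ∘ (thr P u (Q ⊗ C) ∘ (P ◁ thr Q u C)) = lift2 e (M u C).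
Proof.
elim: u => [|o u IH] /=; first by rewrite !tens_id !compm1.
rewrite !whisker -!compA (compEE _ (X_nat _ _ _ _)) -[RHS](rslide2 true (mob o) e).
by rewrite (compA (mob o ◁ thr _ _ _)) !compA -!whisker -!compA IH !compA.
Qed.

Lemma Xmob s P o C : X s P (mob o) C = X true P (mob o) C.
Proof. by case: s; rewrite // (transparent_X _ _ _ (mob_transparent tA o)). Qed.
Lemma Xmobl s P o C : X s (mob o) P C = X true (mob o) P C.
Proof. by case: s; rewrite // (transparent_Xl _ _ _ (mob_transparent tA o)). Qed.

Local Notation ev_id := (eval (fun B : T => B)).

Lemma sep_step w w' (s : step w w') :
  sep w' ∘ eval_step lab s =
  macts s (ewob w') ∘ (Mmap (marks w) (ev_id (erase_step s)) ∘ sep w).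
Proof.
elim: s => [s [oA a] [oB b] v|[oA a] v|[oA a] v|[oA a] v v' s IH] /=.
- rewrite -liftE -/(X _ _ _ _); case: oA oB => [A'|] [B'|] /=; rewrite ?comp1m.
  + rewrite -[in RHS]liftE !whisker -!compA -X_nat /X.
    have := thr_lift (crossm s (str (Some A', a)) (str (Some B', b))) (marks v) (ewob v).
    by move=> /(congr1 (fun h => h ∘ (_ ◁ _ ◁ sep v))); rewrite -!compA => ->.
  + rewrite Mmap_id Xmob ?tens_id ?comp1m !whisker -!compA; congr (_ ∘ _).
    by rewrite -X_nat.
  + rewrite Mmap_id Xmobl ?tens_id ?comp1m !whisker -!compA (compEE _ (X_nat _ _ _ _)).
    (* Here the pulling reverses the crossing of the slice, and the resulting double braiding
       vanishes by transparency. *)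
    by rewrite -dbl_def (mob_transparent tA) compm1.
  + by rewrite Mmap_id Xmob ?tens_id ?comp1m -X_nat.
- rewrite -lift0E; case: oA => [A'|] /=; rewrite ?comp1m.
  + rewrite -lift0E -(thr_lift0 _ (marks v)) whisker -!compA.
    by rewrite -lift0_nat.
  + rewrite Mmap_id ?tens_id ?comp1m mcup_nat; by case: a.
- rewrite -lift2E; case: oA => [A'|] /=; rewrite ?comp1m.
  + rewrite -[in RHS]lift2E !whisker -lift2_nat.
    by rewrite -(thr_lift2 (capm lab (Some A', a)) (marks v)) -!compA.
  + rewrite Mmap_id ?tens_id ?comp1m mcap_nat; by case: a.
case: oA => [A'|] /=; last by rewrite -!whisker IH.
rewrite eval_dskip -!compA -whisker IH !whisker (compEE _ (thr_macts _ _ _)).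
by rewrite (compEE _ (thr_nat _ _ _)).
Qed.

Lemma sep_diagram w w' (D : diagram w w') :
  sep w' ∘ eval lab D =
  mactD D (ewob w') ∘ (Mmap (marks w) (ev_id (erase_diagram D)) ∘ sep w).
Proof.
elim: D => [v|v v' v'' s D IH] /=; first by rewrite Mmap_id !comp1m compm1.
rewrite compA IH -!compA sep_step eval_dcat Mmap_comp -!compA.
by rewrite (compEE _ (esym (macts_nat s _))).
Qed.

Fixpoint thrV P u C : hom (M u (P ⊗ C)) (P ⊗ M u C) :=
  if u is o :: u' return hom (M u (P ⊗ C)) (P ⊗ M u C)
  then X false (mob o) P (M u' C) ∘ (mob o ◁ thrV P u' C) else idm _.

Lemma thrK P u C : thrV P u C ∘ thr P u C = idm _.
Proof.
elim: u => /= [|o u IH]; first by rewrite comp1m.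
rewrite -!compA (compA (mob o ◁ _)) -whisker IH tens_id comp1m.
exact: (XK true).
Qed.

Lemma sep_injl w B (f g : hom B (wob lab w)) : sep w ∘ f = sep w ∘ g -> f = g.
Proof.
suff [h hK] : exists h, h ∘ sep w = idm _ by exact: comp_injl hK.
elim: w {f g} => [|[[A'|] o] w [h hK]] /=; first by exists (idm _); rewrite comp1m.
  exists ((str (Some A', o) ◁ h) ∘ thrV (str (Some A', o)) (marks w) (ewob w)).
  by rewrite -!compA (compE _ (thrK _ _ _)) comp1m -whisker hK tens_id.
by exists (mob o ◁ h); rewrite -whisker hK tens_id.
Qed.

(** [sep] has a left inverse, and after it the value depends only on the action on marked strands
    and on the erased diagram. *)
Lemma eval_erase s t (D D' : diagram s t) :
  (forall C, mactD D C = mactD D' C) -> erase_diagram D = erase_diagram D' ->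
  eval lab D = eval lab D'.
Proof. by move=> DD' e; apply: sep_injl; rewrite !sep_diagram DD' e. Qed.
End Separation.

(** * Following one marked component through a diagram *)

Section Component.
Variables (R : comNzRingType) (T : tortile_category R) (A : T).
Local Open Scope nat_scope.
Local Notation word := (word (option T)).

Inductive mop := Nop | Sw of nat | Cu of nat & bool | Ca of nat.
Definition mskip m :=
  match m with Nop => Nop | Sw k => Sw k.+1 | Cu k o => Cu k.+1 o | Ca k => Ca k.+1 end.
Definition mop_aop C m : aop A C :=
  match m with Nop => aid A C | Sw k => asw A C k | Cu k o => acu A C k o | Ca k => aca A C k end.

Fixpoint sop (w w' : word) (s : step w w') : mop :=
  match s with
  | cross _ (oA, a) (oB, b) w => if oA is None then if oB is None then Sw 0 else Nop else Nop
  | cup (oA, a) w => if oA is None then Cu 0 a else Nop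
  | cap (oA, a) w => if oA is None then Ca 0 else Nop
  | skip (oA, a) w w' s => if oA is None then mskip (sop s) else sop s
  end.

Lemma mop_aop_skip C m o u : mop_aop C (mskip m) (o :: u) = skipA o (mop_aop C m u).
Proof. by case: m => //=; rewrite /skipA /= tens_id. Qed.

Lemma sopE w w' (s : step w w') C : mop_aop C (sop s) (marks w) = Arrow (macts A s C).
Proof.
elim: s => [s [[A'|] a] [[B'|] b] v|[[A'|] a] v|[[A'|] a] v|[[A'|] a] v v' s IH] //=.
  by case: a.
by rewrite mop_aop_skip IH.
Qed.

Lemma sop_capat w w' (s : step w w') k : sop s = Ca k -> capat k (marks w).
Proof.
elim: s k => [s [[A'|] a] [[B'|] b] v|[[A'|] a] v|[[A'|] a] v|[[A'|] a] v v' s IH] //= k.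
  by case=> <-; rewrite /capat /= eqxx.
by case e: (sop s) => [|||k'] //= [<-]; exact: IH e.
Qed.

Lemma sop_cup w w' (s : step w w') k o : sop s = Cu k o -> k <= size (marks w).
Proof.
elim: s k => [s [[A'|] a] [[B'|] b] v|[[A'|] a] v|[[A'|] a] v|[[A'|] a] v v' s IH] //= k.
  by case=> <-.
by case e: (sop s) => [||k' o'|] //= [<- eo]; rewrite eo in e; exact: IH e.
Qed.

Lemma sop_unmarked w w' (s : step w w') : marks w = [::] -> marks w' = [::] -> sop s = Nop.
Proof.
by elim: s => [s [[A'|] a] [[B'|] b] v|[[A'|] a] v|[[A'|] a] v|[[A'|] a] v v' s IH] //=.
Qed.

(* Unmarked strands are labelled 0, marked ones by positive numbers. *)
Fixpoint labok (w : word) (l : seq nat) : bool :=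
  match w, l with
  | [::], [::] => true
  | x :: w, i :: l => (isSome x.1 == (i == 0)) && labok w l
  | _, _ => false
  end.

Local Notation marked_labels := (filter (leq 1)).

Lemma size_marked_labels w l : labok w l -> size (marked_labels l) = size (marks w).
Proof.
elim: w l => [|[[A'|] o] w IH] [|[|i] l] //= /IH //; by move=> ->.
Qed.

Definition mrename m (l : seq nat) : nat -> nat :=
  if m is Ca k then rename (nth 0 l k) (nth 0 l k.+1) else id.
Definition mlabels i m (l : seq nat) : seq nat :=
  match m with
  | Nop => l
  | Sw k => lsw k l
  | Cu k _ => lcu k i l
  | Ca k => lrem k (map (mrename m l) l)
  end.

Definition end_label (ρ : nat -> nat) (l l' : seq nat) (e : bool * nat) :=
  if e.1 then nth 0 l' e.2 else ρ (nth 0 l e.2).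

Lemma size_labok w l : labok w l -> size l = size w.
Proof. by elim: w l => [|x w IH] [|n l] //= /andP[_ /IH ->]. Qed.

Lemma mrename_skip m j l : mrename (mskip m) (j :: l) = mrename m l.
Proof. by case: m. Qed.
Lemma mlabels_skip i m j l :
  mlabels i (mskip m) (j :: l) = mrename m l j :: mlabels i m l.
Proof. by case: m. Qed.

(** Labels are carried through one slice: a cup introduces [i], and a cap merges the labels of the
    arcs it joins, which [ρ] applies to the source side. Ends of the same strand then agree. *)
Lemma label_step w w' (s : step w w') l i : 0 < i -> labok w l ->
  let ρ := mrename (sop s) (marked_labels l) in
  exists l', [/\ labok w' l', marked_labels l' = mlabels i (sop s) (marked_labels l),
    forall j, (ρ j == 0) = (j == 0) &
    forall e, e \in step_links s -> end_label ρ l l' e.1 = end_label ρ l l' e.2].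
Proof.
move=> i0; elim: s l => [s x y v [|j l]|x v l|x v [|j l]|x v v' s IH [|j l]] //=.
- case: x y l => [oA a] [oB b] [|k l] /=; first by rewrite andbF.
  move=> /and3P[/eqP Aj /eqP Bk lv]; exists [:: k, j & l]; split.
  + by rewrite /= Aj Bk !eqxx.
  + by rewrite /=; case: oA oB Aj Bk => [A'|] [B'|] /=; case: j k => [|j] [|k].
  + by case: oA oB {Aj Bk} => [A'|] [B'|].
  move=> e; rewrite !inE => /or3P[/eqP->|/eqP->|/mapP[n _ ->]];
    by case: oA oB {Aj Bk} => [A'|] [B'|].
- case: x => [oA a] lv; pose f := if oA is None then i else 0.
  exists [:: f, f & l]; split=> [||m|e].
  + by rewrite /= lv /f; case: oA {f} => //=; case: i i0.
  + by rewrite /f; case: oA {f} => //=; rewrite i0.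
  + by case: (oA).
  by rewrite inE => /orP[/eqP->|/mapP[n _ ->]] //; case: (oA).
- case: x l => [oA a] [|k l] /=; first by rewrite andbF.
  case: oA => [A'|] /=; case: j k => [|j] [|k] // lv.
    exists l; split=> // e; rewrite inE => /orP[/eqP->|/mapP[n _ ->]] //.
  have ρ0 n : (rename j.+1 k.+1 n == 0) = (n == 0).
    by rewrite /rename; case: (n =P k.+1) => [->|].
  exists (map (rename j.+1 k.+1) l); split=> // [||e].
  + by elim: v l lv => [|x v IH] [|n l] //= /andP[/eqP -> /IH ->]; rewrite ρ0 eqxx.
  + by rewrite filter_map; congr map; apply: eq_filter => n /=; rewrite !lt0n ρ0.
  rewrite inE => /orP[/eqP->|/mapP[n nv ->]] //=; rewrite /end_label /=.
    by rewrite /rename eqxx; case: eqP.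
  by rewrite (nth_map 0) // (size_labok lv); move: nv; rewrite mem_iota.
case: x => oA a /andP[/eqP Aj lv]; have [l' [lv' ml' ρ0 ll']] := IH _ lv.
set ρ := mrename (sop s) _ in ρ0 ll'.
have -> : mrename (if oA is None then mskip (sop s) else sop s)
    (if 0 < j then j :: marked_labels l else marked_labels l) = ρ.
  by case: oA Aj => [A'|]; case: j => //= j _; rewrite mrename_skip.
exists (ρ j :: l'); split=> //=.
- by rewrite lv' andbT Aj ρ0.
- rewrite ml' lt0n ρ0 -lt0n; case: oA Aj => [A'|]; case: j => //= j _.
  by rewrite mlabels_skip.
move=> e; rewrite inE => /orP[/eqP->|/mapP[n ns ->]] //=.
by have := ll' _ ns; rewrite /end_label /=; case: n.1.1; case: n.2.1.
Qed.

Definition colouring (E : seq (nat * nat * (nat * nat))) (l : seq nat) (κ : nat * nat -> bool) :=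
  (forall e, e \in E -> κ e.1 = κ e.2) /\
  (forall p q, nth 0 l p = nth 0 l q -> κ (0, p) = κ (0, q)).

(* The marked strands of D belong to one component once strands with equal labels
   are joined below D.  Connectedness is tested by colourings constant on
   components, which are easy to extend downwards by one slice. *)
Definition conn w w' (D : diagram w w') (l : seq nat) :=
  forall κ, colouring (diagram_links 0 D) l κ ->
  forall u v, marked (L := T) D u -> marked D v -> κ u = κ v.

Lemma diagram_links_shift h w w' (D : diagram (L := option T) w w') :
  diagram_links h.+1 D =
  [seq ((e.1.1.+1, e.1.2), (e.2.1.+1, e.2.2)) | e <- diagram_links h D].
Proof.
elim: D h => [//|v v' v'' s D IH] h /=; rewrite map_cat -IH -map_comp.
by congr (_ ++ _); apply: eq_map => e.
Qed.

Lemma marked0 w w' (D : diagram w w') l p : labok w l -> marked D (0, p) = (0 < nth 0 l p).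
Proof.
move=> lw; have -> : marked D (0, p) = if onth w p is Some (None, _) then true else false.
  by case: (D).
elim: w l p lw {w' D} => [|[[A'|] o] w IH] [|[|i] l] [|p] //= lw.
- by rewrite (IH l).
- by rewrite (IH l).
Qed.

Lemma colouring_cons v v' v'' (s : step (L := option T) v v') (D : diagram v' v'') l l' κ
    (κ0 : nat -> bool) :
  (forall e, e \in step_links s ->
     (if e.1.1 then κ (0, e.1.2) else κ0 (nth 0 l e.1.2)) =
     (if e.2.1 then κ (0, e.2.2) else κ0 (nth 0 l e.2.2))) ->
  colouring (diagram_links 0 D) l' κ ->
  colouring (diagram_links 0 (dcons s D)) l
    (fun u => if u.1 is h.+1 then κ (h, u.2) else κ0 (nth 0 l u.2)).
Proof.
move=> Hs [Hl _]; split=> [e|p q -> //]; rewrite mem_cat => /orP[/mapP[d ds ->]|].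
  by have := Hs _ ds => /=; case: d.1.1; case: d.2.1.
rewrite -[X in _ \in X]/(diagram_links 1 D) diagram_links_shift => /mapP[d /Hl + ->] /=.
by rewrite -!surjective_pairing.
Qed.

(** A colouring above the slice extends below it: a strand labelled [i] gets the colour of any
    strand labelled [ρ i] above. *)
Lemma conn_cons v v' v'' (s : step (L := option T) v v') (D : diagram v' v'') l l' ρ :
  (forall e, e \in step_links s -> end_label ρ l l' e.1 = end_label ρ l l' e.2) ->
  conn (dcons s D) l -> conn D l'.
Proof.
move=> Hs cD κ Hκ u w Du Dw.
have := cD _ (@colouring_cons _ _ _ s D l l' κ (fun i => κ (0, index (ρ i) l')) _ Hκ)
  (u.1.+1, u.2) (w.1.+1, w.2); rewrite /= -!surjective_pairing; apply=> // e es.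
(* Positions beyond the end read the default label 0. If 0 does not occur in [l'], its index is such
   a position as well, so the claim still holds. *)
have nthE p : κ (0, p) = κ (0, index (nth 0 l' p) l').
  apply: Hκ.2; have [pl|pl] := boolP (nth 0 l' p \in l'); first by rewrite nth_index.
  rewrite [RHS]nth_default; last by rewrite leqNgt index_mem.
  move: pl; apply: contraNeq => p0; apply: mem_nth; rewrite ltnNge.
  by apply: contra p0 => /(nth_default 0) ->.
have := Hs _ es; rewrite /end_label; case: e.1.1; case: e.2.1 => /= E;
  by rewrite ?(nthE e.1.2) ?(nthE e.2.2) E.
Qed.

Section Run.
Hypothesis tA : transparent A.
Hypothesis twistA : twist A = idm A.
Variable r : R.
Hypothesis loopA : forall C, (ev' A C ∘ coev A C = r *: idm C)%R.
Variables B C : T.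
Variable s0 : state A B C.
Hypothesis s00 : projT1 s0 = [::].

Fixpoint run w w' (D : diagram (L := option T) w w') (t : state A B C) : state A B C :=
  match D with
  | dnil _ => t
  | dcons _ _ _ s D' => run D' (ap (mop_aop C (sop s)) t)
  end.

Lemma run_scale w w' (D : diagram w w') c t : run D (scale c t) = scale c (run D t).
Proof.
elim: D t => [//|v v' v'' s D IH] t /=.
by rewrite -IH /ap /scale /= compZr.
Qed.

Lemma run_mactD w w' (D : diagram w w') (f : hom B (M A (marks w) C)) :
  run D (State f) = State (mactD A D C ∘ f).
Proof.
elim: D f => [v|v v' v'' s D IH] f /=; first by rewrite comp1m.
by rewrite /ap /= sopE /= IH compA.
Qed.

Lemma projT1_ap_sop w w' (s : step (L := option T) w w') (t : state A B C) :
  projT1 t = marks w -> projT1 (ap (mop_aop C (sop s)) t) = marks w'.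
Proof. by case: t => u f /= ->; rewrite sopE. Qed.

Lemma unmarked_labels w w' (D : diagram w w') l : labok w l ->
  (forall u, ~~ marked D u) -> marked_labels l = [::].
Proof.
move=> lw Du; apply/eqP; rewrite -(negbK (_ == _)) -has_filter; apply/hasPn => i il.
have := Du (0, index i l); rewrite (marked0 _ _ lw) nth_index //.
Qed.

Lemma run_unmarked w w' (D : diagram w w') l t : labok w l ->
  good s0 (marked_labels l, t) -> marks w' = [::] -> (forall u, ~~ marked D u) ->
  run D t = s0.
Proof.
elim: D l t => [v|v v' v'' s D IH] l t lv gt v0 Du.
  have /= := good_base s00 gt; apply; exact: unmarked_labels Du.
have ml0 := unmarked_labels lv Du.
have [l' [lv' ml' _ _]] := label_step s (ltn0Sn 0) lv.
have Du' u : ~~ marked D u by exact: (Du (u.1.+1, u.2)).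
have mv' : marks v' = [::].
  by apply/nilP; rewrite /nilp -(size_marked_labels lv') (unmarked_labels lv' Du').
have mv : marks v = [::].
  by apply/nilP; rewrite /nilp -(size_marked_labels lv) ml0.
rewrite /= (sop_unmarked s mv mv') ap_id; apply: IH lv' _ v0 Du'.
by rewrite ml' (sop_unmarked s mv mv').
Qed.

(** Either a cap closes an arc into a circle, or the state stays good. In the second case no labels
    can vanish altogether, so the component cannot end without a circle being closed. *)
Lemma good_step w w' (s : step (L := option T) w w') l i t :
  let S := (l, t) in let m := sop s in
  good s0 S -> projT1 t = marks w -> i \notin l ->
  (exists k t', [/\ m = Ca k, nth 0 l k = nth 0 l k.+1, k.+1 < size l,
      good s0 (mlabels i m l, t') &
      (nth 0 l k \notin mlabels i m l) /\ ap (mop_aop C m) t = scale r t'])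
  \/ good s0 (mlabels i m l, ap (mop_aop C m) t) /\ (mlabels i m l = [::] -> l = [::]).
Proof.
move=> S m gS tw il; have wS := good_wf s00 gS.
case e: m => [|k|k o|k].
- by right; rewrite /= ap_id.
- right; split; first exact: good_sw gS.
  by move=> /(congr1 size) /=; rewrite size_lsw => /size0nil.
- right; split; first apply: (good_cup s00 o gS il).
    by have := sop_cup e; rewrite -tw -wS.
  by case: k e => [|k] //= _; case: (l).
have cS : capat k (projT1 S.2) by rewrite tw; exact: (sop_capat e).
have kS : k.+1 < size l by move: wS; rewrite /wf /= => ->; case/andP: cS.
have [ij|ij] := eqVneq (nth 0 l k) (nth 0 l k.+1).
  left; have [[l' t'] [/= gt' tl it tE]] := good_cap_eq_at tA twistA loopA s00 gS cS ij.
  have ri : map (mrename (Ca k) l) l = l.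
    rewrite -[RHS]map_id; apply: eq_map => n; rewrite /= /rename ij.
    by case: eqP.
  exists k, t'; move: gt' it; rewrite {}tl /mlabels ri => gt' it.
  by split.
right; split; first exact: good_cap_neq_at gS cS ij.
case: k l {e cS} @S gS kS ij {tw il wS} => [|k] [|x [|y [|z l]]] //= gS _ xy _.
(* Every label occurs twice, so two different labels cannot make up the whole list. *)
have := good_count tA s00 (i := x) gS; rewrite /= inE !eqxx eq_sym (negPf xy).
by move=> /(_ isT).
Qed.

Lemma fresh_label (l : seq nat) : exists2 i, 0 < i & i \notin l.
Proof.
exists (foldr maxn 0 l).+1 => //; apply/negP => il.
suff H : forall j, j \in l -> j <= foldr maxn 0 l by have := H _ il; rewrite ltnn.
elim: l {il} => //= j l IH n; rewrite inE => /orP[/eqP->|/IH nl]; first exact: leq_maxl.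
by rewrite (leq_trans nl) // leq_maxr.
Qed.

(** The first circle that is closed must be the entire component; no marked strand follows, and the
    rest of the run changes nothing. *)
Lemma run_component w w' (D : diagram w w') l t : labok w l -> projT1 t = marks w ->
  good s0 (marked_labels l, t) -> marks w' = [::] -> conn D l ->
  (exists u, marked D u) -> run D t = scale r s0.
Proof.
elim: D l t => [v|v v' v'' s D IH] l t lv tv gt v0 cD [u Du].
  have l0 : marked_labels l = [::].
    by apply/nilP; rewrite /nilp (size_marked_labels lv) v0.
  case: u Du => [[|h] p]; last by case: h p => [|h] [|p].
  rewrite (marked0 _ _ lv) => lp; have : nth 0 l p \in marked_labels l.
    by rewrite mem_filter lp mem_nth // ltnNge; apply: contraL lp => /(nth_default 0) ->.
  by rewrite l0.
have [i i0 il] := fresh_label (marked_labels l).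
have [l' [lv' ml' ρ0 ll']] := label_step s i0 lv.
have Dc h p : marked (dcons s D) (h.+1, p) = marked D (h, p) by [].
have [[k [t' [mE ij kl gt' [jl tE]]]]|[gt' ne]] := good_step s gt tv il; last first.
  rewrite -ml' in gt' ne.
  apply: (IH l' _ lv' _ gt' v0 (conn_cons ll' cD)); first exact: projT1_ap_sop.
  have [//|Du'] := pselect (exists u, marked D u); exfalso.
  have ml0 := ne (unmarked_labels lv' (fun u => introN idP (fun Dv => Du' (ex_intro _ u Dv)))).
  case: u Du => [[|h] p]; last by rewrite Dc => Dv; case: Du'; exists (h, p).
  rewrite (marked0 _ _ lv) => lp; have : nth 0 l p \in marked_labels l.
    by rewrite mem_filter lp mem_nth // ltnNge; apply: contraL lp => /(nth_default 0) ->.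
  by rewrite ml0.
rewrite /= tE run_scale (run_unmarked lv' _ v0) //; first by rewrite ml'.
set j := nth 0 (marked_labels l) k in ij jl.
have jL : j \in marked_labels l by apply: mem_nth; exact: ltnW.
have j0 : 0 < j by move: jL; rewrite mem_filter => /andP[].
have Hρ n : mrename (sop s) (marked_labels l) n = n.
  by rewrite mE /= -ij /rename; case: eqP.
have j'l p : (nth 0 l' p == j) = false.
  apply/negbTE; apply: contra jl => /eqP pj; rewrite -ml' mem_filter.
  rewrite -pj in j0 *; rewrite j0 mem_nth // ltnNge.
  by apply: contraL j0 => /(nth_default 0) ->.
move=> [h p]; apply/negP => Dp.
(* The test colouring singles out label [j] below the cap and is false above, where [j] no longer
   occurs. A later marked strand would contradict connectedness. *)
have cκ : colouring (diagram_links 0 D) l' (fun=> false) by split.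
have Dj : marked (dcons s D) (0, index j l).
  rewrite (marked0 _ _ lv) nth_index //.
  by move: jL; rewrite mem_filter => /andP[].
have := cD _ (@colouring_cons _ _ _ s D l l' _ (fun i => i == j) _ cκ) (0, index j l) (h.+1, p) Dj Dp.
rewrite /= nth_index; last by move: jL; rewrite mem_filter => /andP[].
rewrite eqxx => H; suff : true = false by []. 
apply: H => e es; have := ll' _ es; rewrite /end_label !Hρ.
by case: e.1.1; case: e.2.1 => // E; rewrite ?E ?j'l // -E j'l.
Qed.

End Run.
End Component.

(** * Condition (c) against transparent simple objects with trivial twist *)

Section Detection.
Variables (R : comNzRingType) (T : tortile_category R) (S : semisimple T).

Lemma marks_mark (w : word T) : marks (mark w) = [::].
Proof. by elim: w. Qed.
Lemma labok_mark (w : word T) : labok (mark w) (nseq (size w) 0%N).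
Proof. by elim: w. Qed.

Lemma conn_component (s t : word T) (D : diagram (mark s) (mark t)) l :
  marks_closed_component D -> conn D l.
Proof.
move=> [_ H] κ [κE _] u v Du Dv; have [q] := H u v Du Dv.
elim: q u {Du H} => [|x q IH] u [/= + e]; first by rewrite e.
by move=> /andP[/orP[] /κE /= ux xq]; [rewrite ux|rewrite -ux]; apply: IH.
Qed.

(** Each of the two components acts on the empty word as the rank of [A], however it is knotted or
    linked. *)
Lemma mactD_component A (s t : word T) (D D' : diagram (mark s) (mark t)) C :
  transparent A -> twist A = idm A ->
  marks_closed_component D -> marks_closed_component D' -> mactD A D C = mactD A D' C.
Proof.
move=> tA twA cD cD'; pose s0 := State (idm (M A (marks (mark s)) C)).
have s00 : projT1 s0 = [::] by exact: marks_mark.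
have E (D0 : diagram (mark s) (mark t)) : marks_closed_component D0 -> run D0 s0 = scale (rank A) s0.
  move=> c; refine (run_component (t := s0) tA twA (fun C => loop S A C) s00 (labok_mark s) erefl _ _ _ _).
  - by have -> : filter (leq 1) (nseq (size s) 0%N) = [::] :> seq nat; [elim: (size s)|exact: good_nil].
  - exact: marks_mark.
  - exact: conn_component c.
  - by case: c.
have := E D cD; rewrite -(E _ cD') !run_mactD !compm1.
by move/eqP; rewrite eq_Tagged /= => /eqP.
Qed.

Lemma detected_twisted (a : simple S) :
  transparent (sobj a) -> twist (sobj a) = idm (sobj a) -> ~ detected a.
Proof.
move=> ta twa [s [t [D [D' [cD cD' e []]]]]].
by apply: (eval_erase ta) => // C; exact: mactD_component.
Qed.
End Detection.

(** * Homology of the two complexes *)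

Lemma boundary2_commutator : boundary2 P_commutator = 0.
Proof.
apply/matrixP => j k; rewrite !mxE /exponent_sum; case: j => -[|//] _ /=.
by rewrite !big_cons big_nil; case: k => -[|[|//]] kP.
Qed.

Lemma boundary2_trivial : boundary2 P_trivial = 0.
Proof.
apply/matrixP => j k; rewrite !mxE /exponent_sum; case: j => -[|//] _ /=.
by rewrite big_nil.
Qed.

Lemma same_homology_commutator_trivial : same_homology P_commutator P_trivial.
Proof.
have sub m n (x : 'rV[int]_n) : (exists c : 'rV_m, x = c *m 0) <-> x = 0.
  by split=> [[c ->]|->]; [rewrite mulmx0 | exists 0; rewrite mulmx0].
rewrite /same_homology boundary2_commutator boundary2_trivial.
split; exists id, id; split=> // x.
- by rewrite subrr sub.
- by rewrite subrr sub.
- by move=> x' _ _; rewrite subrr sub.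
- by rewrite mulmx0 subrr.
- by rewrite mulmx0 subrr.
by move=> x' _ _; rewrite subrr.
Qed.

Theorem mainTheorem4 (p : nat) (p_prime : prime p)
    (T : tortile_category (Rp p)) (S : semisimple T)
    (S_nontrivial : (1 < #|simple S|)%N)
    (abcd : conditions_abcd S (vp p)) :
  [/\ has_ZQ S P_commutator (#|simple S|%:R),
      has_ZQ S P_trivial 0 &
      #|simple S|%:R != 0 :> 'F_p ->
      ~ ZQ_determined_by_homology S (fun P => euler_char P <= 0)].
Proof.
case: abcd => _ [regC _] det tw; have domR := mulRp_eq0 p_prime.
(* Both signs serve later: the commutator link is cut with [false], and the reduction mod $p$ uses
   [true]. *)
have kill s a C : a != sone S -> K S s (sobj a) C = 0.
  move=> a1; have [//|ta] := K_dichotomy domR s a.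
  by case: (detected_twisted ta (transparent_twist ta regC) (det a a1)).
have ZQc : has_ZQ S P_commutator (#|simple S|%:R).
  (* With two generators the normalization is $X^{-4}$, against $Z=X^4|S|$. *)
  exists (#|simple S|%:R); last exact: phi_nat.
  by rewrite (Zlink_commutator domR) // => a C; exact: kill.
have [y y1] : exists y, y != sone S.
  move: S_nontrivial; rewrite (cardD1 (sone S)) inE ltnS => /card_gt0P[y].
  by rewrite !inE andbT => y1; exists y.
have ZQt : has_ZQ S P_trivial 0.
  (* Here $X^{-4}X^6=X^2$ is what has to vanish mod $p$. *)
  exists (X2 S); first by rewrite Zlink_trivial -exprSr.
  exact: (phi_X2 p_prime tw (kill true y one y1)).
split=> // c0 H; case/eqP: c0.
by apply: H ZQc ZQt => //; exact: same_homology_commutator_trivial.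
Qed.
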